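(* Let $r\geq k\geq 4$ be fixed integers and let $n\in\mathbb{N}$ be sufficiently large (depending on $r$ and $k$). Then \[S^k_{2r}(n)=\max_{n_1+\dots+n_r=n}f_k(n_1,\dots,n_r),\] where the maximum is over all $r$-tuples of non-negative integers with sum $n$, and \[f_k(n_1,\dots,n_r)=\left(\sum_{\mathcal{I}\in\binom{[r]}{k}}\prod_{i\in\mathcal{I}}n_i\right) +\left(\sum_{1\leq\ell\leq\lfloor k/2\rfloor}\ \sum_{\mathcal{J}\in\binom{[r]}{\ell}}\left(\prod_{j\in\mathcal{J}}(n_j-\mathbf{1}_{n_j\notin 4\mathbb{Z}})\right)\left(\sum_{\mathcal{I}\in\binom{[r]\setminus\mathcal{J}}{k-2\ell}}\prod_{i\in\mathcal{I}}n_i\right)\right).\]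
   Context: For an integer $k\geq 3$, a regular $(k-1)$-simplex is a set of $k$ points in Euclidean space whose pairwise distances are all equal. $S^k_d(n)$ denotes the maximum number of regular $(k-1)$-simplices (of any side lengths) spanned by a set of $n$ points in $\mathbb{R}^d$, where a simplex is spanned by a point set if all its vertices lie in the set. Notation: $[r]=\{1,\dots,r\}$; $\binom{A}{m}$ is the family of all $m$-element subsets of a set $A$ (so $\binom{A}{0}=\{\emptyset\}$, and an empty product equals $1$); $\mathbf{1}_{A}$ equals $1$ if the condition $A$ holds and $0$ otherwise; $4\mathbb{Z}$ is the set of integers divisible by $4$. *)

(* Defs.v *)
From mathcomp Require Import all_boot all_order all_algebra.
From mathcomp Require Import finmap boolp reals.

Set Implicit Arguments.
Unset Strict Implicit.
Unset Printing Implicit Defensive.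

Import Order.TTheory GRing.Theory Num.Theory.
Local Open Scope fset_scope.
Local Open Scope ring_scope.

(* The canonical norm on 'rV[R]_d in MathComp-Analysis is the sup norm, hence
   this explicit Euclidean distance. *)
Definition edist (R : realType) (d : nat) (x y : 'rV[R]_d) : R :=
  Num.sqrt (\sum_(i < d) (x ord0 i - y ord0 i) ^+ 2).

(* The (k-1)-simplex is identified with its set of k vertices. *)
Definition regular_simplex (R : realType) (d k : nat)
    (S : {fset 'rV[R]_d}) : bool :=
  (#|` S| == k) &&
  `[< exists a : R, forall x y, x \in S -> y \in S -> x != y -> edist x y = a >].

Definition num_simplices (R : realType) (d k : nat)
    (P : {fset 'rV[R]_d}) : nat :=
  #|` [fset S in fpowerset P | regular_simplex k S]|.

(* A set of n points spans at most 'C(n, k) simplices, so the bound on m loses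
   nothing: see [max_simplices_ub] and [max_simplices_attained]. If no set of n
   points exists (d = 0 and 1 < n), the value is 0. *)
Definition max_simplices (R : realType) (k d n : nat) : nat :=
  (\max_(m < 'C(n, k).+1 |
     `[< exists P : {fset 'rV[R]_d}, #|` P| = n /\ num_simplices k P = m >]) m)%N.

Lemma num_simplices_le (R : realType) (d k : nat) (P : {fset 'rV[R]_d}) :
  (num_simplices k P <= 'C(#|` P|, k))%N.
Proof.
pose T : finType := P.
pose g (A : {set T}) : {fset 'rV[R]_d} := [fset val x | x in A].
pose D := [set A : {set T} | #|A| == k].
have -> : 'C(#|` P|, k) = #|D| by rewrite card_draws cardfE.
rewrite /num_simplices.
apply: leq_trans (fsubset_leq_card (_ : _ `<=` [fset g A | A in D])) _; last first.
  by apply: leq_trans (leq_imfset_card _ _ _) _; rewrite // cardE.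
apply/fsubsetP => S; rewrite !inE /= => /andP[].
rewrite fpowersetE => SP /andP[/eqP Sk _].
have Sg : S = g [set x : T | val x \in S].
  apply/fsetP => x; apply/idP/imfsetP => [xS|[y /= + ->]]; last by rewrite inE.
  by exists [` fsubsetP SP _ xS] => //=; rewrite inE.
apply/imfsetP; exists [set x : T | val x \in S] => //=.
rewrite inE -Sk [in X in _ == X]Sg card_imfset /=; last exact: val_inj.
by rewrite cardE.
Qed.

Lemma max_simplices_ub (R : realType) (k d n : nat) (P : {fset 'rV[R]_d}) :
  #|` P| = n -> (num_simplices k P <= max_simplices R k d n)%N.
Proof.
move=> Pn; have := num_simplices_le k P; rewrite Pn -ltnS => lt.
apply: (@leq_bigmax_cond _ _ (fun m : 'I_('C(n, k).+1) => val m) (Ordinal lt)).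
by apply/asboolP; exists P.
Qed.

Lemma max_simplices_attained (R : realType) (k d n : nat)
    (P0 : {fset 'rV[R]_d}) :
  #|` P0| = n ->
  exists P : {fset 'rV[R]_d},
    #|` P| = n /\ num_simplices k P = max_simplices R k d n.
Proof.
move=> Pn; have := num_simplices_le k P0; rewrite Pn -ltnS => lt.
rewrite /max_simplices (@bigop.bigmax_eq_arg _ (Ordinal lt)); last first.
  by apply/asboolP; exists P0.
by case: arg_maxnP => [|i /asboolP //]; apply/asboolP; exists P0.
Qed.

Local Open Scope nat_scope.

(* Both subtractions are genuine: 0 is a multiple of 4, and 2 * l <= k. *)
Definition fk (r k : nat) (nu : 'I_r -> nat) : nat :=
  \sum_(I : {set 'I_r} | #|I| == k) \prod_(i in I) nu i +
  \sum_(1 <= l < (k %/ 2).+1)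
    \sum_(J : {set 'I_r} | #|J| == l)
      (\prod_(j in J) (nu j - ~~ (4 %| nu j))) *
      (\sum_(I : {set 'I_r} | (I \subset ~: J) && (#|I| == k - 2 * l))
         \prod_(i in I) nu i).

(* Main.v *)
Require Import Defs.
From mathcomp Require Import all_boot all_order all_algebra.
From mathcomp Require Import finmap boolp reals.
From mathcomp Require Import zify ring lra.

(** Lower bound.  Take r pairwise orthogonal planes through a common point and
    a circle of radius 1 around that point in each of them.  Two points of
    different circles are at squared distance 2, and so are two points of one
    circle that differ by a quarter turn.  A k-set that meets every circle in
    nothing, in one point or in the two ends of a quarter turn is therefore a
    regular simplex, and the number of these sets is the sum of products
    defining [fk] ([card_configs], [fk_profile_sum]): n points on a circle can
    span n quarter turns if 4 divides n and n - 1 otherwise.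

    Upper bound for such a Lenz configuration.  Quarter turns join each point
    to at most two others, and if each point of a circle has two of them then
    the points of the circle fall into squares ([card_edges]).  As k is at
    least 4, a simplex cannot lie in one circle, so its squared side is 2 and
    it is one of the sets just counted ([card_lenz_simplices]).

    Reduction to Lenz configurations.  Suppose that n points span more than
    [max_fk n] simplices.  If every point were in nearly as many simplices as
    in a balanced Lenz configuration, then the points would form a Lenz
    configuration ([lenz_structure]), which the previous paragraph excludes.
    So some point is in fewer than [max_fk n - max_fk (n - 1)] simplices, and
    without it the remaining points exceed [max_fk (n - 1)] by more than
    before ([excess_grows]).  Descending from n to a fixed N yields an excess
    of at least n - N on N points, which is absurd once n is large.

    Why large degrees force a Lenz configuration.  The geometric input is
    [box_frame]: if U_1, ..., U_r have at least three points each and the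
    distance between points of U_i and U_j depends on i and j only, then the
    U_i span pairwise orthogonal planes, which exhaust the space, and a point
    equidistant from three points of U_j has no component in the plane of U_j.
    In particular no such U_1, ..., U_r with a single mutual distance a lie on
    a sphere of radius a around a further point.  By [box_exists] the graph of
    distance a on that sphere then has few r-cliques, and by Moon and Moser's
    inequality its number of (k-1)-cliques is asymptotically at most that of a
    balanced complete (r-1)-partite graph ([local_density]).

    The side lengths of the simplices vary, but as k is at least 4 the
    distances that occur rarely contribute few simplices ([card_rare]), and
    only boundedly many distances are left.  Hence almost every point has at
    least about (1 - 1/r) n points at such a frequent distance
    ([palette_exists]), which allows one to choose r-tuples of typical points
    greedily, to fix their mutual distances by pigeonhole, and to find
    U_1, ..., U_r as above with many points ([typical_box]).  The points of
    the U_i miss only about n/r points each, whereas every point but the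
    centre is missed by most of some U_i; so almost every point is missed by
    just one U_i and lies in its plane, at one of boundedly many distances
    from the centre ([planes_exist]).  Two applications of the degree
    condition through [large_sphere] show that these points lie on circles of
    one radius ([circles_exist]) and that there are no other points
    ([lenz_structure]). *)

Set Implicit Arguments.
Unset Strict Implicit.
Unset Printing Implicit Defensive.

Import Order.TTheory GRing.Theory Num.Theory.
Local Open Scope ring_scope.

(** * Boxes in dense relations *)

Section Box.
Variable R : realType.

Definition count_tuples (T : finType) (r : nat) (E : pred (seq T)) : nat :=
  #|[set s : r.-tuple T | E s]|.

Lemma count_tuplesS (T : finType) (r : nat) (E : pred (seq T)) :
  count_tuples r.+1 E = (\sum_(s : r.-tuple T) #|[set x | E (x :: s)]|)%N.
Proof.
rewrite /count_tuples -sum1dep_card.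
rewrite (reindex (fun u : T * r.-tuple T => cons_tuple u.1 u.2)) /=; last first.
  exists (fun s : r.+1.-tuple T => (thead s, behead_tuple s)).
    by case=> x s _ /=; congr pair; apply: val_inj.
  by move=> s _; rewrite [in RHS](tuple_eta s); apply: val_inj.
rewrite -(pair_big_dep xpredT (fun (x : T) (s : r.-tuple T) => E (x :: s)) (fun _ _ => 1%N)) /=.
rewrite (exchange_big_dep xpredT) //=; apply: eq_bigr => s _.
by rewrite sum1dep_card.
Qed.

Lemma count_tuples0 (T : finType) (E : pred (seq T)) : count_tuples 0 E = E [::].
Proof.
rewrite /count_tuples; case: (boolP (E [::])) => h.
  have -> : [set s : 0.-tuple T | E s] = setT.
    by apply/setP => s; rewrite !inE tuple0 h.
  by rewrite cardsT card_tuple expn0.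
apply/eqP; rewrite cards_eq0; apply/eqP/setP => s; rewrite !inE tuple0.
exact: negbTE.
Qed.

Lemma sumr_cst (I : finType) (P : pred I) (c : R) :
  \sum_(i | P i) c = c * #|[set i | P i]|%:R.
Proof. by rewrite -sum1dep_card natr_sum mulr_sumr; apply: eq_bigr => i _; rewrite mulr1. Qed.

(** Values below [c * b] contribute at most half of the sum. *)
Lemma card_heavy (I : finType) (F : I -> R) (b c : R) :
  0 <= b -> 0 <= c -> (forall i, F i <= b) ->
  (c + c) * b * #|I|%:R <= \sum_i F i ->
  c * #|I|%:R * b <= #|[set i | c * b <= F i]|%:R * b.
Proof.
move=> b0 c0 Fb; rewrite (bigID (fun i => c * b <= F i)) /= => h.
have h1 : \sum_(i | c * b <= F i) F i <= #|[set i | c * b <= F i]|%:R * b.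
  rewrite -sum1dep_card natr_sum mulr_suml; apply: ler_sum => i _.
  by rewrite mul1r.
have h2 : \sum_(i | ~~ (c * b <= F i)) F i <= c * b * #|I|%:R.
  apply: le_trans (_ : \sum_(i | ~~ (c * b <= F i)) c * b <= _).
    by apply: ler_sum => i; rewrite -ltNge => /ltW.
  rewrite sumr_cst; apply: ler_wpM2l; first exact: mulr_ge0.
  by rewrite ler_nat max_card.
by lra.
Qed.

(** The bound is multiplied by [#|T|] so that no predecessor of t occurs in an
    exponent. *)
Lemma card_noninj_tuple (T : finType) (t : nat) :
  (#|[set s : t.-tuple T | ~~ uniq s]| * #|T| <= t * t * #|T| ^ t)%N.
Proof.
elim: t => [|t IH].
  by rewrite (_ : #|_| = 0%N) //; apply: eq_card0 => s; rewrite tuple0 inE.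
rewrite -[X in (X * _ <= _)%N]/(count_tuples t.+1 (fun s : seq T => ~~ uniq s)) count_tuplesS.
have -> : (\sum_(s : t.-tuple T) #|[set x | ~~ uniq (x :: s)]| =
   \sum_(s : t.-tuple T | uniq s) #|[set x | ~~ uniq (x :: s)]| +
   \sum_(s : t.-tuple T | ~~ uniq s) #|[set x | ~~ uniq (x :: s)]|)%N.
  by rewrite (bigID (fun s : t.-tuple T => uniq s)).
rewrite expnSr mulnA leq_mul2r; apply/orP; right.
apply: leq_trans (_ : t * #|T| ^ t + t * t * #|T| ^ t <= _)%N; last first.
  by rewrite -mulnDl leq_mul2r; apply/orP; right; nia.
apply: leq_add.
  apply: leq_trans (_ : \sum_(s : t.-tuple T) t <= _)%N.
    rewrite [X in (_ <= X)%N](bigID (fun s : t.-tuple T => uniq s)) /=.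
    apply: leq_trans (leq_addr _ _); apply: leq_sum => s us.
    rewrite -[X in (_ <= X)%N](size_tuple s); apply: leq_trans (card_size s).
    by apply/subset_leq_card/subsetP => x; rewrite !inE us andbT negbK.
  by rewrite sum_nat_const card_tuple mulnC.
apply: leq_trans (_ : \sum_(s : t.-tuple T | ~~ uniq s) #|T| <= _)%N.
  by apply: leq_sum => s _; exact: max_card.
by rewrite sum_nat_const; move: IH; rewrite cardsE.
Qed.

Lemma card_tuple_all (T : finType) (t : nat) (A : {set T}) :
  #|[set h : t.-tuple T | all (mem A) h]| = (#|A| ^ t)%N.
Proof.
elim: t => [|t IHt].
  by rewrite expn0 -[LHS]/(count_tuples 0 (fun h => all (mem A) h)) count_tuples0.
rewrite -[LHS]/(count_tuples t.+1 (fun h => all (mem A) h)) count_tuplesS.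
rewrite (bigID (fun h : t.-tuple T => all (mem A) h)) /=.
rewrite [X in (_ + X)%N]big1 ?addn0; last first.
  move=> h /negbTE hh; apply/eqP; rewrite cards_eq0; apply/eqP/setP => x.
  by rewrite !inE hh andbF.
rewrite expnS -IHt mulnC -sum1dep_card big_distrl /=; apply: eq_bigr => h ->.
by rewrite mul1n; apply: eq_card => x; rewrite !inE andbT.
Qed.

(** Kovari, Sos and Turan's argument for r-ary relations, by induction on r: a
    positive proportion of the tails s have many heads x with [E (x :: s)], so by
    averaging some t distinct heads share a positive proportion of the tails.
    The sides of the box need not be disjoint. *)
Lemma box_exists (r t : nat) (c : R) : 0 < c -> exists M : nat,
  forall (T : finType) (E : pred (seq T)), (M <= #|T|)%N ->
    c * #|T|%:R ^+ r <= (count_tuples r E)%:R ->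
  exists U : seq {set T}, [/\ size U = r, all (fun A : {set T} => #|A| == t) U
    & forall s, all2 (fun x (A : {set T}) => x \in A) s U -> E s].
Proof.
elim: r c => [|r IH] c c0.
  exists 0%N => T E _; rewrite expr0 mulr1 count_tuples0 => h.
  exists [::]; split=> // -[] // _.
  by move: h; case: (E [::]) => // h; move: (lt_le_trans c0 h); rewrite ltxx.
pose c2 := c / 2.
have c20 : 0 < c2 by rewrite /c2; lra.
pose c3 := c2 ^+ t.+1 / 2.
have c30 : 0 < c3 by rewrite /c3 divr_gt0 // exprn_gt0.
have [M hM] := IH c3 c30.
pose M1 := (Num.truncn ((t * t)%:R / c3)).+1.
exists (maxn M M1).+1 => T E hT hE.
have T0 : (0 < #|T|)%N by lia.
set m : R := #|T|%:R.
have m0 : 0 < m by rewrite ltr0n.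
(* the tails with a proportion c / 2 of possible heads *)
pose F (s : r.-tuple T) : R := #|[set x | E (x :: s)]|%:R.
pose H := [set s : r.-tuple T | c2 * m <= F s].
have hH : c2 * m ^+ r <= #|H|%:R.
  have := @card_heavy _ F m c2 (ltW m0) (ltW c20).
  rewrite card_tuple natrX -/m => h.
  rewrite -(ler_pM2r m0); apply: h.
    by move=> s; rewrite ler_nat max_card.
  rewrite -natr_sum -count_tuplesS; apply: le_trans hE.
  by rewrite exprS /c2; lra.
(* double counting of the pairs (t heads, common tail) *)
pose G (h : t.-tuple T) := [set s : r.-tuple T | all (fun x => E (x :: s)) h].
have cnt : c2 ^+ t.+1 * m ^+ r * m ^+ t <= \sum_(h : t.-tuple T) #|G h|%:R.
  have -> : \sum_(h : t.-tuple T) #|G h|%:R =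
     \sum_(s : r.-tuple T) (#|[set x | E (x :: s)]|%:R ^+ t) :> R.
    rewrite -natr_sum.
    under eq_bigr do rewrite -sum1dep_card.
    rewrite (exchange_big_dep xpredT) //= natr_sum; apply: eq_bigr => s _.
    rewrite sum1dep_card -natrX; congr (_%:R).
    have -> : [set h : t.-tuple T | all (fun x => E (x :: s)) h] =
       [set h : t.-tuple T | all (mem [set x | E (x :: s)]) h].
      by apply/setP => h; rewrite !inE; apply: eq_all => x; rewrite /= inE.
    exact: card_tuple_all.
  apply: le_trans (_ : \sum_(s in H) (c2 * m) ^+ t <= _).
    rewrite sumr_cst cardsE.
    have -> : (c2 * m) ^+ t = c2 ^+ t * m ^+ t by exact: exprMn.
    have -> : c2 ^+ t.+1 = c2 * c2 ^+ t by exact: exprS.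
    have -> : c2 * c2 ^+ t * m ^+ r * m ^+ t = c2 ^+ t * m ^+ t * (c2 * m ^+ r) by ring.
    by apply: ler_wpM2l => //; apply/ltW/mulr_gt0; apply: exprn_gt0.
  rewrite [leRHS](bigID (mem H)) /=; apply: ler_wpDr.
    by apply: sumr_ge0 => s _; rewrite exprn_ge0.
  apply: ler_sum => s; rewrite inE => hs.
  apply: lerXn2r => //; rewrite nnegrE //.
  exact: mulr_ge0 (ltW c20) (ltW m0).
have [h0 [uh0 hh0]] : exists h : t.-tuple T, uniq h /\ c3 * m ^+ r <= #|G h|%:R.
  apply: contrapT => /forallNP hn.
  have : \sum_(h : t.-tuple T) #|G h|%:R <
         c2 ^+ t.+1 * m ^+ r * m ^+ t.
    rewrite (bigID (fun h : t.-tuple T => uniq h)) /=.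
    have -> : c2 ^+ t.+1 * m ^+ r * m ^+ t = c3 * m ^+ r * m ^+ t + c3 * m ^+ r * m ^+ t.
      by rewrite /c3; field.
    apply: ler_ltD.
      apply: le_trans (_ : \sum_(h : t.-tuple T | uniq h) c3 * m ^+ r <= _).
        apply: ler_sum => h uh; rewrite leNgt; apply/negP => hlt.
        by apply: (hn h); split=> //; exact: ltW.
      rewrite sumr_cst; apply: ler_wpM2l.
        by rewrite mulr_ge0 ?exprn_ge0 // ltW.
      by rewrite -natrX ler_nat -card_tuple max_card.
    apply: le_lt_trans (_ : \sum_(h : t.-tuple T | ~~ uniq h) m ^+ r < _).
      by apply: ler_sum => h _; rewrite -natrX ler_nat -card_tuple max_card.
    rewrite sumr_cst mulrC.
    have -> : c3 * m ^+ r * m ^+ t = (c3 * m ^+ t) * m ^+ r by ring.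
    rewrite ltr_pM2r ?exprn_gt0 //.
    rewrite -(ltr_pM2r m0); apply: le_lt_trans (_ : (t * t)%:R * m ^+ t < _).
      by rewrite -natrX -!natrM ler_nat card_noninj_tuple.
    rewrite mulrAC ltr_pM2r ?exprn_gt0 // mulrC -ltr_pdivrMr //.
    by apply: lt_le_trans (truncnS_gt _) _; rewrite ler_nat -/M1; lia.
  by move=> hlt; move: (le_lt_trans cnt hlt); rewrite ltxx.
have [|U [sU aU hU]] := hM T (fun s => all (fun x => E (x :: s)) h0) _ hh0.
  by lia.
exists ([set x in h0] :: U); split => //=.
- by rewrite sU.
- by rewrite aU andbT cardsE (card_uniqP uh0) size_tuple.
- case=> [|x s] //= /andP[]; rewrite inE => xh /hU /allP; exact.
Qed.
End Box.

(** * Clique counts *)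

Section MoonMoser.
Variables (T : finType) (e : rel T).
Hypotheses (e_sym : symmetric e) (e_irr : irreflexive e).
Variable V : {set T}.

Definition cliques (j : nat) : {set {set T}} :=
  [set A : {set T} | [&& A \subset V, #|A| == j &
     [forall x in A, forall y in A, (x != y) ==> e x y]]].

Definition extenders (L : {set T}) : {set T} :=
  [set x in V | [forall y in L, e x y]].

Lemma cliquesP (j : nat) (A : {set T}) :
  reflect [/\ A \subset V, #|A| = j & forall x y, x \in A -> y \in A -> x != y -> e x y]
          (A \in cliques j).
Proof.
rewrite inE; apply: (iffP and3P) => [[AV /eqP Aj h]|[AV Aj h]]; split=> //.
- by move=> x y xA yA xy; move/forall_inP: h => /(_ x xA)/forall_inP/(_ y yA)/implyP; exact.
- exact/eqP.
- by apply/forall_inP => x xA; apply/forall_inP => y yA; apply/implyP; exact: h.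
Qed.

Lemma extender_notin (L : {set T}) x : x \in extenders L -> x \notin L.
Proof.
rewrite inE => /andP[_ /forall_inP h]; apply/negP => /h.
by rewrite e_irr.
Qed.

Lemma cliques_extend (j : nat) (L : {set T}) (u : T) : u \notin L ->
  (u |: L \in cliques j.+1) = (L \in cliques j) && (u \in extenders L).
Proof.
move=> uL; apply/idP/andP => [/cliquesP[sV cj h]|[/cliquesP[sV cj h]]].
- split.
    apply/cliquesP; split.
    + by apply: subset_trans sV; exact: subsetUr.
    + by move: cj; rewrite cardsU1 uL add1n => -[].
    + by move=> x y xL yL; apply: h; rewrite in_setU1 (xL, yL) orbT.
  rewrite inE (subsetP sV) ?setU11 //=; apply/forall_inP => y yL.
  apply: h; rewrite ?setU11 //; first by rewrite in_setU1 yL orbT.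
  by apply: contraNneq uL => ->.
- rewrite inE => /andP[uV /forall_inP hu]; apply/cliquesP; split.
  + by rewrite subUset sub1set uV.
  + by rewrite cardsU1 uL add1n cj.
  + move=> x y; rewrite !in_setU1 => /orP[/eqP->|xL] /orP[/eqP->|yL].
    * by rewrite eqxx.
    * by move=> _; exact: hu.
    * by move=> _; rewrite e_sym; exact: hu.
    * exact: h.
Qed.

(** Pairs (clique, vertex of it) correspond to pairs (smaller clique, vertex
    extending it). *)
Lemma sum_cliques_remove (j : nat) (F : {set T} -> nat) :
  (\sum_(K in cliques j.+1) \sum_(u in K) F (K :\ u) =
   \sum_(L in cliques j) #|extenders L| * F L)%N.
Proof.
rewrite (exchange_big_dep predT) //=.
have -> : (\sum_(L in cliques j) #|extenders L| * F L =
           \sum_(L in cliques j) \sum_(u in extenders L) F L)%N.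
  by apply: eq_bigr => L _; rewrite sum_nat_const.
rewrite [RHS](exchange_big_dep predT) //=; apply: eq_bigr => u _.
rewrite (reindex_onto (fun L => u |: L) (fun K => K :\ u)) /=; last first.
  by move=> K /andP[_ uK]; exact: setD1K.
apply: eq_big => [L|L /andP[_ /eqP->] //].
rewrite setU11 andbT.
have [uL|uL] := boolP (u \in L).
  have -> : (u |: L) :\ u == L = false.
    by apply/negbTE/eqP => h; move: uL; rewrite -h !inE eqxx.
  rewrite andbF; apply/esym/negbTE; rewrite negb_and orbC.
  by have [/extender_notin|//] := boolP (u \in extenders L); rewrite uL.
by rewrite setU1K // eqxx andbT cliques_extend.
Qed.

Lemma sum_extenders (j : nat) :
  (\sum_(L in cliques j) #|extenders L| = j.+1 * #|cliques j.+1|)%N.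
Proof.
have := sum_cliques_remove j (fun _ => 1%N); under [in RHS]eq_bigr do rewrite muln1.
move=> <-; rewrite mulnC -sum_nat_const; apply: eq_bigr => K /cliquesP[_ Kj _].
by rewrite sum_nat_const Kj muln1.
Qed.

(** A vertex x that does not extend K extends [K :\ u] for at most one u: if it
    does so for u and w, it is adjacent to all of K. *)
Lemma sum_extenders_remove (j : nat) (K : {set T}) : K \in cliques j.+1 ->
  (\sum_(u in K) #|extenders (K :\ u)| <= #|V| + j * #|extenders K|)%N.
Proof.
move=> /cliquesP[KV Kj Kc].
have -> : (\sum_(u in K) #|extenders (K :\ u)| =
           \sum_(x in V) #|[set u in K | x \in extenders (K :\ u)]|)%N.
  under eq_bigr do rewrite -sum1_card.
  rewrite (exchange_big_dep (mem V)) /=; last first.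
    by move=> u x _; rewrite inE => /andP[].
  apply: eq_bigr => x xV; rewrite -sum1_card; apply: eq_bigl => u.
  by rewrite !inE.
have -> : (j * #|extenders K| = \sum_(x in V) j * (x \in extenders K))%N.
  rewrite mulnC -sum_nat_const big_mkcond [RHS]big_mkcond /=; apply: eq_bigr => x _.
  by rewrite inE; case: (x \in V) => //=; case: ifP => _; rewrite ?muln1 ?muln0.
rewrite -sum1_card -big_split /=; apply: leq_sum => x xV.
have [xK|xK] := boolP (x \in extenders K).
  rewrite muln1 add1n -Kj; apply/subset_leq_card/subsetP => u.
  by rewrite inE => /andP[].
rewrite muln0 addn0 leqNgt; apply/negP => /card_gt1P[u [w [hu hw uw]]].
move: hu hw; rewrite !inE xV /= => /andP[uK /forall_inP hu] /andP[wK /forall_inP hw].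
case/negP: xK; rewrite inE xV /=; apply/forall_inP => y yK.
have [yu|yu] := eqVneq y u; last by apply: hu; rewrite !inE yu.
by apply: hw; rewrite !inE yK yu uw.
Qed.

Lemma card_cliquesS (j : nat) :
  (j.+1 * #|cliques j.+1| <= #|V| * #|cliques j|)%N.
Proof.
rewrite -sum_extenders mulnC -sum_nat_const; apply: leq_sum => L _.
by apply/subset_leq_card/subsetP => x; rewrite inE => /andP[].
Qed.

(** Sum [sum_extenders_remove] over the cliques K; the left-hand side becomes a
    sum of squares, to which the Cauchy-Schwarz inequality applies. *)
Lemma moon_moser (R : realType) (j : nat) :
  (j.+1%:R * #|cliques j.+1|%:R) ^+ 2 <=
  #|cliques j|%:R * (#|V|%:R * #|cliques j.+1|%:R +
                     j%:R * (j.+2%:R * #|cliques j.+2|%:R)) :> R.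
Proof.
have cs (I : finType) (P : {set I}) (F : I -> nat) :
    ((\sum_(i in P) F i)%:R) ^+ 2 <= #|P|%:R * (\sum_(i in P) F i * F i)%:R :> R.
  set S : R := (_)%:R; set N : R := _%:R.
  have [N0|N0] := eqVneq N 0.
    suff -> : S = 0 by rewrite expr0n N0 mul0r.
    move/eqP: N0; rewrite /N pnatr_eq0 cards_eq0 => /eqP P0.
    by rewrite /S P0 big_set0.
  have Np : 0 < N by rewrite lt_def N0 /= ler0n.
  have : 0 <= \sum_(i in P) ((F i)%:R - S / N) ^+ 2.
    by apply: sumr_ge0 => i _; exact: sqr_ge0.
  have -> : \sum_(i in P) ((F i)%:R - S / N) ^+ 2 =
     (\sum_(i in P) F i * F i)%:R - S ^+ 2 / N.
    have E i : ((F i)%:R - S / N) ^+ 2 =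
        (F i * F i)%:R - (F i)%:R * (S / N *+ 2) + (S / N) ^+ 2 :> R.
      by rewrite natrM; ring.
    rewrite (eq_bigr _ (fun i _ => E i)).
    rewrite big_split /= sumrB sumr_const -[_ *+ #|P|]mulr_natr.
    rewrite -mulr_suml -!natr_sum -/S -/N.
    by field.
  by rewrite subr_ge0 ler_pdivrMr // mulrC.
rewrite -natrM -sum_extenders; apply: le_trans (cs _ _ _) _.
apply: ler_wpM2l; first exact: ler0n.
rewrite -sum_cliques_remove -!natrM -natrD ler_nat -sum_extenders.
rewrite mulnC big_distrr /= -sum_nat_const -big_split /=.
by apply: leq_sum => K /sum_extenders_remove.
Qed.

End MoonMoser.

Section MoonMoserAsymptotic.
Variable R : realType.

(** What [moon_moser] says about the normalised clique counts x_j = k_j / m^j of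
    a graph whose vertices form a proportion nu of an m-element set. *)
Definition clique_like (x : nat -> R) (nu : R) : Prop :=
  [/\ 0 <= nu <= 1, forall j, 0 <= x j <= 1 &
    forall j, (j.+1%:R * x j.+1) ^+ 2 <=
       x j * (nu * x j.+1 + j%:R * (j.+2%:R * x j.+2))].

(** In the Turan graph with s parts x_{j+1} / x_j is nu (1 - j/s) / (j + 1).  The
    absence of (s+1)-cliques gives the case j = s, and Moon and Moser's inequality
    leads from j + 1 to j at the price of a square root of the error. *)
Lemma ratio_bound (s : nat) (s0 : (0 < s)%N) (i : nat) (eps : R) : 0 < eps -> (i <= s)%N ->
  exists delta : R, 0 < delta /\
  forall (x : nat -> R) (nu : R), clique_like x nu -> x s.+1 <= delta ->
    (s - i).+1%:R * x (s - i).+1 <= nu * (1 - (s - i)%:R / s%:R) * x (s - i)%N + eps.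
Proof.
elim: i eps => [|i IH] eps eps0 is'.
  exists (eps / s.+1%:R); split; first by rewrite divr_gt0.
  move=> x nu _ xs; rewrite subn0 divff ?pnatr_eq0 -?lt0n // subrr mulr0 mul0r add0r.
  by rewrite mulrC -ler_pdivlMr.
pose e2 := eps ^+ 2 / s%:R.
have e20 : 0 < e2 by rewrite divr_gt0 ?exprn_gt0 ?ltr0n.
have [delta [d0 h]] := IH e2 e20 (ltnW is').
exists delta; split => // x nu xmm xs; have {IH h} := h x nu xmm xs.
have [/andP[nu0 nu1] x01 mm] := xmm.
have -> : (s - i)%N = (s - i.+1).+1 by lia.
have := mm (s - i.+1)%N; have : (s - i.+1 < s)%N by lia.
set j := (s - i.+1)%N => js /= mmj IH.
set w := j.+1%:R * x j.+1.
have w0 : 0 <= w by rewrite mulr_ge0 // (andP (x01 _)).1.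
have sR : 0 < s%:R :> R by rewrite ltr0n.
have xj0 : 0 <= x j by rewrite (andP (x01 _)).1.
have xj1 : x j <= 1 by rewrite (andP (x01 _)).2.
set B := nu * (1 - j%:R / s%:R) * x j.
have jle : j%:R <= s%:R :> R by rewrite ler_nat ltnW.
have B0 : 0 <= B.
  by rewrite !mulr_ge0 // subr_ge0 ler_pdivrMr // mul1r.
have key : w ^+ 2 <= B * w + eps ^+ 2.
  apply: le_trans mmj _.
  apply: le_trans (_ : x j * (nu * x j.+1 + j%:R * (nu * (1 - j.+1%:R / s%:R) * x j.+1 + e2)) <= _).
    by apply: ler_wpM2l => //; rewrite lerD2l; apply: ler_wpM2l.
  have -> : x j * (nu * x j.+1 + j%:R * (nu * (1 - j.+1%:R / s%:R) * x j.+1 + e2)) =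
     B * w + x j * (j%:R * e2).
    by rewrite /B /w; field; rewrite pnatr_eq0 -lt0n.
  rewrite lerD2l -[leRHS]mul1r; apply: ler_pM => //; first by rewrite mulr_ge0 // ltW.
  by rewrite /e2 mulrA ler_pdivrMr // mulrC; apply: ler_wpM2l => //; exact: sqr_ge0.
rewrite leNgt; apply/negP => wB.
have : w * (w - B) > eps * eps by apply: ltr_pM; try (exact: ltW); lra.
by rewrite -expr2; nra.
Qed.

Lemma clique_density_seq (s : nat) (s0 : (0 < s)%N) (eps : R) : 0 < eps ->
  exists2 delta : R, 0 < delta &
  forall (x : nat -> R) (nu : R), clique_like x nu -> x s.+1 <= delta ->
    forall j, (j <= s)%N -> x j <= 'C(s, j)%:R * (nu / s%:R) ^+ j + eps.
Proof.
move=> eps0; pose e1 := eps / s%:R.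
have sR : 0 < s%:R :> R by rewrite ltr0n.
have e10 : 0 < e1 by rewrite divr_gt0.
have [delta d0 hd] : exists2 delta : R, 0 < delta &
    forall (x : nat -> R) (nu : R), clique_like x nu -> x s.+1 <= delta ->
    forall j, (j <= s)%N -> j.+1%:R * x j.+1 <= nu * (1 - j%:R / s%:R) * x j + e1.
  have /boolp.choice[dl hdl] (i : 'I_s.+1) := ratio_bound s0 e10 (ltn_ord i).
  exists (\big[Order.min/1]_(i < s.+1) dl i).
    by apply: (big_ind (fun z => 0 < z)) => // [a b a0 b0|i _]; [rewrite lt_min a0 b0 | exact: (hdl i).1].
  move=> x nu xmm xs j js.
  have is' : (s - j < s.+1)%N by lia.
  have := (hdl (Ordinal is')).2 x nu xmm.
  rewrite /= subKn //; apply; apply: le_trans xs _.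
  exact: bigmin_le.
exists delta => // x nu xmm xs j js.
have [/andP[nu0 nu1] x01 mm] := xmm.
suff : x j <= 'C(s, j)%:R * (nu / s%:R) ^+ j + j%:R * e1.
  move=> h; apply: le_trans h _; rewrite lerD2l /e1 mulrA ler_pdivrMr // mulrC.
  by apply: ler_wpM2l; [exact: ltW | rewrite ler_nat].
elim: j js => [|j IH] js.
  by rewrite bin0 expr0 mul0r addr0 mulr1 (andP (x01 _)).2.
have {}IH := IH (ltnW js).
have h := hd x nu xmm xs j (ltnW js).
have j1 : 0 < j.+1%:R :> R by rewrite ltr0n.
rewrite -(ler_pM2l j1).
apply: le_trans h _.
have a0 : 0 <= nu * (1 - j%:R / s%:R).
  by rewrite mulr_ge0 // subr_ge0 ler_pdivrMr // mul1r ler_nat ltnW.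
have a1 : nu * (1 - j%:R / s%:R) <= 1.
  rewrite -[leRHS]mul1r; apply: ler_pM => //.
    by rewrite subr_ge0 ler_pdivrMr // mul1r ler_nat ltnW.
  by rewrite gerBl divr_ge0.
apply: le_trans (_ : nu * (1 - j%:R / s%:R) * ('C(s, j)%:R * (nu / s%:R) ^+ j + j%:R * e1) + e1 <= _).
  by rewrite lerD2r; apply: ler_wpM2l.
rewrite mulrDr [X in _ <= X]mulrDr -addrA; apply: lerD.
  rewrite le_eqVlt; apply/orP; left; apply/eqP.
  have -> : j.+1%:R * ('C(s, j.+1)%:R * (nu / s%:R) ^+ j.+1) =
            (j.+1 * 'C(s, j.+1))%:R * (nu / s%:R) ^+ j.+1 :> R by rewrite natrM mulrA.
  rewrite mul_bin_left natrM natrB ?(ltnW js) // exprS.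
  by field; rewrite pnatr_eq0 -lt0n.
apply: le_trans (_ : j%:R * e1 + e1 <= _).
  by rewrite lerD2r -[leRHS]mul1r; apply: ler_wpM2r => //; rewrite mulr_ge0 // ltW.
have -> : j%:R * e1 + e1 = 1 * (j.+1%:R * e1) by rewrite mul1r -natr1 mulrDl mul1r.
by apply: ler_wpM2r; [rewrite mulr_ge0 // ltW | rewrite ler1n].
Qed.

(** Asymptotic form of Zykov's theorem, for graphs with few (s+1)-cliques. *)
Lemma clique_density (s : nat) (s0 : (0 < s)%N) (eps : R) : 0 < eps ->
  exists2 delta : R, 0 < delta &
  forall (T : finType) (e : rel T) (V : {set T}), symmetric e -> irreflexive e ->
    (0 < #|T|)%N ->
    #|cliques e V s.+1|%:R <= delta * #|T|%:R ^+ s.+1 ->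
    forall j, (j <= s)%N ->
    #|cliques e V j|%:R <= 'C(s, j)%:R * (#|V|%:R / s%:R) ^+ j + eps * #|T|%:R ^+ j.
Proof.
move=> eps0; have [delta d0 h] := clique_density_seq s0 eps0.
exists delta => // T e V es ei T0 hs j js.
set m : R := #|T|%:R; have m0 : 0 < m by rewrite ltr0n.
have mj i : 0 < m ^+ i by exact: exprn_gt0.
pose x i := #|cliques e V i|%:R / m ^+ i.
have cl i : #|cliques e V i|%:R = x i * m ^+ i by rewrite divfK // gt_eqF.
suff /h : clique_like x (#|V|%:R / m).
  have xs : x s.+1 <= delta by rewrite /x ler_pdivrMr.
  move=> /(_ xs j js); rewrite -(ler_pM2r (mj j)) -cl mulrDl -mulrA -exprMn.
  have -> // : #|V|%:R / m / s%:R * m = #|V|%:R / s%:R.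
  by rewrite mulrAC divfK // gt_eqF.
split.
- by rewrite divr_ge0 //= ler_pdivrMr // mul1r ler_nat max_card.
- move=> i; apply/andP; split; first by rewrite divr_ge0 // ltW.
  rewrite ler_pdivrMr // mul1r.
  elim: i => [|i IH].
    rewrite expr0 lern1 -(cards1 (set0 : {set T})).
    apply/subset_leq_card/subsetP => A /cliquesP[_ A0 _].
    by rewrite inE -cards_eq0 A0.
  have h1 := card_cliquesS es ei V i.
  apply: le_trans (_ : (#|V| * #|cliques e V i|)%:R <= _).
    by rewrite ler_nat; apply: leq_trans h1; exact: leq_pmull.
  by rewrite natrM exprS; apply: ler_pM => //; rewrite ler_nat max_card.
- move=> i; have := moon_moser es ei V R i; rewrite !cl.
  set v : R := #|V|%:R => mm.
  have mm2 : 0 < m ^+ i * m ^+ i * m ^+ 2 by rewrite !mulr_gt0.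
  rewrite -(ler_pM2r mm2).
  have -> : (i.+1%:R * x i.+1) ^+ 2 * (m ^+ i * m ^+ i * m ^+ 2) =
            (i.+1%:R * (x i.+1 * m ^+ i.+1)) ^+ 2.
    have aux (a m' p n : R) : (n * a) ^+ 2 * (p * p * m' ^+ 2) = (n * (a * (m' * p))) ^+ 2.
      by ring.
    by rewrite [m ^+ i.+1]exprS aux.
  apply: le_trans mm _; rewrite le_eqVlt; apply/orP; left; apply/eqP.
  have aux (m' a b c p : R) : m' != 0 ->
      a * p * (v * (b * (m' * p)) + i%:R * (i.+2%:R * (c * (m' * (m' * p))))) =
      a * (v / m' * b + i%:R * (i.+2%:R * c)) * (p * p * m' ^+ 2).
    by move=> mn; field.
  by rewrite [m ^+ i.+2]exprS [m ^+ i.+1]exprS aux // gt_eqF.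
Qed.
End MoonMoserAsymptotic.

(** * Orthogonal planes *)

Section Euclid.
Variables (R : realType) (d : nat).
Implicit Types x y z : 'rV[R]_d.

Definition dot x y : R := \sum_(i < d) x ord0 i * y ord0 i.
Definition sqd x y : R := \sum_(i < d) (x ord0 i - y ord0 i) ^+ 2.

Lemma dotC x y : dot x y = dot y x.
Proof. by apply: eq_bigr => i _; rewrite mulrC. Qed.

Lemma dotBl x y z : dot (x - y) z = dot x z - dot y z.
Proof. by rewrite -sumrB; apply: eq_bigr => i _; rewrite !mxE mulrBl. Qed.

Lemma dotBr x y z : dot z (x - y) = dot z x - dot z y.
Proof. by rewrite dotC dotBl !(dotC z). Qed.

Lemma dotZl a x z : dot (a *: x) z = a * dot x z.
Proof. by rewrite mulr_sumr; apply: eq_bigr => i _; rewrite !mxE mulrA. Qed.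

Lemma dotZr a x z : dot z (a *: x) = a * dot z x.
Proof. by rewrite dotC dotZl dotC. Qed.

Lemma dot_ge0 x : 0 <= dot x x.
Proof. by apply: sumr_ge0 => i _; rewrite -expr2 sqr_ge0. Qed.

Lemma dot_eq0 x : dot x x = 0 -> x = 0.
Proof.
move/eqP; rewrite psumr_eq0 => [/allP h|i _]; last by rewrite -expr2 sqr_ge0.
apply/rowP => i; rewrite mxE; apply/eqP; rewrite -sqrf_eq0 expr2.
by apply: (implyP (h i (mem_index_enum i))).
Qed.

Lemma sqdE x y : sqd x y = dot (x - y) (x - y).
Proof. by apply: eq_bigr => i _; rewrite !mxE expr2. Qed.

Lemma sqd_ge0 x y : 0 <= sqd x y.
Proof. by rewrite sqdE dot_ge0. Qed.

Lemma sqdC x y : sqd x y = sqd y x.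
Proof. by apply: eq_bigr => i _; ring. Qed.

Lemma sqd_eq0 x y : (sqd x y == 0) = (x == y).
Proof.
apply/eqP/eqP => [|->]; last by rewrite sqdE subrr /dot big1 // => i _; rewrite mxE mul0r.
by rewrite sqdE => /dot_eq0/eqP; rewrite subr_eq0 => /eqP.
Qed.

Lemma sqd_polar x x' y y' :
  2 * dot (x - x') (y - y') = sqd x y' + sqd x' y - sqd x y - sqd x' y'.
Proof.
rewrite !sqdE !(dotBl, dotBr) (dotC y x) (dotC y' x) (dotC y x') (dotC y' x').
by ring.
Qed.

End Euclid.

(** 2r orthonormal vectors form an orthogonal matrix, whose transpose is also its
    inverse on the other side. *)
Lemma parseval (R : realType) (d r : nat) (e1 e2 : 'I_r -> 'rV[R]_d) : d = (r + r)%N ->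
  (forall i j, dot (e1 i) (e1 j) = (i == j)%:R) ->
  (forall i j, dot (e2 i) (e2 j) = (i == j)%:R) ->
  (forall i j, dot (e1 i) (e2 j) = 0) ->
  forall x, dot x x = \sum_(j < r) (dot x (e1 j) ^+ 2 + dot x (e2 j) ^+ 2).
Proof.
move=> hd h11 h22 h12 x; subst d.
pose W (i : 'I_(r + r)) := match split i with inl j => e1 j | inr j => e2 j end.
have WW i j : dot (W i) (W j) = (i == j)%:R.
  rewrite /W -[i]splitK -[j]splitK; case: (split i) => i'; case: (split j) => j';
    rewrite !unsplitK /=.
  - by rewrite h11 (inj_eq (@lshift_inj _ _)).
  - by rewrite h12 eq_lrshift.
  - by rewrite dotC h12 eq_rlshift.
  - by rewrite h22 (inj_eq (@rshift_inj _ _)).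
pose A := \matrix_i W i : 'M[R]_(r + r).
have AA : A *m A^T = 1%:M.
  apply/matrixP => i j; rewrite !mxE -WW; apply: eq_bigr => k _.
  by rewrite !mxE.
have dotE (y z : 'rV[R]_(r + r)) : dot y z = (y *m z^T) 0 0.
  by rewrite mxE; apply: eq_bigr => i _; rewrite mxE.
have xA k : (x *m A^T) 0 k = dot x (W k).
  by rewrite mxE; apply: eq_bigr => i _; rewrite !mxE.
have -> : dot x x = dot (x *m A^T) (x *m A^T).
  by rewrite !dotE trmx_mul trmxK mulmxA -(mulmxA x) (mulmx1C AA) mulmx1.
rewrite {1}/dot big_split_ord /= -big_split /=; apply: eq_bigr => i _.
by rewrite !xA /W -!expr2 (unsplitK (inl i)) (unsplitK (inr i)).
Qed.

Section Planar.
Variable R : realType.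

(** A line meets a circle in at most two points: if v is not 0 then v.x and |x|
    determine the component of x orthogonal to v up to sign, so two of the three
    points would agree. *)
Lemma circle_line (a1 a2 b1 b2 c1 c2 v1 v2 s t : R) :
  a1 ^+ 2 + a2 ^+ 2 = s -> b1 ^+ 2 + b2 ^+ 2 = s -> c1 ^+ 2 + c2 ^+ 2 = s ->
  v1 * a1 + v2 * a2 = t -> v1 * b1 + v2 * b2 = t -> v1 * c1 + v2 * c2 = t ->
  (a1, a2) != (b1, b2) -> (a1, a2) != (c1, c2) -> (b1, b2) != (c1, c2) ->
  v1 = 0 /\ v2 = 0.
Proof.
move=> na nb nc va vb vc ab ac bc.
have [D0|Dn] := eqVneq (v1 ^+ 2 + v2 ^+ 2) 0.
  move/eqP: D0; rewrite paddr_eq0 ?sqr_ge0 // !sqrf_eq0.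
  by move=> /andP[/eqP-> /eqP->].
have key (x1 x2 y1 y2 : R) : v1 * x1 + v2 * x2 = v1 * y1 + v2 * y2 ->
    v1 * x2 - v2 * x1 = v1 * y2 - v2 * y1 -> (x1, x2) = (y1, y2).
  move=> h1 h2; congr pair; apply: (mulfI Dn).
    have -> : (v1 ^+ 2 + v2 ^+ 2) * x1 = v1 * (v1 * x1 + v2 * x2) - v2 * (v1 * x2 - v2 * x1) by ring.
    by rewrite h1 h2; ring.
  have -> : (v1 ^+ 2 + v2 ^+ 2) * x2 = v2 * (v1 * x1 + v2 * x2) + v1 * (v1 * x2 - v2 * x1) by ring.
  by rewrite h1 h2; ring.
have sq (x1 x2 : R) : x1 ^+ 2 + x2 ^+ 2 = s -> v1 * x1 + v2 * x2 = t ->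
    (v1 * x2 - v2 * x1) ^+ 2 = (v1 ^+ 2 + v2 ^+ 2) * s - t ^+ 2.
  by move=> <- <-; ring.
have /eqP := etrans (sq _ _ na va) (esym (sq _ _ nb vb)); rewrite eqf_sqr.
have /eqP := etrans (sq _ _ na va) (esym (sq _ _ nc vc)); rewrite eqf_sqr.
case/orP => /eqP h1; first by move: ac; rewrite (key _ _ c1 c2) ?eqxx // va vc.
case/orP => /eqP h2; first by move: ab; rewrite (key _ _ b1 b2) ?eqxx // va vb.
move: bc; rewrite (key _ _ c1 c2) ?eqxx //; first by rewrite vb vc.
by apply: oppr_inj; rewrite -h1 -h2.
Qed.
End Planar.

Section Frame.
Variables (R : realType) (r : nat) (T : finType) (p : T -> 'rV[R]_(2 * r)).
Hypothesis p_inj : injective p.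

Definition qd (x y : T) : R := sqd (p x) (p y).

Lemma qdC x y : qd x y = qd y x.
Proof. exact: sqdC. Qed.

Lemma qd_eq0 x y : (qd x y == 0) = (x == y).
Proof. by rewrite /qd sqd_eq0 (inj_eq p_inj). Qed.

Lemma qdxx x : qd x x = 0.
Proof. by apply/eqP; rewrite qd_eq0. Qed.

(** X x j and Y x j are the two coordinates of the point x in the j-th plane. *)
Definition is_frame (X Y : T -> 'I_r -> R) : Prop :=
  forall x y, qd x y = \sum_(j < r) ((X x j - X y j) ^+ 2 + (Y x j - Y y j) ^+ 2).

(** Three points on a sphere are not collinear, so Gram-Schmidt applies to their
    differences. *)
Lemma circumcircle_frame (w u1 u2 u3 : T) : u1 != u2 -> u1 != u3 -> u2 != u3 ->
  qd w u1 = qd w u2 -> qd w u1 = qd w u3 ->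
  exists e1 e2 : 'rV[R]_(2 * r), exists al be ga : R,
  [/\ [/\ dot e1 e1 = 1, dot e2 e2 = 1 & dot e1 e2 = 0],
   e1 = al *: (p u2 - p u1) & e2 = be *: (p u3 - p u1) - ga *: (p u2 - p u1)].
Proof.
move=> u12 u13 u23 q12 q13.
set a := p u2 - p u1; set b := p u3 - p u1.
have norm (z : 'rV[R]_(2 * r)) : z != 0 ->
    exists2 al : R, al != 0 & dot (al *: z) (al *: z) = 1.
  move=> z0; have zz : 0 < dot z z.
    by rewrite lt_def dot_ge0 andbT; apply: contra_neq z0; exact: dot_eq0.
  exists (Num.sqrt (dot z z))^-1; first by rewrite invr_eq0 gt_eqF ?sqrtr_gt0.
  rewrite dotZl dotZr mulrA -expr2 exprVn sqr_sqrtr ?mulVf ?gt_eqF //.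
  exact: ltW.
have a0 : a != 0 by rewrite subr_eq0 (inj_eq p_inj) eq_sym.
have [al al0 e11] := norm a a0.
pose e1 := al *: a; pose b' := b - dot b e1 *: e1.
have b'0 : b' != 0.
  rewrite /b' subr_eq0; apply/eqP => hb.
  have {hb} [l hb] : exists l, b = l *: a by exists (dot b e1 * al); rewrite -scalerA.
  have wa : dot a a = 2 * dot (p w - p u1) a.
    by rewrite sqd_polar -/(qd w u1) -/(qd w u2) q12 -/(qd u1 u1) qdxx (sqdC (p u1)) sqdE; ring.
  have wb : dot b b = 2 * dot (p w - p u1) b.
    by rewrite sqd_polar -/(qd w u1) -/(qd w u3) q13 -/(qd u1 u1) qdxx (sqdC (p u1)) sqdE; ring.
  have : l * (l - 1) * dot a a = 0.
    rewrite hb !(dotZl, dotZr) in wb.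
    have -> : l * (l - 1) * dot a a = l * (l * dot a a) - l * dot a a by ring.
    by rewrite wb wa; ring.
  move/eqP; rewrite !mulf_eq0 => /orP[/orP[/eqP l0|]|/eqP/dot_eq0/eqP]; last exact/negP.
    by move: u13; rewrite -(inj_eq p_inj) eq_sym -subr_eq0 -/b hb l0 scale0r eqxx.
  rewrite subr_eq0 => /eqP l1; move: hb; rewrite l1 scale1r /a /b => /addIr/p_inj.
  by move/esym/eqP; exact/negP.
have [be be0 e22] := norm b' b'0.
exists e1, (be *: b'), al, be, (be * dot b e1 * al); split => //; last first.
  by rewrite /b' scalerBr {2}/e1 !scalerA mulrA.
split => //; rewrite dotZr /b' dotBr dotZr e11.
by rewrite (dotC e1 b) mulr1 subrr mulr0.
Qed.

(** Equal distances make differences inside U_i orthogonal to differences inside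
    U_j.  So the orthonormal bases of the r planes together are one of the whole
    space.  Coordinates in the j-th plane are measured from any point w of another
    U_i, since w projects to the circumcentre of U_j. *)
Lemma box_frame (U : 'I_r -> {set T}) (c : 'I_r -> 'I_r -> R) : (1 < r)%N ->
  (forall i, (2 < #|U i|)%N) ->
  (forall i j x y, i != j -> x \in U i -> y \in U j -> qd x y = c i j) ->
  exists X Y : T -> 'I_r -> R, is_frame X Y /\
    forall v j x1 x2 x3, x1 \in U j -> x2 \in U j -> x3 \in U j ->
      x1 != x2 -> x1 != x3 -> x2 != x3 ->
      qd v x1 = qd v x2 -> qd v x1 = qd v x3 -> X v j = 0 /\ Y v j = 0.
Proof.
move=> r1 U3 Uc.
have o_ex (j : 'I_r) : exists i : 'I_r, i != j.
  have r0 : (0 < r)%N by apply: ltnW.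
  have [->|j0] := eqVneq j (Ordinal r0); first by exists (Ordinal r1).
  by exists (Ordinal r0); rewrite eq_sym.
have [o oj] := boolp.choice o_ex.
have u_ex (j : 'I_r) : exists u : T * T * T, [/\ u.1.1 \in U j, u.1.2 \in U j & u.2 \in U j] /\
    [/\ u.1.1 != u.1.2, u.1.1 != u.2 & u.1.2 != u.2].
  have /card_gt2P[x [y [z [[xU yU zU] [xy yz zx]]]]] := U3 j.
  by exists ((x, y), z); split=> //=; split=> //; rewrite eq_sym.
have [u hu] := boolp.choice u_ex.
pose w j := (u (o j)).1.1.
have wU j : w j \in U (o j) by have [[]] := hu (o j).
have e_ex (j : 'I_r) : exists e : 'rV[R]_(2 * r) * 'rV[R]_(2 * r), exists abc : R * R * R,
  [/\ [/\ dot e.1 e.1 = 1, dot e.2 e.2 = 1 & dot e.1 e.2 = 0],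
   e.1 = abc.1.1 *: (p (u j).1.2 - p (u j).1.1) &
   e.2 = abc.1.2 *: (p (u j).2 - p (u j).1.1) - abc.2 *: (p (u j).1.2 - p (u j).1.1)].
  have [[h1 h2 h3] [h12 h13 h23]] := hu j.
  have [||e1 [e2 [al [be [ga h]]]]] := circumcircle_frame (w := w j) h12 h13 h23.
  - by rewrite !(Uc _ _ _ _ (oj j) (wU j)).
  - by rewrite !(Uc _ _ _ _ (oj j) (wU j)).
  - by exists (e1, e2), (al, be, ga).
have [e he] := boolp.choice e_ex.
have orth i j x x' y y' : i != j -> x \in U i -> x' \in U i -> y \in U j -> y' \in U j ->
    dot (p x - p x') (p y - p y') = 0.
  move=> ij xU x'U yU y'U; apply: (@mulfI _ 2%:R); first by rewrite pnatr_eq0.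
  rewrite mulr0 sqd_polar -/(qd x y') -/(qd x' y) -/(qd x y) -/(qd x' y').
  by rewrite !(Uc _ _ _ _ ij) //; ring.
have ee i j : i != j -> [/\ dot (e i).1 (e j).1 = 0, dot (e i).2 (e j).2 = 0,
    dot (e i).1 (e j).2 = 0 & dot (e i).2 (e j).1 = 0].
  move=> ij; have [abc [_ -> ->]] := he i; have [abc' [_ -> ->]] := he j.
  have [[h1 h2 h3] _] := hu i; have [[k1 k2 k3] _] := hu j.
  by rewrite !(dotBl (_ *: _)) !(dotBr (_ *: _)) !(dotZl, dotZr) !(orth i j) // !mulr0 !subr0.
pose X v j := dot (p v - p (w j)) (e j).1.
pose Y v j := dot (p v - p (w j)) (e j).2.
have frXY : is_frame X Y.
  move=> x y; rewrite /qd sqdE.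
  rewrite (@parseval _ _ r (fun j => (e j).1) (fun j => (e j).2)).
  - apply: eq_bigr => j _; rewrite /X /Y -!dotBl.
    by rewrite opprB addrA subrK.
  - by rewrite mul2n addnn.
  - move=> i j; have [->|/ee[//]] := eqVneq i j.
    by have [abc [[]]] := he j.
  - move=> i j; have [->|/ee[//]] := eqVneq i j.
    by have [abc [[]]] := he j.
  - move=> i j; have [->|/ee[//]] := eqVneq i j.
    by have [abc [[]]] := he j.
have zero0 v j : qd v (u j).1.1 = qd v (u j).1.2 -> qd v (u j).1.1 = qd v (u j).2 ->
    X v j = 0 /\ Y v j = 0.
  move=> h12 h13; have [[h1 h2 h3] _] := hu j.
  have d0 x : x \in U j -> qd v (u j).1.1 = qd v x -> dot (p v - p (w j)) (p x - p (u j).1.1) = 0.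
    move=> xU vx; apply: (@mulfI _ 2%:R); first by rewrite pnatr_eq0.
    rewrite mulr0 sqd_polar -/(qd v (u j).1.1) -/(qd v x) -/(qd (w j) x) -/(qd (w j) (u j).1.1).
    by rewrite vx !(Uc _ _ _ _ (oj j) (wU j)) //; ring.
  rewrite /X /Y; have [abc [_ -> ->]] := he j.
  by rewrite (dotBr (_ *: _)) !dotZr !d0 // !mulr0 subr0.
have Uplane i j x : i != j -> x \in U i -> X x j = 0 /\ Y x j = 0.
  move=> ij xU; have [[h1 h2 h3] _] := hu j.
  by apply: zero0; rewrite !(Uc _ _ _ _ ij xU).
have nrm j x y : x \in U j -> y \in U j ->
    X x j ^+ 2 + Y x j ^+ 2 = X y j ^+ 2 + Y y j ^+ 2.
  move=> xU yU.
  have wx z : z \in U j -> c j (o j) = X z j ^+ 2 + Y z j ^+ 2 +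
      \sum_(i < r | i != j) (X (w j) i ^+ 2 + Y (w j) i ^+ 2).
    move=> zU; rewrite -(Uc _ _ z (w j)) // ?[j == _]eq_sym ?oj // frXY (bigD1 j) //=.
    have [-> ->] := Uplane _ _ _ (oj j) (wU j); rewrite !subr0; congr (_ + _).
    by apply: eq_bigr => i; rewrite eq_sym => ji; have [-> ->] := Uplane j i z ji zU; ring.
  by apply: (addIr (\sum_(i < r | i != j) (X (w j) i ^+ 2 + Y (w j) i ^+ 2))); rewrite -!wx.
exists X, Y; split => // v j x1 x2 x3 x1U x2U x3U x12 x13 x23 q12 q13.
have qv x : x \in U j -> qd v x = \sum_(i < r | i != j) (X v i ^+ 2 + Y v i ^+ 2) +
    (X v j ^+ 2 + Y v j ^+ 2) + (X x j ^+ 2 + Y x j ^+ 2) - 2 * (X v j * X x j + Y v j * Y x j).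
  move=> xU; rewrite frXY (bigD1 j) //=.
  have -> : \sum_(i < r | i != j) ((X v i - X x i) ^+ 2 + (Y v i - Y x i) ^+ 2) =
            \sum_(i < r | i != j) (X v i ^+ 2 + Y v i ^+ 2).
    apply: eq_bigr => i; rewrite eq_sym => ji.
    by have [-> ->] := Uplane j i x ji xU; rewrite !subr0.
  by ring.
have neq x y : x \in U j -> y \in U j -> x != y -> (X x j, Y x j) != (X y j, Y y j).
  move=> xU yU; apply: contra_neq => -[hX hY]; apply/eqP; rewrite -qd_eq0 frXY big1 // => i _.
  have [->|ij] := eqVneq i j; first by rewrite hX hY; ring.
  have ji : j != i by rewrite eq_sym.
  have [-> ->] := Uplane _ _ _ ji xU; have [-> ->] := Uplane _ _ _ ji yU.
  by ring.
apply: (@circle_line _ (X x1 j) (Y x1 j) (X x2 j) (Y x2 j) (X x3 j) (Y x3 j)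
  _ _ (X x1 j ^+ 2 + Y x1 j ^+ 2) (X v j * X x1 j + Y v j * Y x1 j)) => //.
- exact: nrm.
- exact: nrm.
- by move: q12; rewrite !qv // (nrm j x1 x2) //; lra.
- by move: q13; rewrite !qv // (nrm j x1 x3) //; lra.
- exact: neq.
- exact: neq.
- exact: neq.
Qed.
End Frame.

(** * Simplices through a point *)

Lemma nth_codom_ord (T : Type) (r : nat) (x0 : T) (f : 'I_r -> T) (i : 'I_r) :
  nth x0 (codom f) i = f i.
Proof. by rewrite codomE (nth_map i) ?size_enum_ord // nth_ord_enum. Qed.

Section BoxFun.
Variable R : realType.

Lemma box_exists_fun (r t : nat) (c : R) : 0 < c -> exists M : nat,
  forall (T : finType) (E : pred (seq T)), (M <= #|T|)%N ->
    c * #|T|%:R ^+ r <= (count_tuples r E)%:R ->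
  exists U : 'I_r -> {set T}, (forall i, #|U i| = t) /\
    forall f : 'I_r -> T, (forall i, f i \in U i) -> E (codom f).
Proof.
move=> c0; have [M hM] := box_exists r t c0; exists M => T E hT hE.
have [U [sU aU hU]] := hM T E hT hE.
exists (fun i => nth set0 U i); split => [i|f hf].
  by apply/eqP; move/all_nthP: aU => ->; rewrite ?sU.
apply: hU; rewrite all2E size_codom card_ord sU eqxx /=.
have [r0|r0] := posnP r.
  by move: sU; rewrite [in RHS]r0 => /size0nil->; case: (codom f).
pose x0 := f (Ordinal r0).
apply/(all_nthP (x0, set0)) => i; rewrite size_zip size_codom card_ord sU minnn => ir.
rewrite nth_zip ?size_codom ?card_ord ?sU //=.
by rewrite (nth_codom_ord x0 f (Ordinal ir)) (hf (Ordinal ir)).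
Qed.
End BoxFun.

Section SetCounting.
Variable T : finType.
Implicit Types (A B : {set T}) (F G : {set {set T}}).

Lemma card_bigcup_le (I : Type) (s : seq I) (P : pred I) (S : finType) (f : I -> {set S}) :
  (#|\bigcup_(i <- s | P i) f i| <= \sum_(i <- s | P i) #|f i|)%N.
Proof.
elim/big_rec2: _ => [|i y z _ h]; first by rewrite cards0.
by apply: leq_trans (leq_card_setU _ _).1 _; rewrite leq_add2l.
Qed.

(** Each member of F is recovered from a member B of G and a point of [N B]. *)
Lemma card_by_removal F G (N : {set T} -> {set T}) (C : nat) :
  (forall A, A \in F -> exists y, [/\ y \in A, A :\ y \in G & y \in N (A :\ y)]) ->
  (forall B, B \in G -> (#|N B| <= C)%N) ->
  (#|F| <= #|G| * C)%N.
Proof.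
move=> hF hN; apply: (@leq_trans #|\bigcup_(B in G) [set y |: B | y in N B]|).
  apply/subset_leq_card/subsetP => A /hF[y [yA AG yN]].
  by apply/bigcupP; exists (A :\ y) => //; apply/imsetP; exists y; rewrite ?setD1K.
apply: leq_trans (card_bigcup_le _ _ _) _; rewrite -sum_nat_const; apply: leq_sum => B BG.
by apply: leq_trans (leq_imset_card _ _) _; exact: hN.
Qed.

Definition pointed (j : nat) (v : T) : {set {set T}} :=
  [set A : {set T} | (#|A| == j) && (v \in A)].

Lemma card_pointed (j : nat) (v : T) : (#|pointed j.+1 v| <= #|T| ^ j)%N.
Proof.
elim: j => [|j IH].
  rewrite expn0 -[X in (_ <= X)%N](cards1 [set v]); apply/subset_leq_card/subsetP => A.
  rewrite !inE => /andP[/cards1P[x ->]]; rewrite inE => /eqP->.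
  exact: eqxx.
rewrite expnSr; apply: leq_trans (leq_mul IH (leqnn _)).
apply: (card_by_removal (N := fun=> setT)) => [A|B _]; last by rewrite cardsT.
rewrite inE => /andP[/eqP Aj vA].
have /card_gt1P[x [y [xA yA xy]]] : (1 < #|A|)%N by rewrite Aj.
have [z zA zv] : exists2 z, z \in A & z != v.
  have [xv|xv] := eqVneq x v; last by exists x.
  by exists y => //; rewrite -xv eq_sym.
exists z; split; rewrite ?inE // (eq_sym v) zv vA andbT.
by move: Aj; rewrite (cardsD1 z) zA add1n => -[->]; rewrite eqxx.
Qed.

Lemma pointed_remove (j : nat) (v y : T) A :
  A \in pointed j.+1 v -> y \in A -> y != v -> A :\ y \in pointed j v.
Proof.
rewrite !inE => /andP[/eqP Aj vA] yA yv; rewrite (eq_sym v) yv vA andbT.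
by rewrite (cardsD1 y) yA add1n in Aj; case: Aj => ->; rewrite eqxx.
Qed.

(** The sets of F lose a factor [#|T|] against all sets through v as soon as one of
    their points is determined, up to C choices, by the others. *)
Lemma card_pointed_removal (j : nat) (v : T) F (N : {set T} -> {set T}) (C : nat) :
  F \subset pointed j.+2 v ->
  (forall A, A \in F -> exists y, [/\ y \in A, y != v & y \in N (A :\ y)]) ->
  (forall B, B \in pointed j.+1 v -> (#|N B| <= C)%N) ->
  (#|F| <= #|T| ^ j * C)%N.
Proof.
move=> /subsetP Fp hF hN.
apply: leq_trans (card_by_removal (G := pointed j.+1 v) (N := N) (C := C) _ hN) _.
  by move=> A AF; have [y [yA yv yN]] := hF A AF; exists y; split => //; apply: pointed_remove (Fp _ AF) _ _.
by rewrite leq_mul2r card_pointed orbT.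
Qed.

Lemma sum_pointed (j : nat) F : (forall A, A \in F -> #|A| = j) ->
  (\sum_(v : T) #|[set A in F | v \in A]| = j * #|F|)%N.
Proof.
move=> hF; under eq_bigr do rewrite -sum1dep_card.
rewrite (exchange_big_dep (mem F)) /=; last by move=> v A _ /andP[].
rewrite mulnC -sum_nat_const; apply: eq_bigr => A AF.
by rewrite -(hF A AF) -sum1_card; apply: eq_bigl => v; rewrite AF.
Qed.
End SetCounting.

Section Config.
Variables (R : realType) (r : nat) (T : finType) (p : T -> 'rV[R]_(2 * r)).
Hypothesis p_inj : injective p.

Local Notation q := (qd p).

Definition mono (A : {set T}) : bool :=
  `[< exists a : R, forall x y, x \in A -> y \in A -> x != y -> q x y = a >].

Definition simplices (k : nat) : {set {set T}} :=
  [set A : {set T} | (#|A| == k) && mono A].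

Definition simplex_degree (k : nat) (v : T) : nat := #|[set A in simplices k | v \in A]|.

Definition at_sqdist (a : R) : rel T := fun x y => (x != y) && (q x y == a).

Definition sphere (a : R) (v : T) : {set T} := [set x | at_sqdist a v x].

Lemma at_sqdist_sym a : symmetric (at_sqdist a).
Proof. by move=> x y; rewrite /at_sqdist eq_sym qdC. Qed.

Lemma at_sqdist_irr a : irreflexive (at_sqdist a).
Proof. by move=> x; rewrite /at_sqdist eqxx. Qed.

Lemma simplexP (k : nat) (A : {set T}) : reflect (#|A| = k /\ exists a : R,
   forall x y, x \in A -> y \in A -> x != y -> q x y = a) (A \in simplices k).
Proof.
rewrite inE; apply: (iffP andP) => [[/eqP Ak /asboolP h]|[Ak h]] //.
by split; [exact/eqP | exact/asboolP].
Qed.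

Lemma simplex_link (k : nat) (v : T) (a : R) (A : {set T}) : #|A| = k.+1 -> v \in A ->
  (forall x y, x \in A -> y \in A -> x != y -> q x y = a) ->
  A :\ v \in cliques (at_sqdist a) (sphere a v) k.
Proof.
move=> Ak vA h; apply/cliquesP; split.
- apply/subsetP => x; rewrite !inE => /andP[xv xA].
  by rewrite /at_sqdist eq_sym xv h //= eq_sym.
- by rewrite (cardsD1 v) vA add1n in Ak; case: Ak.
- move=> x y; rewrite !inE => /andP[_ xA] /andP[_ yA] xy.
  by rewrite /at_sqdist xy h //= eqxx.
Qed.

Lemma setD1_inj (v : T) (F : {set {set T}}) : (forall A, A \in F -> v \in A) ->
  {in F &, injective (fun A => A :\ v)}.
Proof. by move=> h A B AF BF /(congr1 (setU [set v])); rewrite !setD1K ?h. Qed.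

End Config.

Section LocalDensity.
Variables (R : realType) (r : nat).
Hypothesis r1 : (1 < r)%N.

(** By [box_frame] the centre v of the sphere is the common centre of the circles
    carrying the U_i, so these circles have squared radius a, whereas points of
    two of them are at squared distance a + a. *)
Lemma no_spherical_box (T : finType) (p : T -> 'rV[R]_(2 * r)) (p_inj : injective p)
    (v : T) (a : R) (U : 'I_r -> {set T}) :
  (forall i, #|U i| = 3) -> (forall i, U i \subset sphere p a v) ->
  (forall i j x y, i != j -> x \in U i -> y \in U j -> at_sqdist p a x y) -> False.
Proof.
move=> U3 Us Ud.
have U3' i : (2 < #|U i|)%N by rewrite U3.
have Uc i j x y : i != j -> x \in U i -> y \in U j -> qd p x y = a.
  by move=> ij xU yU; have /andP[_ /eqP] := Ud i j x y ij xU yU.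
have [X [Y [fr h0]]] := box_frame p_inj (c := fun _ _ => a) r1 U3' Uc.
have eqd z j : (forall x, x \in U j -> qd p z x = a) -> X z j = 0 /\ Y z j = 0.
  move=> hz; have /card_gt2P[x1 [x2 [x3 [[x1U x2U x3U] [x12 x23 x31]]]]] := U3' j.
  by apply: (h0 z j x1 x2 x3) => //; rewrite ?hz // eq_sym.
have v0 j : X v j = 0 /\ Y v j = 0.
  by apply: eqd => x xU; have := subsetP (Us j) x xU; rewrite inE => /andP[_ /eqP].
pose i0 := Ordinal (ltnW r1); pose i1 := Ordinal r1.
have [x xU] : exists x, x \in U i0 by apply/set0Pn; rewrite -cards_eq0 U3.
have [y yU] : exists y, y \in U i1 by apply/set0Pn; rewrite -cards_eq0 U3.
have i01 : i0 != i1 by [].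
have nrm i z : z \in U i -> \sum_(j < r) (X z j ^+ 2 + Y z j ^+ 2) = a.
  move=> zU; have := subsetP (Us i) z zU; rewrite inE => /andP[_ /eqP <-].
  rewrite fr; apply: eq_bigr => j _; have [-> ->] := v0 j.
  by ring.
have /andP[xy /eqP qxy] := Ud i0 i1 x y i01 xU yU.
have a0 : a + a = a.
  rewrite -{1}(nrm _ _ xU) -{1}(nrm _ _ yU) -{1}qxy fr -big_split /=.
  apply: eq_bigr => j _; have [ji|ji] := eqVneq i0 j.
    have [-> ->] : X y j = 0 /\ Y y j = 0.
      by apply: eqd => z; rewrite -ji => zU; rewrite qdC (Uc i0 i1).
    by ring.
  have [-> ->] : X x j = 0 /\ Y x j = 0 by apply: eqd => z zU; rewrite (Uc i0 j).
  by ring.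
have {}a0 : a = 0 by lra.
by move/negP: xy; apply; rewrite -(qd_eq0 p_inj) qxy a0.
Qed.

Lemma pairwise_codom (T : finType) (e : rel T) (f : 'I_r -> T) (i j : 'I_r) :
  symmetric e -> pairwise e (codom f) -> i != j -> e (f i) (f j).
Proof.
move=> es h ij; wlog : i j ij / (i < j)%N.
  by move=> H; case: (ltngtP i j) => [|ji|/val_inj/eqP]; [exact: H | rewrite es; apply: H; rewrite 1?eq_sym | rewrite (negbTE ij)].
move=> lij; move/(pairwiseP (f i)): h => /(_ i j).
rewrite !inE size_codom card_ord !ltn_ord => /(_ isT isT lij).
by rewrite !nth_codom_ord.
Qed.

(** [no_spherical_box] and [box_exists] bound the number of r-cliques, and
    [clique_density] does the rest. *)
Lemma local_density (eps : R) : 0 < eps -> exists M : nat,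
  forall (T : finType) (p : T -> 'rV[R]_(2 * r)), injective p -> (M <= #|T|)%N ->
  forall v a j, (j <= r.-1)%N ->
    #|cliques (at_sqdist p a) (sphere p a v) j|%:R <=
    'C(r.-1, j)%:R * (#|sphere p a v|%:R / r.-1%:R) ^+ j + eps * #|T|%:R ^+ j.
Proof.
move=> eps0; have s0 : (0 < r.-1)%N by case: r r1 => [|[]].
have [delta d0 hd] := clique_density s0 eps0.
have [M hM] := box_exists_fun r 3 d0.
exists M.+1 => T p p_inj hT v a j jr.
have T0 : (0 < #|T|)%N by apply: leq_trans hT.
apply: hd => //; [exact: at_sqdist_sym | exact: at_sqdist_irr |].
rewrite prednK ?(ltnW r1) // leNgt; apply/negP => hlt.
pose E (s : seq T) := all (mem (sphere p a v)) s && pairwise (at_sqdist p a) s.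
have [] := hM T E (ltnW hT).
  apply: le_trans (ltW hlt) _; rewrite ler_nat.
  pose x0 : r.-tuple T := [tuple of nseq r v].
  pose F (A : {set T}) : r.-tuple T := insubd x0 (enum A).
  have FE A : A \in cliques (at_sqdist p a) (sphere p a v) r -> val (F A) = enum A.
    by move=> /cliquesP[_ Ar _]; rewrite val_insubd -cardE Ar eqxx.
  rewrite -(card_in_imset (f := F) (D := cliques _ _ _)); last first.
    move=> A B hA hB /(congr1 val); rewrite (FE A hA) (FE B hB) => h.
    by rewrite -(set_enum A) -(set_enum B) h.
  apply/subset_leq_card/subsetP => t /imsetP[A hA ->].
  rewrite inE /E (FE A hA); have /cliquesP[/subsetP AV Ar h] := hA.
  apply/andP; split; first by apply/allP => x; rewrite mem_enum => /AV.
  apply/(pairwiseP v) => i l; rewrite !inE => il ll ilt.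
  apply: h; rewrite -?(mem_enum (mem A)) ?mem_nth //.
  by rewrite nth_uniq ?enum_uniq // ltn_eqF.
move=> U [U3 hU].
have Une i : exists x, x \in U i by apply/set0Pn; rewrite -cards_eq0 U3.
have [u hu] := boolp.choice Une.
apply: (no_spherical_box p_inj (v := v) (a := a) U3).
- move=> i; apply/subsetP => x xU.
  pose f l := if l == i then x else u l.
  have /hU/andP[/allP h _] : forall l, f l \in U l.
    by move=> l; rewrite /f; case: eqP => [->|].
  by apply: (h x); apply/codomP; exists i; rewrite /f eqxx.
- move=> i l x y il xU yU.
  pose f k := if k == i then x else if k == l then y else u k.
  have /hU/andP[_ h] : forall k, f k \in U k.
    by move=> k; rewrite /f; case: eqP => [->|_] //; case: eqP => [->|].
  have := pairwise_codom (@at_sqdist_sym _ _ _ p a) h il.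
  by rewrite /f eqxx (eq_sym l) (negbTE il) eqxx.
Qed.
End LocalDensity.

(** * Frequent distances *)

Lemma sum_fibers (I : finType) (V : eqType) (f : I -> V) (P : pred I) (s : seq V) :
  uniq s ->
  (\sum_(a <- s) #|[set u | P u && (f u == a)]| = #|[set u | P u && (f u \in s)]|)%N.
Proof.
elim: s => [|a s IH] /=.
  by rewrite big_nil => _; apply/esym/eqP; rewrite cards_eq0; apply/eqP/setP => u; rewrite !inE andbF.
move=> /andP[as_ us]; rewrite big_cons IH // -cardsUI.
rewrite [X in (_ + X)%N](_ : _ = 0%N) ?addn0; last first.
  apply/eqP; rewrite cards_eq0; apply/eqP/setP => u; rewrite !inE.
  case: eqP => [->|]; last by rewrite andbF.
  by rewrite (negbTE as_) !andbF.
by apply: eq_card => u; rewrite !inE andb_orr.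
Qed.

Section LinkDensity.
Variables (R : realType) (r k : nat).
Hypotheses (k2 : (1 < k)%N) (kr : (k <= r)%N).

(** The number of simplices through a point of a balanced Lenz configuration of
    n points is asymptotically [link_density * n ^ (k-1)]. *)
Definition link_density : R := 'C(r.-1, k.-1)%:R / r%:R ^+ k.-1.

(** The right-hand side of the hypothesis is [local_density] with x the
    proportion of points on the sphere; it reaches [link_density] at
    x = 1 - 1/r. *)
Lemma size_of_link (e : R) : 0 < e -> exists2 d : R, 0 < d &
  forall x : R, 0 <= x ->
    link_density - d <= 'C(r.-1, k.-1)%:R * (x / r.-1%:R) ^+ k.-1 + d ->
    1 - r%:R^-1 - e <= x.
Proof.
move=> e0; set z := 1 - r%:R^-1 - e; set C : R := 'C(r.-1, k.-1)%:R.
have C0 : 0 < C by rewrite ltr0n bin_gt0; lia.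
have s0 : 0 < r.-1%:R :> R by rewrite ltr0n; lia.
have [z0|z0] := lerP z 0.
  by exists 1 => // x x0 _; exact: le_trans x0.
have r0 : 0 < r%:R :> R by rewrite ltr0n; lia.
have ylt : z / r.-1%:R < r%:R^-1.
  rewrite ltr_pdivrMr //; apply: lt_le_trans (_ : 1 - r%:R^-1 <= _).
    by rewrite /z; lra.
  have -> : r%:R = r.-1%:R + 1 :> R by rewrite natr1 prednK //; lia.
  rewrite le_eqVlt; apply/orP; left; apply/eqP; field.
  by rewrite gt_eqF // natr1 ltr0n.
have k10 : (0 < k.-1)%N by lia.
have plt : (z / r.-1%:R) ^+ k.-1 < r%:R^-1 ^+ k.-1.
  by rewrite ltrXn2r -?lt0n ?divr_ge0 ?invr_ge0 // ltW.
exists (C * (r%:R^-1 ^+ k.-1 - (z / r.-1%:R) ^+ k.-1) / 3).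
  by rewrite divr_gt0 // mulr_gt0 // subr_gt0.
move=> x x0; rewrite leNgt => h; rewrite leNgt; apply: contra h => xz.
have xp : (x / r.-1%:R) ^+ k.-1 <= (z / r.-1%:R) ^+ k.-1.
  by rewrite lerXn2r ?nnegrE ?divr_ge0 // ?ler_pM2r ?invr_gt0 // ltW.
rewrite /link_density -/C -exprVn.
set Z := (z / _) ^+ _ in plt xp *; set X := (x / _) ^+ _ in xp *; set W := _ ^+ k.-1 in plt *.
have : C * X <= C * Z by rewrite ler_pM2l.
have : 0 < C * (W - Z) by rewrite mulr_gt0 // subr_gt0.
by lra.
Qed.
End LinkDensity.

Section Rare.
Variables (R : realType) (r : nat) (T : finType) (p : T -> 'rV[R]_(2 * r)).
Variable eta : R.
Hypothesis eta0 : 0 < eta.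
Local Notation q := (qd p).
Local Notation m := (#|T|%:R : R).

Definition common (a : R) : bool :=
  eta * m ^+ 2 <= #|[set u : T * T | (u.1 != u.2) && (q u.1 u.2 == a)]|%:R.

Definition palette : seq R :=
  [seq a <- undup (codom (fun u : T * T => q u.1 u.2)) | common a].

Lemma mem_palette x y : (q x y \in palette) = common (q x y).
Proof.
rewrite mem_filter mem_undup; case: (common _) => //=.
by apply/codomP; exists (x, y).
Qed.

Lemma size_palette : (0 < #|T|)%N -> (size palette)%:R * eta <= 1.
Proof.
move=> T0; have m2 : 0 < m ^+ 2 by rewrite exprn_gt0 // ltr0n.
rewrite -(ler_pM2r m2) mul1r -mulrA.
have uP : uniq palette by rewrite filter_uniq // undup_uniq.
apply: le_trans (_ : #|[set u : T * T | (u.1 != u.2) && (q u.1 u.2 \in palette)]|%:R <= _); last first.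
  by rewrite -natrX ler_nat expnS expn1 -card_prod max_card.
rewrite -(sum_fibers (fun u : T * T => q u.1 u.2) (fun u => u.1 != u.2) uP) natr_sum.
have -> : (size palette)%:R * (eta * m ^+ 2) = \sum_(a <- palette) eta * m ^+ 2.
  by rewrite big_const_seq count_predT iter_addr_0 mulr_natl.
rewrite [leLHS]big_seq [leRHS]big_seq.
by apply: ler_sum => a; rewrite mem_filter => /andP[].
Qed.

Definition rare (k : nat) : {set {set T}} :=
  [set A in simplices p k | [exists u : T * T,
     [&& u.1 \in A, u.2 \in A, u.1 != u.2 & ~~ common (q u.1 u.2)]]].

(** A rare 4-simplex consists of two disjoint pairs at the same rare distance; the
    first pair leaves at most eta m^2 possibilities for the second. *)
Lemma card_rare4 : #|rare 4|%:R <= eta * m ^+ 4.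
Proof.
pose W := [set w : (T * T) * (T * T) | [&& w.1.1 != w.1.2, ~~ common (q w.1.1 w.1.2),
   w.2.1 != w.2.2 & q w.2.1 w.2.2 == q w.1.1 w.1.2]].
pose f (w : (T * T) * (T * T)) := w.1.1 |: (w.1.2 |: [set w.2.1; w.2.2]).
apply: le_trans (_ : #|W|%:R <= _).
  rewrite ler_nat; apply: leq_trans (leq_imset_card f _).
  apply/subset_leq_card/subsetP => A; rewrite inE => /andP[/simplexP[A4 [a Aa]]].
  case/existsP => -[x y] /and4P[/= xA yA xy nc].
  have yAx : y \in A :\ x by rewrite !inE eq_sym xy.
  have : #|A :\ x :\ y| == 2.
    move: A4; rewrite (cardsD1 x) xA add1n => -[]; rewrite (cardsD1 y) yAx add1n => -[->].
    exact: eqxx.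
  case/cards2P => [z [t [zt Azt]]].
  have : z \in A :\ x :\ y by rewrite Azt !inE eqxx.
  rewrite !inE => /and3P[zy zx zA].
  have : t \in A :\ x :\ y by rewrite Azt !inE eqxx orbT.
  rewrite !inE => /and3P[ty tx tA].
  apply/imsetP; exists ((x, y), (z, t)); last by rewrite /f /= -Azt !setD1K.
  by rewrite inE /= xy nc zt !Aa //= eqxx.
have -> : #|W| = (\sum_(u : T * T | (u.1 != u.2) && ~~ common (q u.1 u.2))
    #|[set w : T * T | (w.1 != w.2) && (q w.1 w.2 == q u.1 u.2)]|)%N.
  under eq_bigr do rewrite -sum1dep_card.
  by rewrite pair_big_dep /= -sum1dep_card; apply: eq_bigl => w; rewrite -andbA.
rewrite natr_sum; apply: le_trans (_ : \sum_(u : T * T) eta * m ^+ 2 <= _).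
  rewrite [leRHS](bigID (fun u : T * T => (u.1 != u.2) && ~~ common (q u.1 u.2))) /=.
  apply: ler_wpDr.
    by apply: sumr_ge0 => u _; rewrite mulr_ge0 ?exprn_ge0 // ltW.
  by apply: ler_sum => u /andP[_]; rewrite /common -ltNge => /ltW.
rewrite sumr_cst (_ : #|_| = (#|T| * #|T|)%N); last first.
  by rewrite -card_prod; apply: eq_card => u; rewrite !inE.
rewrite natrM le_eqVlt; apply/orP; left; apply/eqP.
by rewrite -mulrA -expr2 -exprD.
Qed.

Lemma card_rareS (j : nat) : (1 < j)%N -> (#|rare j.+1| <= #|rare j| * #|T|)%N.
Proof.
move=> j1; apply: (card_by_removal (N := fun=> setT)) => [A|B _]; last by rewrite cardsT.
rewrite inE => /andP[/simplexP[Aj [a Aa]]]; case/existsP => -[x y] /and4P[/= xA yA xy nc].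
have yAx : y \in A :\ x by rewrite !inE eq_sym xy.
have [z] : exists z, z \in A :\ x :\ y.
  apply/set0Pn; rewrite -card_gt0.
  by move: Aj; rewrite (cardsD1 x) xA (cardsD1 y) yAx; lia.
rewrite !inE => /and3P[zy zx zA]; exists z; split=> //; rewrite inE; apply/andP; split.
  apply/simplexP; split.
    by move: Aj; rewrite (cardsD1 z) zA add1n => -[].
  by exists a => u v; rewrite !inE => /andP[_ uA] /andP[_ vA]; exact: Aa.
by apply/existsP; exists (x, y); rewrite /= !inE ![_ == z]eq_sym zx zy xA yA xy nc.
Qed.

Lemma card_rare (k : nat) : (3 < k)%N -> #|rare k|%:R <= eta * m ^+ k.
Proof.
elim: k => // k IH; rewrite ltnS leq_eqVlt => /orP[/eqP<-|k3]; first exact: card_rare4.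
apply: le_trans (_ : (#|rare k| * #|T|)%:R <= _).
  by rewrite ler_nat card_rareS //; lia.
by rewrite natrM exprSr mulrA; apply: ler_wpM2r => //; exact: IH.
Qed.

Definition nbrs (C : seq R) (v : T) : {set T} := [set x | (v != x) && (q v x \in C)].

(** A simplex through v with frequent squared side a consists of v and a
    (k-1)-clique of the graph of squared distance a on the sphere of squared radius
    a around v. *)
Lemma simplex_degree_rare (k : nat) (v : T) : (1 < k)%N ->
  (simplex_degree p k v <= #|[set A in rare k | v \in A]| +
    \sum_(a <- palette) #|cliques (at_sqdist p a) (sphere p a v) k.-1|)%N.
Proof.
move=> k1; pose G := [set A in simplices p k :\: rare k | v \in A].
apply: (@leq_trans (#|[set A in rare k | v \in A]| + #|G|)).
  apply: leq_trans (leq_card_setU _ _).1; apply/subset_leq_card/subsetP => A.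
  by rewrite !inE => /andP[-> ->]; rewrite !andbT /= orbN.
rewrite leq_add2l -(card_in_imset (f := fun A : {set T} => A :\ v)); last first.
  by apply: setD1_inj => A; rewrite inE => /andP[].
apply: leq_trans (card_bigcup_le _ _ _); apply/subset_leq_card/subsetP => B /imsetP[A].
rewrite inE => /andP[/setDP[/[dup] As /simplexP[Ak [a Aa]] Ar] vA ->].
have [x xA xv] : exists2 x, x \in A & v != x.
  have [x] : exists x, x \in A :\ v.
    by apply/set0Pn; rewrite -card_gt0; move: Ak; rewrite (cardsD1 v) vA; lia.
  by rewrite !inE => /andP[xv xA]; exists x; rewrite // eq_sym.
have aP : a \in palette.
  rewrite -(Aa v x vA xA xv) mem_palette; apply/negPn; apply: contra Ar => nc.
  by rewrite inE As; apply/existsP; exists (v, x); rewrite /= vA xA xv.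
rewrite (big_rem a) //= inE; apply/orP; left.
by apply: simplex_link => //; rewrite prednK // ltnW.
Qed.

Lemma card_nbrs_palette (v : T) :
  (\sum_(a <- palette) #|sphere p a v| = #|nbrs palette v|)%N.
Proof.
rewrite -(sum_fibers (fun x => q v x) (fun x => v != x)) // filter_uniq //.
exact: undup_uniq.
Qed.
End Rare.

Lemma sum_expn_le (I : Type) (s : seq I) (F : I -> nat) (j : nat) :
  (\sum_(i <- s) F i ^ j.+1 <= (\sum_(i <- s) F i) ^ j.+1)%N.
Proof.
elim: s => [|i s IH]; first by rewrite !big_nil.
rewrite !big_cons; apply: leq_trans (leq_add (leqnn _) IH) _.
move: (\sum_(_ <- s) _)%N (F i) => b a {IH}.
rewrite !expnS mulnDl; case: j => [|j] //.
by apply: leq_add; rewrite leq_mul2l leq_exp2r // ?leq_addr ?leq_addl orbT.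
Qed.

Section Palette.
Variables (R : realType) (r k : nat).
Hypotheses (k4 : (3 < k)%N) (kr : (k <= r)%N).

(** A point in few simplices of rare sides is in many of frequent sides, and
    [local_density] for each frequent distance, together with the
    superadditivity of powers ([sum_expn_le]), shows that it has many points at
    these distances.  Points in many simplices of rare sides are few, since
    [card_rare] bounds their total degree. *)
Lemma palette_exists (e : R) : 0 < e -> exists2 d : R, 0 < d & exists L M : nat,
  forall (T : finType) (p : T -> 'rV[R]_(2 * r)), injective p -> (M <= #|T|)%N ->
  (forall v, (link_density R r k - d) * #|T|%:R ^+ k.-1 <= (simplex_degree p k v)%:R) ->
  exists C : seq R, (size C <= L)%N /\
    #|[set v | ~~ ((1 - r%:R^-1 - e) * #|T|%:R <= #|nbrs p C v|%:R)]|%:R <= e * #|T|%:R.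
Proof.
move=> e0; have k1 : (1 < k)%N by lia.
have [d d0 hd] := size_of_link k1 kr e0.
have k0 : 0 < k%:R :> R by rewrite ltr0n; lia.
pose xi := d / 2; have xi0 : 0 < xi by rewrite /xi; lra.
pose eta := e * xi / k%:R; have eta0 : 0 < eta by rewrite /eta !(mulr_gt0, invr_gt0).
pose L := (Num.truncn eta^-1).+1.
have L0 : 0 < L%:R :> R by rewrite ltr0n.
pose e1 := xi / L%:R; have e10 : 0 < e1 by rewrite divr_gt0.
have r1 : (1 < r)%N by lia.
have [M hM] := local_density r1 e10.
exists d => //; exists L, M.+1 => T p p_inj hT hdeg.
have T0 : (0 < #|T|)%N by apply: leq_trans hT.
set m : R := #|T|%:R; have m0 : 0 < m by rewrite ltr0n.
exists (palette p eta).
have sz : (size (palette p eta) <= L)%N.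
  rewrite -(ler_nat R) ltW //; apply: le_lt_trans (truncnS_gt _).
  by rewrite -[leRHS]mul1r ler_pdivlMr //; exact: size_palette.
split => //.
pose dr v : R := #|[set A in rare p eta k | v \in A]|%:R.
have mk0 : 0 < m ^+ k.-1 by exact: exprn_gt0.
(* a point with too few neighbours is in many simplices of rare sides *)
have sub v : ~~ ((1 - r%:R^-1 - e) * m <= #|nbrs p (palette p eta) v|%:R) ->
    xi * m ^+ k.-1 <= dr v.
  apply: contraR; rewrite -ltNge => drv.
  rewrite -ler_pdivlMr //; apply: hd; first by rewrite divr_ge0 // ltW.
  rewrite -(ler_pM2r mk0).
  apply: le_trans (hdeg v) _; have := simplex_degree_rare p eta0 v k1.
  rewrite -(ler_nat R) => /le_trans; apply.
  rewrite natrD mulrDl.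
  have -> : d * m ^+ k.-1 = xi * m ^+ k.-1 + xi * m ^+ k.-1 by rewrite /xi; field.
  rewrite [leRHS]addrCA; apply: lerD; first exact: ltW.
  rewrite natr_sum.
  apply: le_trans (_ : \sum_(a <- palette p eta)
     ('C(r.-1, k.-1)%:R * (#|sphere p a v|%:R / r.-1%:R) ^+ k.-1 + e1 * m ^+ k.-1) <= _).
    by apply: ler_sum => a _; apply: hM => //; lia.
  rewrite big_split /=; apply: lerD.
    rewrite -mulr_sumr -mulrA; apply: ler_wpM2l => //.
    rewrite -exprMn mulrAC divfK ?gt_eqF // expr_div_n.
    under eq_bigr do rewrite expr_div_n.
    rewrite -mulr_suml; apply: ler_wpM2r; first by rewrite invr_ge0 exprn_ge0.
    under eq_bigr do rewrite -natrX.
    rewrite -natr_sum -natrX ler_nat -card_nbrs_palette.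
    have -> : k.-1 = k.-2.+1 by lia.
    exact: sum_expn_le.
  rewrite big_const_seq count_predT iter_addr_0 -mulr_natl mulrA.
  apply: ler_wpM2r; first exact: ltW.
  by rewrite /e1 mulrA ler_pdivrMr // mulrC ler_pM2l // ler_nat.
rewrite -(ler_pM2r (mulr_gt0 xi0 mk0)).
apply: le_trans (_ : \sum_v dr v <= _).
  rewrite [leRHS](bigID (fun v => ~~ ((1 - r%:R^-1 - e) * m <= #|nbrs p (palette p eta) v|%:R))) /=.
  apply: ler_wpDr; first by apply: sumr_ge0.
  rewrite -sum1dep_card natr_sum mulr_suml; apply: ler_sum => v hv.
  by rewrite mul1r; exact: sub.
rewrite -natr_sum (@sum_pointed _ k); last by move=> A; rewrite inE => /andP[/simplexP[]].
rewrite natrM; apply: le_trans (_ : k%:R * (eta * m ^+ k) <= _).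
  by rewrite ler_pM2l //; exact: card_rare.
have -> : m ^+ k = m * m ^+ k.-1 by rewrite -exprS prednK //; lia.
rewrite /eta le_eqVlt; apply/orP; left; apply/eqP.
by move: (m ^+ _) => P; field; rewrite gt_eqF.
Qed.
End Palette.

(** * Typical points and a large box *)

Section TypicalBox.
Variables (R : realType) (r : nat).
Hypothesis r1 : (1 < r)%N.
Let r0 : 0 < r%:R :> R. Proof. by rewrite ltr0n ltnW. Qed.

Definition typical (T : finType) (p : T -> 'rV[R]_(2 * r)) (C : seq R) (e : R) (v : T) : bool :=
  (1 - r%:R^-1 - e) * #|T|%:R <= #|nbrs p C v|%:R.

(** Greedy choice: fewer than r typical points leave a proportion 1 / (2 r) of
    common neighbours that are typical. *)
Lemma count_typical_cliques (T : finType) (p : T -> 'rV[R]_(2 * r)) (C : seq R) (e : R) :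
  e * (2 * r%:R ^+ 2) <= 1 -> 0 <= e ->
  #|[set v | ~~ typical p C e v]|%:R <= e * #|T|%:R ->
  forall j, (j <= r)%N ->
  (#|T|%:R / (2 * r%:R)) ^+ j <=
  (count_tuples j (fun s : seq T => all (typical p C e) s &&
     pairwise (fun x y => y \in nbrs p C x) s))%:R :> R.
Proof.
move=> er e0 hT; set m : R := #|T|%:R; have m0 : 0 <= m by exact: ler0n.
elim=> [|j IH] jr; first by rewrite count_tuples0.
set E := (X in count_tuples _ X) in IH *.
rewrite count_tuplesS natr_sum exprSr.
apply: le_trans (_ : (count_tuples j E)%:R * (m / (2 * r%:R)) <= _).
  by apply: ler_wpM2r; [rewrite divr_ge0 // mulr_ge0 // ltW | apply: IH; exact: ltnW].
rewrite /count_tuples -sum1dep_card natr_sum mulr_suml [leRHS](bigID (fun s : j.-tuple T => E s)) /=.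
apply: ler_wpDr; first by apply: sumr_ge0.
apply: ler_sum => s Es; rewrite mul1r.
set G := [set x | _].
have cover : [set: T] \subset G :|: ([set v | ~~ typical p C e v] :|:
    \bigcup_(y <- s) ~: [set x | y \in nbrs p C x]).
  apply/subsetP => x _; rewrite !inE; have [tx|//] := boolP (typical p C e x).
  have [hx|/allPn[y ys hy]] := boolP (all (fun y => y \in nbrs p C x) s).
    by move: Es; rewrite /E /= => /andP[-> ->].
  apply/orP; right; apply/orP; right; rewrite (big_rem y) //= !inE.
  by move: hy; rewrite inE => ->.
have sym y : [set x | y \in nbrs p C x] = nbrs p C y.
  by apply/setP => x; rewrite !inE eq_sym qdC.
have cardb : m <= #|G|%:R + (e * m + \sum_(y <- s) #|~: nbrs p C y|%:R).
  apply: le_trans (_ : (#|G| + (#|[set v | ~~ typical p C e v]| + \sum_(y <- s) #|~: nbrs p C y|))%:R <= _).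
    rewrite ler_nat -cardsT; apply: leq_trans (subset_leq_card cover) _.
    apply: leq_trans (leq_card_setU _ _).1 _; rewrite leq_add2l.
    apply: leq_trans (leq_card_setU _ _).1 _; rewrite leq_add2l.
    apply: leq_trans (card_bigcup_le _ _ _) _; apply: eq_leq; apply: eq_bigr => y _.
    by rewrite sym.
  by rewrite !natrD natr_sum lerD2l lerD2r.
have bnd : \sum_(y <- s) #|~: nbrs p C y|%:R <= (r%:R - 1) * ((r%:R^-1 + e) * m).
  apply: le_trans (_ : \sum_(y <- s) (r%:R^-1 + e) * m <= _).
    rewrite big_seq [leRHS]big_seq; apply: ler_sum => y ys.
    have ty : typical p C e y by move: Es => /andP[/allP/(_ y ys)].
    have : #|nbrs p C y|%:R + #|~: nbrs p C y|%:R = m by rewrite -natrD cardsC.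
    by move: ty; rewrite /typical -/m; lra.
  rewrite big_const_seq count_predT iter_addr_0 size_tuple -[_ *+ j]mulr_natl.
  apply: ler_wpM2r; first by rewrite mulr_ge0 // addr_ge0 // invr_ge0 ltW.
  have : (j.+1)%:R <= r%:R :> R by rewrite ler_nat.
  by rewrite -natr1; lra.
have -> : m / (2 * r%:R) = (r%:R^-1 / 2) * m by field; rewrite gt_eqF.
apply: le_trans (_ : (r%:R^-1 - r%:R * e) * m <= _).
  apply: ler_wpM2r => //.
  have : e * r%:R <= r%:R^-1 / 2.
    rewrite -(ler_pM2r (_ : 0 < 2 * r%:R)) ?mulr_gt0 //.
    have -> : r%:R^-1 / 2 * (2 * r%:R) = 1 :> R by field; rewrite gt_eqF.
    by move: er; rewrite expr2; lra.
  by lra.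
have e1 : (r%:R - 1) * ((r%:R^-1 + e) * m) = m - r%:R^-1 * m + (r%:R - 1) * (e * m).
  by field; rewrite gt_eqF.
by move: cardb bnd; rewrite e1; lra.
Qed.

Lemma pigeonhole_tuples (T : finType) (F : finType) (j : nat) (E : pred (seq T))
    (f : seq T -> F) (w0 : F) :
  exists w : F, (count_tuples j E <= #|F| * count_tuples j (fun s => E s && (f s == w)))%N.
Proof.
have hs : (\sum_(w : F) count_tuples j (fun s => E s && (f s == w)) = count_tuples j E)%N.
  rewrite /count_tuples; under eq_bigr do rewrite -sum1dep_card.
  rewrite (exchange_big_dep (fun s : j.-tuple T => E s)) /=; last by move=> w s _ /andP[].
  rewrite -sum1dep_card; apply: eq_bigr => s Es.
  by rewrite (big_pred1 (f s)) // => w; rewrite /= Es eq_sym.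
have [w _ hw] := @arg_maxnP F w0 xpredT (fun w => count_tuples j (fun s => E s && (f s == w))) isT.
by exists w; rewrite -hs -sum_nat_const; apply: leq_sum => w' _; exact: hw.
Qed.

Lemma nbrs_sym (T : finType) (p : T -> 'rV[R]_(2 * r)) (C : seq R) :
  symmetric (fun x y => y \in nbrs p C x).
Proof. by move=> x y; rewrite !inE eq_sym qdC. Qed.

(** The r-cliques of typical points are coloured by their distance matrix, a
    bounded number of colours, and [box_exists] is applied to the most frequent
    colour. *)
Lemma typical_box (L t : nat) (e : R) : e * (2 * r%:R ^+ 2) <= 1 -> 0 <= e -> (0 < t)%N ->
  exists M : nat, forall (T : finType) (p : T -> 'rV[R]_(2 * r)) (C : seq R),
  (M <= #|T|)%N -> (size C <= L)%N ->
  #|[set v | ~~ typical p C e v]|%:R <= e * #|T|%:R ->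
  exists (U : 'I_r -> {set T}) (c : 'I_r -> 'I_r -> R),
    [/\ forall i, #|U i| = t, forall i x, x \in U i -> typical p C e x &
     forall i j x y, i != j -> x \in U i -> y \in U j -> qd p x y = c i j].
Proof.
move=> er e0 t0.
pose F := {ffun 'I_r * 'I_r -> 'I_L.+1}.
have F0 : 0 < #|{: F}|%:R :> R by rewrite ltr0n card_ffun card_ord expn_gt0.
have c0 : 0 < 2 * r%:R :> R by rewrite mulr_gt0.
pose b : R := (2 * r%:R) ^- r / #|{: F}|%:R.
have b0 : 0 < b by rewrite divr_gt0 // invr_gt0 exprn_gt0.
have [M hM] := box_exists_fun r t b0.
exists M.+1 => T p C hT sC hty.
have /card_gt0P[x0 _] : (0 < #|T|)%N by apply: leq_trans hT.
pose E (s : seq T) := all (typical p C e) s && pairwise (fun x y => y \in nbrs p C x) s.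
pose col x y : 'I_L.+1 := inord (index (qd p x y) C).
pose f (s : seq T) : F := [ffun ij : 'I_r * 'I_r => col (nth x0 s ij.1) (nth x0 s ij.2)].
have [w hw] := pigeonhole_tuples r E f [ffun=> ord0].
have [|U [Ut hU]] := hM T (fun s => E s && (f s == w)) (ltnW hT).
  have h := count_typical_cliques er e0 hty (leqnn r).
  move: hw; rewrite -(ler_nat R) natrM => /(le_trans h).
  rewrite expr_div_n => h2; rewrite -(ler_pM2l F0); apply: le_trans h2.
  rewrite le_eqVlt; apply/orP; left; apply/eqP.
  by rewrite /b mulrA [_ * (_ / _)]mulrC divfK ?gt_eqF // mulrC.
have Une i : exists x, x \in U i by apply/set0Pn; rewrite -card_gt0 Ut.
have [u hu] := boolp.choice Une.
exists U, (fun i j => nth 0 C (w (i, j))); split=> // [i x xU|i j x y ij xU yU].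
  pose g l := if l == i then x else u l.
  have /hU/andP[/andP[/allP h _] _] : forall l, g l \in U l.
    by move=> l; rewrite /g; case: eqP => [->|].
  by apply: h; apply/codomP; exists i; rewrite /g eqxx.
pose g l := if l == i then x else if l == j then y else u l.
have gi : g i = x by rewrite /g eqxx.
have gj : g j = y by rewrite /g eq_sym (negbTE ij) eqxx.
have /hU/andP[/andP[_ h] /eqP fw] : forall l, g l \in U l.
  by move=> l; rewrite /g; case: eqP => [->|_] //; case: eqP => [->|].
have := pairwise_codom (nbrs_sym p C) h ij; rewrite gi gj inE => /andP[_ qC].
rewrite -fw ffunE /= !nth_codom_ord gi gj inordK ?nth_index //.
by rewrite ltnS (leq_trans (index_size _ _)).
Qed.

End TypicalBox.

Section Frames.
Variables (R : realType) (r : nat) (T : finType) (X Y : T -> 'I_r -> R).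

Definition on_plane (v : T) (j : 'I_r) : bool :=
  [forall i, (i != j) ==> (X v i == 0) && (Y v i == 0)].

(** The squared distance to the centre when v lies in the j-th plane. *)
Definition rad2 (v : T) (j : 'I_r) : R := X v j ^+ 2 + Y v j ^+ 2.

Lemma on_planeP v j : reflect (forall i, i != j -> X v i = 0 /\ Y v i = 0) (on_plane v j).
Proof.
apply: (iffP forallP) => [h i ij|h i].
  by have /implyP/(_ ij)/andP[/eqP-> /eqP->] := h i.
by apply/implyP => /h[-> ->]; rewrite !eqxx.
Qed.

Variable (p : T -> 'rV[R]_(2 * r)).
Hypothesis (p_inj : injective p) (fr : is_frame p X Y).

Lemma frame_eq x y : (forall i, X x i = X y i /\ Y x i = Y y i) -> x = y.
Proof.
move=> h; apply/eqP; rewrite -(qd_eq0 p_inj) fr big1 // => i _.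
by have [-> ->] := h i; ring.
Qed.

Lemma qd_cross x y i j : i != j -> on_plane x i -> on_plane y j ->
  qd p x y = rad2 x i + rad2 y j.
Proof.
move=> ij /on_planeP xi /on_planeP yj; rewrite fr (bigD1 i) //= (bigD1 j) 1?eq_sym //=.
rewrite big1 => [|l /andP[li lj]]; last first.
  by have [-> ->] := xi l li; have [-> ->] := yj l lj; ring.
have ji : j != i by rewrite eq_sym.
have [-> ->] := yj i ij; have [-> ->] := xi j ji.
by rewrite /rad2; ring.
Qed.

Lemma qd_same x y i : on_plane x i -> on_plane y i ->
  qd p x y = rad2 x i + rad2 y i - 2 * (X x i * X y i + Y x i * Y y i).
Proof.
move=> /on_planeP xi /on_planeP yi; rewrite fr (bigD1 i) //=.
rewrite big1 => [|l li]; last first.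
  by have [-> ->] := xi l li; have [-> ->] := yi l li; ring.
by rewrite /rad2; ring.
Qed.

Lemma qd_orth v x j : on_plane x j -> X v j = 0 -> Y v j = 0 ->
  qd p v x = \sum_(i < r) rad2 v i + rad2 x j.
Proof.
move=> /on_planeP xj v1 v2; rewrite fr (bigD1 j) //= [in RHS](bigD1 j) //= /rad2 v1 v2.
have -> : \sum_(i < r | i != j) ((X v i - X x i) ^+ 2 + (Y v i - Y x i) ^+ 2) =
          \sum_(i < r | i != j) (X v i ^+ 2 + Y v i ^+ 2).
  by apply: eq_bigr => i ij; have [-> ->] := xj i ij; rewrite !subr0.
by ring.
Qed.

(** The points of the plane on a sphere around v and on the circle satisfy a linear
    equation that is not trivial, v being off the axis; [circle_line] applies. *)
Lemma card_circle_sphere (v : T) (j : 'I_r) (s a : R) : (X v j, Y v j) != (0, 0) ->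
  (#|[set x | [&& on_plane x j, rad2 x j == s & qd p v x == a]]| <= 2)%N.
Proof.
move=> vj; rewrite leqNgt; apply/negP => /card_gt2P[x1 [x2 [x3 [[h1 h2 h3] [n12 n23 n31]]]]].
move: h1 h2 h3; rewrite !inE => /and3P[x1j /eqP r1 /eqP q1] /and3P[x2j /eqP r2 /eqP q2]
  /and3P[x3j /eqP r3 /eqP q3].
have E x : on_plane x j -> rad2 x j = s -> qd p v x = a ->
    X v j * X x j + Y v j * Y x j =
    (\sum_(i < r | i != j) rad2 v i + rad2 v j + s - a) / 2.
  move=> /on_planeP xj <- <-; rewrite fr [X in _ - X](bigD1 j) //=.
  have -> : \sum_(i < r | i != j) ((X v i - X x i) ^+ 2 + (Y v i - Y x i) ^+ 2) =
            \sum_(i < r | i != j) rad2 v i.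
    by apply: eq_bigr => i ij; have [-> ->] := xj i ij; rewrite !subr0.
  by rewrite /rad2; field.
have neq x y : on_plane x j -> on_plane y j -> x != y -> (X x j, Y x j) != (X y j, Y y j).
  move=> /on_planeP xj /on_planeP yj; apply: contra_neq => -[hX hY].
  apply: frame_eq => i; have [->|ij] := eqVneq i j; first by [].
  by have [-> ->] := xj i ij; have [-> ->] := yj i ij.
have n13 : x1 != x3 by rewrite eq_sym.
have [v1 v2] := circle_line r1 r2 r3 (E _ x1j r1 q1) (E _ x2j r2 q2) (E _ x3j r3 q3)
  (neq _ _ x1j x2j n12) (neq _ _ x1j x3j n13) (neq _ _ x2j x3j n23).
by move: vj; rewrite v1 v2 eqxx.
Qed.
End Frames.

(** * All but few points lie in the planes *)

Section Seeing.
Variables (R : realType) (r : nat) (T : finType) (p : T -> 'rV[R]_(2 * r)).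
Variables (C : seq R) (U : 'I_r -> {set T}).

(** Three points of U_i at one distance from v are what [box_frame] needs to
    conclude that v has no component in the i-th plane. *)
Definition sees (v : T) (i : 'I_r) : bool :=
  has (fun a => (2 < #|[set x in U i | qd p v x == a]|)%N) C.

Definition blind (v : T) : {set 'I_r} := [set i | ~~ sees v i].

Definition misses (v : T) (i : 'I_r) : nat := #|[set x in U i | v \notin nbrs p C x]|.

(** A point that does not see U_i has at most two points of U_i at each distance
    of C. *)
Lemma blind_misses v i : i \in blind v -> (#|U i| <= misses v i + 2 * size C)%N.
Proof.
rewrite inE -all_predC => /allP bl.
apply: (@leq_trans (misses v i + #|\bigcup_(a <- C) [set x in U i | qd p v x == a]|)).
  apply: leq_trans (leq_card_setU _ _).1; apply/subset_leq_card/subsetP => x xU.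
  rewrite !inE xU /= -implybE; apply/implyP => /andP[_ qC].
  by rewrite (big_rem _ qC) /= !inE xU qdC eqxx.
rewrite leq_add2l; apply: leq_trans (card_bigcup_le _ _ _) _.
rewrite mulnC -sum1_size big_distrl /= big_seq [X in (_ <= X)%N]big_seq.
by apply: leq_sum => a /bl /=; rewrite -leqNgt mul1n.
Qed.

Lemma sum_misses (t : nat) (e : R) : (0 < r)%N -> (forall i, #|U i| = t) ->
  (forall i x, x \in U i -> typical p C e x) ->
  (\sum_v \sum_i misses v i)%:R <= t%:R * (1 + r%:R * e) * #|T|%:R.
Proof.
move=> r0 Ut Uty; have rp : 0 < r%:R :> R by rewrite ltr0n.
have -> : (\sum_v \sum_i misses v i = \sum_i \sum_(x in U i) #|~: nbrs p C x|)%N.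
  rewrite (exchange_big_dep xpredT) //=; apply: eq_bigr => i _.
  rewrite /misses; under eq_bigr do rewrite -sum1dep_card.
  rewrite (exchange_big_dep (mem (U i))) /=; last by move=> v x _ /andP[].
  apply: eq_bigr => x xU; rewrite -sum1_card; apply: eq_bigl => v.
  by rewrite xU in_setC.
rewrite natr_sum; apply: le_trans (_ : \sum_(i < r) t%:R * ((r%:R^-1 + e) * #|T|%:R) <= _).
  apply: ler_sum => i _; rewrite natr_sum -(Ut i) -sum1_card natr_sum mulr_suml.
  apply: ler_sum => x xU; rewrite mul1r.
  have : #|nbrs p C x|%:R + #|~: nbrs p C x|%:R = #|T|%:R :> R by rewrite -natrD cardsC.
  by have := Uty i x xU; rewrite /typical; lra.
rewrite sumr_const card_ord -[_ *+ r]mulr_natl le_eqVlt; apply/orP; left; apply/eqP.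
by field; rewrite gt_eqF.
Qed.
End Seeing.

Section Planes.
Variables (R : realType) (r k : nat).
Hypotheses (k4 : (3 < k)%N) (kr : (k <= r)%N).

(** Used with b v the number of families that v does not see: only the centre sees
    all of them, and the points outside the planes are blind to at least two. *)
Lemma blind_sum (T : finType) (b : T -> nat) :
  (#|T| + #|[set v | 1 < b v]| <= \sum_v b v + #|[set v | b v == 0]|)%N.
Proof.
have E (P : pred T) : #|[set v | P v]| = (\sum_v P v)%N.
  by rewrite -sum1dep_card big_mkcond; apply: eq_bigr => v _; case: (P v).
have -> : #|T| = (\sum_(v : T) 1)%N by rewrite sum1_card.
rewrite !E -!big_split /=.
by apply: leq_sum => v _; case: (b v) => [|[|n]].
Qed.

(** By [sum_misses] a point misses on average about t points of the box, t being
    the size of one family, while by [blind_misses] a point blind to i families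
    misses almost i t points or more.  So [blind_sum] leaves few points blind to
    two families, and a point blind to one family lies in its plane.  Its squared distance from the
    centre is a frequent squared distance less the squared radius of some U_i,
    hence one of boundedly many. *)
Lemma planes_exist (kappa : R) : 0 < kappa -> exists2 d : R, 0 < d & exists L M : nat,
  forall (T : finType) (p : T -> 'rV[R]_(2 * r)), injective p -> (M <= #|T|)%N ->
  (forall v, (link_density R r k - d) * #|T|%:R ^+ k.-1 <= (simplex_degree p k v)%:R) ->
  exists (X Y : T -> 'I_r -> R) (S : seq R) (B : {set T}),
  [/\ is_frame p X Y, (size S <= L)%N, #|B|%:R <= kappa * #|T|%:R &
   forall v, v \notin B -> exists j, [/\ on_plane X Y v j, 0 < rad2 X Y v j &
      rad2 X Y v j \in S]].
Proof.
move=> kap0; have r0 : (0 < r)%N by lia.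
have r1 : (1 < r)%N by lia.
have rp : 0 < r%:R :> R by rewrite ltr0n.
pose e : R := Num.min (kappa / (16 * r%:R)) (2 * r%:R ^+ 2)^-1.
have e0 : 0 < e.
  by rewrite lt_min divr_gt0 ?mulr_gt0 // invr_gt0 mulr_gt0 // exprn_gt0.
have e1 : e * (2 * r%:R ^+ 2) <= 1.
  by rewrite -ler_pdivlMr ?mul1r ?mulr_gt0 ?exprn_gt0 // ge_min lexx orbT.
have e2 : r%:R * e <= kappa / 16.
  have : e <= kappa / (16 * r%:R) by rewrite ge_min lexx.
  rewrite -(ler_pM2l rp) => /le_trans; apply; rewrite le_eqVlt; apply/orP; left; apply/eqP.
  by field; rewrite gt_eqF.
have [d d0 [L [M1 h1]]] := palette_exists k4 kr e0.
(* t is large against the number L of frequent distances and even against L / kappa *)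
pose t := ((Num.truncn (32 * L%:R / kappa)).+1 + 4 * L + 3)%N.
have t3 : (2 < t)%N by rewrite /t; lia.
have tL : 2 * L%:R <= kappa / 16 * t%:R.
  have : 32 * L%:R / kappa <= t%:R.
    apply: ltW; apply: lt_le_trans (truncnS_gt _) _; rewrite ler_nat /t -addnA; exact: leq_addr.
  by rewrite ler_pdivrMr //; lra.
have tL4 : 4 * L%:R <= t%:R :> R by rewrite -natrM ler_nat /t; lia.
have [M2 h2] := typical_box r1 L e1 (ltW e0) (ltnW (ltnW t3)).
exists d => //; exists (L * r)%N, (M1 + M2 + (Num.truncn (4 / kappa)).+1)%N.
move=> T p p_inj hT hdeg; set m : R := #|T|%:R.
have mk : 4 <= kappa * m.
  rewrite mulrC -ler_pdivrMr //; apply: ltW; apply: lt_le_trans (truncnS_gt _) _.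
  by rewrite ler_nat; apply: leq_trans hT; exact: leq_addl.
have hT1 : (M1 <= #|T|)%N by apply: leq_trans hT; rewrite -addnA leq_addr.
have hT2 : (M2 <= #|T|)%N by apply: leq_trans hT; rewrite addnAC leq_addl.
have [C [sC hC]] := h1 T p p_inj hT1 hdeg.
have [U [c [Ut Uty Uc]]] := h2 T p C hT2 sC hC.
have U3 i : (2 < #|U i|)%N by rewrite Ut.
have [X [Y [fr h0]]] := box_frame p_inj r1 U3 Uc.
have Une i : exists x, x \in U i by apply/set0Pn; rewrite -card_gt0; exact: leq_ltn_trans (U3 i).
have [u hu] := boolp.choice Une.
have o_ex (j : 'I_r) : exists i : 'I_r, i != j.
  have [->|j0] := eqVneq j (Ordinal r0); first by exists (Ordinal r1).
  by exists (Ordinal r0); rewrite eq_sym.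
have sees0 v i : sees p C U v i -> X v i = 0 /\ Y v i = 0.
  move=> /hasP[a aC /card_gt2P[x1 [x2 [x3 [[]]]]]].
  rewrite !inE => /andP[x1U /eqP q1] /andP[x2U /eqP q2] /andP[x3U /eqP q3] [x12 x23 x31].
  by apply: (h0 v i x1 x2 x3); rewrite // ?q1 ?q2 ?q3 // eq_sym.
have Upl i x : x \in U i -> on_plane X Y x i.
  move=> xU; apply/on_planeP => l li.
  have /card_gt2P[x1 [x2 [x3 [[x1U x2U x3U] [x12 x23 x31]]]]] := U3 l.
  apply: (h0 x l x1 x2 x3); rewrite // 1?eq_sym //.
    by rewrite !(Uc i l) // eq_sym.
  by rewrite !(Uc i l) // eq_sym.
have Urad i x : x \in U i -> rad2 X Y x i = rad2 X Y (u i) i.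
  move=> xU; have [l li] := o_ex i; have il : i != l by rewrite eq_sym.
  apply: (addIr (rad2 X Y (u l) l)).
  by rewrite -!(qd_cross fr il) ?Upl // !(Uc i l).
pose Z := [set v | [forall i, (X v i == 0) && (Y v i == 0)]].
have Z1 : (#|Z| <= 1)%N.
  rewrite leqNgt; apply/negP => /card_gt1P[v [w [vZ wZ /eqP vw]]]; apply: vw.
  apply: (frame_eq p_inj fr) => i; move: vZ wZ; rewrite !inE.
  by move=> /forallP/(_ i)/andP[/eqP-> /eqP->] /forallP/(_ i)/andP[/eqP-> /eqP->].
pose b v := #|blind p C U v|.
have bZ v : b v = 0%N -> v \in Z.
  move/eqP; rewrite cards_eq0 => /eqP bv; rewrite inE; apply/forallP => i.
  have : i \notin blind p C U v by rewrite bv inE.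
  by rewrite inE negbK => /sees0[-> ->]; rewrite !eqxx.
pose B2 := [set v | (1 < b v)%N].
exists X, Y, [seq a - s | a <- C, s <- [seq rad2 X Y (u i) i | i <- enum 'I_r]], (B2 :|: Z).
split => //.
- by rewrite size_allpairs size_map size_enum_ord leq_mul2r sC orbT.
- apply: le_trans (_ : #|B2|%:R + 1 <= _).
    rewrite natr1 ler_nat -addn1; apply: leq_trans (leq_card_setU _ _).1 _.
    by rewrite leq_add2l.
  set t' : R := t%:R - 2 * L%:R.
  have t'0 : 0 < t'.
    have : 0 < t%:R :> R by rewrite ltr0n; exact: leq_ltn_trans t3.
    by rewrite /t'; lra.
  have sumb : (m + #|B2|%:R - 1) * t' <= t%:R * (1 + r%:R * e) * m.
    apply: le_trans (sum_misses r0 Ut Uty).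
    apply: le_trans (_ : (\sum_v b v)%:R * t' <= _).
      apply: ler_wpM2r; first exact: ltW.
      rewrite lerBlDr -natrD natr1 ler_nat -addn1; apply: leq_trans (blind_sum b) _.
      rewrite leq_add2l; apply: leq_trans Z1; apply/subset_leq_card/subsetP => v.
      by rewrite inE => /eqP/bZ.
    rewrite natr_sum mulr_suml [leRHS]natr_sum; apply: ler_sum => v _.
    rewrite natr_sum [leRHS](bigID (mem (blind p C U v))) /=.
    apply: ler_wpDr; first by apply: sumr_ge0.
    rewrite /b -sum1_card natr_sum mulr_suml; apply: ler_sum => i ib.
    have := blind_misses ib; rewrite Ut mul1r -(ler_nat R) natrD natrM => h.
    have : (size C)%:R <= L%:R :> R by rewrite ler_nat.
    by rewrite /t'; lra.
  have B2le : #|B2|%:R <= kappa / 4 * m + 1.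
    rewrite -(ler_pM2r t'0).
    have m0 : 0 <= m by exact: ler0n.
    have : (t%:R * (r%:R * e)) * m <= (kappa / 16 * t%:R) * m.
      by apply: ler_wpM2r => //; rewrite mulrC; apply: ler_wpM2r.
    have : 2 * L%:R * m <= kappa / 16 * t%:R * m by apply: ler_wpM2r.
    have : kappa / 16 * t%:R * m <= kappa / 8 * t' * m.
      apply: ler_wpM2r => //; have -> : kappa / 8 * t' = kappa / 16 * (2 * t') by field.
      by apply: ler_wpM2l; [lra | rewrite /t'; lra].
    have -> : t%:R = t' + 2 * L%:R by rewrite /t'; ring.
    by move: sumb; have -> : t%:R = t' + 2 * L%:R by [rewrite /t'; ring]; lra.
  by move: B2le mk; lra.
- move=> v; rewrite !inE negb_or => /andP[b2 vZ].
  have b1 : b v == 1%N.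
    have : b v != 0%N by apply: contraNneq vZ => /bZ; rewrite inE.
    by move: b2; rewrite /b; case: #|_| => [|[]].
  have [j bj] : exists j, blind p C U v = [set j] by apply/cards1P.
  have sj i : i != j -> sees p C U v i.
    by move=> ij; have := in_set1 i j; rewrite -bj inE (negbTE ij) => /negbFE.
  have vj : on_plane X Y v j by apply/on_planeP => i /sj /sees0.
  exists j; split => //.
    rewrite lt_def addr_ge0 ?sqr_ge0 // andbT paddr_eq0 ?sqr_ge0 // !sqrf_eq0.
    apply: contra vZ => vj0; apply/forallP => i; have [->//|ij] := eqVneq i j.
    by have [-> ->] := on_planeP _ _ _ _ vj i ij; rewrite !eqxx.
  have [i ij] := o_ex j; have ji : j != i by rewrite eq_sym.
  have /hasP[a aC] := sj i ij; rewrite /= => a3.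
  have [x] : exists x, x \in [set x in U i | qd p v x == a].
    by apply/set0Pn; rewrite -card_gt0; exact: leq_ltn_trans (leq0n _) a3.
  rewrite inE => /andP[xU /eqP qa].
  apply/allpairsP; exists (a, rad2 X Y x i); split => //=.
    by rewrite Urad //; apply: map_f; rewrite mem_enum.
  by rewrite -qa (qd_cross fr ji vj (Upl i x xU)) addrK.
Qed.
End Planes.

(** * Degrees force a single radius *)

Section DegreeSplit.
Variables (R : realType) (r : nat) (T : finType) (p : T -> 'rV[R]_(2 * r)).
Hypothesis p_inj : injective p.
Variables (X Y : T -> 'I_r -> R).
Hypothesis fr : is_frame p X Y.
Variables (v : T) (B : {set T}) (S : seq R).

(** Outside B, and with the points other than v in different planes, to which v
    itself is orthogonal: what remains of the simplices through v after those with
    a nearly determined point are discarded. *)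
Definition spread_simplex (A : {set T}) : Prop :=
  forall y, y \in A -> y != v -> y \notin B /\
    forall x j, x \in A -> x != y -> on_plane X Y y j -> X x j = 0 /\ Y x j = 0.

(** Well defined when A is part of a simplex and has two points ([sideE]). *)
Definition side (A : {set T}) : R :=
  odflt 0 (omap (fun u : T * T => qd p u.1 u.2)
    [pick u : T * T | [&& u.1 \in A, u.2 \in A & u.1 != u.2]]).

Lemma sideE (A : {set T}) a : (1 < #|A|)%N ->
  (forall x y, x \in A -> y \in A -> x != y -> qd p x y = a) -> side A = a.
Proof.
move=> A1 h; rewrite /side; case: pickP => [[x y] /= /and3P[xA yA xy]|no].
  exact: h.
have /card_gt1P[x [y [xA yA xy]]] := A1.
by have := no (x, y); rewrite /= xA yA xy.
Qed.

Definition off_axis (x : T) (j : 'I_r) : bool := (X x j, Y x j) != (0, 0).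

(** The possible positions of a further vertex y of a simplex containing A when y
    lies on one of the circles with squared radius in S and some x in A is off the
    axis of that circle. *)
Definition completions (A : {set T}) : {set T} :=
  \bigcup_(x in A) \bigcup_(j : 'I_r | off_axis x j) \bigcup_(s <- S)
    [set y | [&& on_plane X Y y j, rad2 X Y y j == s & qd p x y == side A]].

Lemma card_completions (A : {set T}) : (#|completions A| <= #|A| * (r * (size S * 2)))%N.
Proof.
apply: leq_trans (card_bigcup_le _ _ _) _; rewrite -sum_nat_const; apply: leq_sum => x _.
apply: leq_trans (card_bigcup_le _ _ _) _.
apply: (@leq_trans (\sum_(j < r | off_axis x j) size S * 2)).
  apply: leq_sum => j xj; apply: leq_trans (card_bigcup_le _ _ _) _.
  rewrite -sum1_size big_distrl /=; apply: leq_sum => s _; rewrite mul1n.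
  exact: card_circle_sphere.
rewrite big_mkcond /= -[X in (_ <= X * _)%N](card_ord r) -sum_nat_const; apply: leq_sum => j _.
by case: ifP.
Qed.

Lemma plane_uniq (y : T) (i j : 'I_r) :
  on_plane X Y y i -> 0 < rad2 X Y y i -> on_plane X Y y j -> i = j.
Proof.
move=> _ yi /on_planeP yj; apply/eqP/negPn/negP => ij.
by move: yi; rewrite /rad2; have [-> ->] := yj i ij; rewrite expr0n addr0 ltxx.
Qed.

Hypothesis BS : forall y, y \notin B -> y != v ->
  exists j, [/\ on_plane X Y y j, 0 < rad2 X Y y j & rad2 X Y y j \in S].

(** A simplex through v that is not spread meets B outside v or has a vertex other
    than v among the completions of the others; [card_pointed_removal] bounds
    both kinds. *)
Lemma simplex_degree_spread (k : nat) : (2 < k)%N ->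
  (simplex_degree p k v <= #|T| ^ k.-2 * (#|B| + k.-1 * (r * (size S * 2))) +
    #|[set A in simplices p k | (v \in A) && `[< spread_simplex A >]]|)%N.
Proof.
move=> k2; have kE : k = k.-2.+2 by case: k k2 => [|[|]].
pose P := [set A in simplices p k | v \in A].
pose F1 := [set A in P | [exists y in A, (y != v) && (y \in B)]].
pose F2 := [set A in P | [exists y in A, (y != v) && (y \in completions (A :\ y))]].
have Pp : P \subset pointed k.-2.+2 v.
  by rewrite -kE; apply/subsetP => A; rewrite !inE => /andP[/andP[-> _] ->].
apply: (@leq_trans (#|F1 :|: F2| + #|[set A in simplices p k | (v \in A) && `[< spread_simplex A >]]|)).
  apply: leq_trans (leq_card_setU _ _).1; apply/subset_leq_card/subsetP => A AP.
  move: (AP); rewrite inE => /andP[As vA].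
  rewrite inE; apply/orP; have [|h2] := boolP (A \in F1 :|: F2); [by left | right].
  rewrite inE As vA /=; apply/asboolP => y yA yv.
  move: h2; rewrite in_setU negb_or => /andP[].
  rewrite inE AP /= => /exists_inPn/(_ y yA); rewrite yv /= => yB.
  rewrite inE AP /= => /exists_inPn/(_ y yA); rewrite yv /= => yN.
  split => // x j xA xy yj.
  have [/eqP[-> ->]//|xj] := boolP ((X x j, Y x j) == (0, 0)).
  case/negP: yN.
  have [j' [yj' y0 yS]] := BS yB yv.
  have jj := plane_uniq yj' y0 yj; subst j'.
  have /simplexP[Ak [a Aa]] := As.
  have xAy : x \in A :\ y by rewrite !inE xy.
  apply/bigcupP; exists x => //; apply/bigcupP; exists j => //.
  rewrite (big_rem _ yS) /= !inE yj eqxx /=.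
  rewrite (@sideE _ a) ?(Aa x y) ?eqxx //.
    by rewrite (cardsD1 y) yA add1n in Ak; rewrite -ltnS Ak.
  by move=> u w; rewrite !inE => /andP[_ uA] /andP[_ wA]; exact: Aa.
rewrite leq_add2r mulnDr; apply: leq_trans (leq_card_setU _ _).1 _; apply: leq_add.
  apply: (card_pointed_removal (N := fun=> B)) => //.
    by apply: subset_trans Pp; apply/subsetP => A; rewrite inE => /andP[].
  by move=> A; rewrite inE => /andP[_ /exists_inP[y yA /andP[yv yB]]]; exists y.
apply: (card_pointed_removal (N := completions)).
- by apply: subset_trans Pp; apply/subsetP => A; rewrite inE => /andP[].
- by move=> A; rewrite inE => /andP[_ /exists_inP[y yA /andP[yv yB]]]; exists y.
- move=> A; rewrite inE => /andP[/eqP Ak _]; apply: leq_trans (card_completions A) _.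
  by rewrite Ak -[in X in (_ <= X * _)%N](prednK (ltnW (ltnW k2))) leq_mul2r; apply/orP; right; case: (k) k2 => [|[|]].
Qed.
End DegreeSplit.

Section Structure.
Variables (R : realType) (r k : nat).
Hypotheses (k4 : (3 < k)%N) (kr : (k <= r)%N).

(** If the spread simplices through v all have squared side a, then [local_density]
    bounds their number in terms of the sphere of squared radius a around v, and
    the other simplices through v are negligible by [simplex_degree_spread]. *)
Lemma large_sphere (e : R) : 0 < e -> exists2 d : R, 0 < d & forall L : nat, exists M : nat,
  forall (T : finType) (p : T -> 'rV[R]_(2 * r)) (X Y : T -> 'I_r -> R),
  injective p -> is_frame p X Y -> (M <= #|T|)%N ->
  forall (v : T) (B : {set T}) (S : seq R) (a : R), (size S <= L)%N ->
  #|B|%:R <= d * #|T|%:R ->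
  (forall y, y \notin B -> y != v ->
    exists j, [/\ on_plane X Y y j, 0 < rad2 X Y y j & rad2 X Y y j \in S]) ->
  (forall A, A \in simplices p k -> v \in A -> spread_simplex X Y v B A ->
    forall x y, x \in A -> y \in A -> x != y -> qd p x y = a) ->
  (link_density R r k - d) * #|T|%:R ^+ k.-1 <= (simplex_degree p k v)%:R ->
  (1 - r%:R^-1 - e) * #|T|%:R <= #|sphere p a v|%:R.
Proof.
move=> e0; have k1 : (1 < k)%N by lia.
have [d2 d20 hd] := size_of_link k1 kr e0.
pose d := d2 / 4; have d0 : 0 < d by rewrite /d; lra.
have r1 : (1 < r)%N by lia.
have [M hM] := local_density r1 d0.
exists d => // L; pose K : R := (k.-1 * (r * (L * 2)))%:R.
exists (M + (Num.truncn (K / d)).+1)%N => T p X Y p_inj fr hT v B S a sS Bd BS hA hdeg.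
set m : R := #|T|%:R.
have mK : K <= d * m.
  rewrite mulrC -ler_pdivrMr //; apply: ltW; apply: lt_le_trans (truncnS_gt _) _.
  by rewrite ler_nat; apply: leq_trans hT; exact: leq_addl.
have m0 : 0 < m by rewrite ltr0n; apply: leq_trans hT; rewrite addnS.
have hTM : (M <= #|T|)%N by apply: leq_trans hT; exact: leq_addr.
have mk0 : 0 < m ^+ k.-1 by exact: exprn_gt0.
rewrite -ler_pdivlMr //; apply: hd; first by rewrite divr_ge0 // ltW.
rewrite -(ler_pM2r mk0).
apply: le_trans (_ : (link_density R r k - d) * m ^+ k.-1 - 3 * d * m ^+ k.-1 <= _).
  by rewrite -mulrBl; apply: ler_wpM2r; [exact: ltW | rewrite /d; lra].
rewrite lerBlDr; apply: le_trans hdeg _.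
have := simplex_degree_spread p_inj fr BS (ltnW k4); rewrite -(ler_nat R) => /le_trans; apply.
rewrite natrD [in leRHS]mulrDl.
have kE : m ^+ k.-1 = m ^+ k.-2 * m by rewrite -exprSr; congr (_ ^+ _); lia.
have h1 : (#|T| ^ k.-2 * (#|B| + k.-1 * (r * (size S * 2))))%:R <= 2 * d * m ^+ k.-1.
  rewrite kE natrM natrX [leRHS]mulrCA; apply: ler_wpM2l; first by rewrite exprn_ge0 // ltW.
  rewrite natrD; apply: le_trans (_ : d * m + K <= _); last by lra.
  by apply: lerD => //; rewrite ler_nat !leq_mul.
have h2 : #|[set A in simplices p k | (v \in A) && `[< spread_simplex X Y v B A >]]|%:R <=
    'C(r.-1, k.-1)%:R * (#|sphere p a v|%:R / m / r.-1%:R) ^+ k.-1 * m ^+ k.-1 + d * m ^+ k.-1.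
  have -> : 'C(r.-1, k.-1)%:R * (#|sphere p a v|%:R / m / r.-1%:R) ^+ k.-1 * m ^+ k.-1 =
            'C(r.-1, k.-1)%:R * (#|sphere p a v|%:R / r.-1%:R) ^+ k.-1.
    by rewrite -mulrA -exprMn -2!mulrA [m^-1 * _]mulrC -[_^-1 * _ * _]mulrA mulVf ?mulr1 // gt_eqF.
  apply: le_trans (hM T p p_inj hTM v a k.-1 _); last by lia.
  rewrite ler_nat -(card_in_imset (f := fun A : {set T} => A :\ v)); last first.
    by apply: setD1_inj => A; rewrite inE => /andP[_ /andP[]].
  apply/subset_leq_card/subsetP => _ /imsetP[A + ->].
  rewrite inE => /andP[As /andP[vA /asboolP sA]].
  apply: simplex_link => //; last exact: hA.
  by have /simplexP[-> _] := As; rewrite prednK //; exact: ltnW.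
have d4 : d2 * m ^+ k.-1 = 4 * d * m ^+ k.-1 by rewrite /d; field.
have dm0 : 0 < d * m ^+ k.-1 by exact: mulr_gt0.
apply: le_trans (lerD h1 h2) _; rewrite d4.
have -> : 2 * d * m ^+ k.-1 = 2 * (d * m ^+ k.-1) by rewrite mulrA.
have -> : 4 * d * m ^+ k.-1 = 4 * (d * m ^+ k.-1) by rewrite mulrA.
have -> : 3 * d * m ^+ k.-1 = 3 * (d * m ^+ k.-1) by rewrite mulrA.
move: ('C(r.-1, k.-1)%:R * _ * m ^+ k.-1) => W.
by move: (d * m ^+ k.-1) dm0 => D D0; lra.
Qed.
End Structure.

Section Circles.
Variables (R : realType) (r : nat) (T : finType) (X Y : T -> 'I_r -> R).

Definition circle (s : R) (j : 'I_r) : {set T} := [set v | on_plane X Y v j && (rad2 X Y v j == s)].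

Lemma circle_disj (s s' : R) (i j : 'I_r) v : 0 < s ->
  v \in circle s i -> v \in circle s' j -> i = j /\ s = s'.
Proof.
rewrite !inE => s0 /andP[vi /eqP si] /andP[vj /eqP sj].
have ij : i = j by apply: (plane_uniq vi _ vj); rewrite si.
by split => //; rewrite -si -sj ij.
Qed.

Variable (p : T -> 'rV[R]_(2 * r)).
Hypothesis (p_inj : injective p) (fr : is_frame p X Y).
Variables (B : {set T}) (S : seq R).
Hypothesis BS : forall y, y \notin B -> 
  exists j, [/\ on_plane X Y y j, 0 < rad2 X Y y j & rad2 X Y y j \in S].

Lemma spread_planes (v y1 y2 : T) (A : {set T}) (j1 j2 : 'I_r) : spread_simplex X Y v B A ->
  y1 \in A -> y2 \in A -> y2 != v -> y1 != y2 ->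
  on_plane X Y y1 j1 -> on_plane X Y y2 j2 -> 0 < rad2 X Y y1 j1 -> j1 != j2.
Proof.
move=> sA y1A y2A y2v y12 p1 p2; have [_ h] := sA y2 y2A y2v.
have [a b] := h y1 j2 y1A y12 p2.
by apply: contraTneq => ->; rewrite /rad2 a b expr0n addr0 ltxx.
Qed.

Lemma two_others (v : T) (A : {set T}) : (2 < #|A|)%N ->
  exists y1 y2, [/\ y1 \in A, y2 \in A, y1 != v, y2 != v & y1 != y2].
Proof.
move=> A3; have : (1 < #|A :\ v|)%N.
  by move: A3; rewrite (cardsD1 v); case: (v \in A) => //=; rewrite add0n => /ltnW.
move=> /card_gt1P[y1 [y2 []]]; rewrite !inE => /andP[h1 h2] /andP[h3 h4] h5.
by exists y1, y2.
Qed.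

(** v and two further vertices lie in different planes with squared radii s0, s1, s2,
    and s0 + s1 = s0 + s2 = s1 + s2 is the squared side. *)
Lemma spread_side (k : nat) (v : T) (j : 'I_r) (A : {set T}) : (2 < k)%N ->
  on_plane X Y v j -> 0 < rad2 X Y v j -> A \in simplices p k -> v \in A -> spread_simplex X Y v B A ->
  forall x y, x \in A -> y \in A -> x != y -> qd p x y = 2 * rad2 X Y v j.
Proof.
move=> k2 vj v0 /simplexP[Ak [a Aa]] vA sA x y xA yA xy; rewrite (Aa x y) // {x y xA yA xy}.
have [|y1 [y2 [y1A y2A y1v y2v y12]]] := @two_others v A; first by rewrite Ak.
have [y1B _] := sA y1 y1A y1v; have [y2B _] := sA y2 y2A y2v.
have [j1 [p1 r1 _]] := BS y1B; have [j2 [p2 r2 _]] := BS y2B.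
have vy1 : v != y1 by rewrite eq_sym.
have vy2 : v != y2 by rewrite eq_sym.
have j01 : j != j1 := spread_planes sA vA y1A y1v vy1 vj p1 v0.
have j02 : j != j2 := spread_planes sA vA y2A y2v vy2 vj p2 v0.
have j12 : j1 != j2 := spread_planes sA y1A y2A y2v y12 p1 p2 r1.
have e1 : rad2 X Y v j + rad2 X Y y1 j1 = a by rewrite -(qd_cross fr j01 vj p1) Aa.
have e2 : rad2 X Y v j + rad2 X Y y2 j2 = a by rewrite -(qd_cross fr j02 vj p2) Aa.
have e3 : rad2 X Y y1 j1 + rad2 X Y y2 j2 = a by rewrite -(qd_cross fr j12 p1 p2) Aa.
by lra.
Qed.

(** A point of the sphere in another plane than v has the radius of v, and those
    in the plane of v are few by [card_circle_sphere]. *)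
Lemma sphere_circles (v : T) (j : 'I_r) : on_plane X Y v j -> 0 < rad2 X Y v j ->
  (#|sphere p (2 * rad2 X Y v j) v| <= #|B| + size S * 2 +
     #|\bigcup_(i | i != j) circle (rad2 X Y v j) i|)%N.
Proof.
move=> vj v0; set s := rad2 X Y v j.
pose near := \bigcup_(s' <- S) [set x | [&& on_plane X Y x j, rad2 X Y x j == s' & qd p v x == 2 * s]].
have nearS : (#|near| <= size S * 2)%N.
  apply: leq_trans (card_bigcup_le _ _ _) _.
  rewrite -sum1_size big_distrl /=; apply: leq_sum => s' _; rewrite mul1n.
  apply: (card_circle_sphere p_inj fr); apply: contraTneq v0 => -[x0 y0].
  by rewrite /rad2 x0 y0 expr0n addr0 ltxx.
apply: (@leq_trans (#|B| + #|near| + #|\bigcup_(i | i != j) circle s i|)); last first.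
  by rewrite leq_add2r leq_add2l.
suff hs : sphere p (2 * s) v \subset B :|: near :|: \bigcup_(i | i != j) circle s i.
  apply: leq_trans (subset_leq_card hs) _; apply: leq_trans (leq_card_setU _ _).1 _.
  by rewrite leq_add2r; exact: (leq_card_setU _ _).1.
apply/subsetP => x; rewrite inE => /andP[vx /eqP qx].
rewrite !inE; have [//|xB] := boolP (x \in B); rewrite /=.
have [i [xi x0 xS]] := BS xB.
have [ij|ij] := eqVneq i j.
  apply/orP; left; rewrite /near (big_rem _ xS) /= !inE -ij xi ij.
  by rewrite -[in rad2 X Y x j]ij eqxx qx eqxx.
apply/orP; right; apply/bigcupP; exists i => //; rewrite inE xi /=.
have ji : j != i by rewrite eq_sym.
by move: qx; rewrite (qd_cross fr ji vj xi) -/s => h; apply/eqP; lra.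
Qed.
End Circles.

Section Lenz.
Variables (R : realType) (r k : nat).
Hypotheses (k4 : (3 < k)%N) (kr : (k <= r)%N).

(** Let v be a point in the j-th plane at distance rho from the centre.  By
    [large_sphere] and [sphere_circles] more than half of all points lie on the
    circles of radius rho in the other planes.  So rho is the same for all v, and
    the circle of v contains at most about n/r points. *)
Lemma circles_exist (kappa : R) : 0 < kappa -> exists2 d : R, 0 < d & exists M : nat,
  forall (T : finType) (p : T -> 'rV[R]_(2 * r)), injective p -> (M <= #|T|)%N ->
  (forall v, (link_density R r k - d) * #|T|%:R ^+ k.-1 <= (simplex_degree p k v)%:R) ->
  exists (X Y : T -> 'I_r -> R) (s : R),
  [/\ is_frame p X Y, 0 < s,
     #|[set v | [forall j, v \notin circle X Y s j]]|%:R <= kappa * #|T|%:R &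
     forall j, #|circle X Y s j|%:R <= (r%:R^-1 + kappa) * #|T|%:R].
Proof.
move=> kap0; have r0 : (0 < r)%N by lia.
have r4 : r%:R^-1 <= 4^-1 :> R.
  by rewrite lef_pV2 ?posrE ?ltr0n // ler_nat; exact: leq_trans k4 kr.
pose k2 : R := Num.min (kappa / 4) 32^-1.
have k20 : 0 < k2 by rewrite lt_min divr_gt0 //= invr_gt0 ltr0n.
have k2a : k2 <= kappa / 4 by rewrite ge_min lexx.
have k2b : k2 <= 32^-1 by rewrite ge_min lexx orbT.
have [dA dA0 hA] := large_sphere k4 kr k20.
pose k1 : R := Num.min k2 dA.
have k10 : 0 < k1 by rewrite lt_min k20 dA0.
have k1a : k1 <= k2 by rewrite ge_min lexx.
have k1b : k1 <= dA by rewrite ge_min lexx orbT.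
have [d1 d10 [L [M1 h1]]] := planes_exist k4 kr k10.
have [M2 h2] := hA L.
pose d := Num.min dA d1.
exists d; first by rewrite lt_min dA0 d10.
exists (M1 + M2 + (Num.truncn ((L * 2)%:R / k1)).+1)%N => T p p_inj hT hdeg.
set m : R := #|T|%:R.
have mL : (L * 2)%:R <= k1 * m.
  rewrite mulrC -ler_pdivrMr //; apply: ltW; apply: lt_le_trans (truncnS_gt _) _.
  by rewrite ler_nat; apply: leq_trans hT; exact: leq_addl.
have m0 : 0 < m by rewrite ltr0n; apply: leq_trans hT; rewrite addnS.
have hT1 : (M1 <= #|T|)%N by apply: leq_trans hT; rewrite -addnA leq_addr.
have hT2 : (M2 <= #|T|)%N by apply: leq_trans hT; rewrite addnAC leq_addl.
have mk0 : 0 < m ^+ k.-1 by exact: exprn_gt0.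
have hdeg' d' : d <= d' -> forall v,
    (link_density R r k - d') * #|T|%:R ^+ k.-1 <= (simplex_degree p k v)%:R.
  by move=> dd' v; apply: le_trans (hdeg v); rewrite ler_pM2r // lerD2l lerN2.
have [|X [Y [S [B [fr sS Bk BS]]]]] := h1 T p p_inj hT1 (hdeg' d1 _).
  by rewrite ge_min lexx orbT.
have big v (vB : v \notin B) j : on_plane X Y v j -> 0 < rad2 X Y v j ->
    (1 - r%:R^-1 - 3 * k2) * m <= #|\bigcup_(i | i != j) circle X Y (rad2 X Y v j) i|%:R.
  move=> vj v0.
  have h : (1 - r%:R^-1 - k2) * m <= #|sphere p (2 * rad2 X Y v j) v|%:R.
    apply: (h2 T p X Y p_inj fr hT2 v B S) => //.
    - by apply: le_trans Bk _; apply: ler_wpM2r => //; exact: ltW.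
    - by move=> y yB _; exact: BS.
    - by move=> A As vA sA; exact: (spread_side fr BS (ltnW k4) vj v0 As vA sA).
    - by apply: hdeg'; rewrite ge_min lexx.
  have := sphere_circles p_inj fr BS vj v0; rewrite -(ler_nat R) !natrD => h'.
  have hS : (size S * 2)%:R <= (L * 2)%:R :> R by rewrite ler_nat leq_mul2r sS orbT.
  have k1m : k1 * m <= k2 * m by rewrite ler_pM2r.
  have Bk' : #|B|%:R <= k1 * m by exact: Bk.
  by lra.
have [v0 v0B] : exists v, v \notin B.
  apply: contrapT => /forallNP h.
  have : m <= #|B|%:R.
    rewrite ler_nat; apply/subset_leq_card/subsetP => v _.
    by apply/negPn/negP => /h.
  have : k1 * m <= 32^-1 * m by rewrite ler_pM2r // (le_trans k1a).
  have Bk' : #|B|%:R <= k1 * m by exact: Bk.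
  by lra.
have [j0 [v0j v0r v0S]] := BS v0 v0B.
set s := rad2 X Y v0 j0.
have all_s v : v \notin B -> exists j, v \in circle X Y s j.
  move=> vB; have [j [vj vr vS]] := BS v vB; exists j; rewrite inE vj /=.
  have b0 := big v0 v0B j0 v0j v0r; have b1 := big v vB j vj vr.
  have [x] : exists x, x \in (\bigcup_(i | i != j0) circle X Y s i) :&:
      (\bigcup_(i | i != j) circle X Y (rad2 X Y v j) i).
    apply/set0Pn; rewrite -card_gt0 lt0n; apply/eqP => I0.
    have : #|\bigcup_(i | i != j0) circle X Y s i|%:R +
       #|\bigcup_(i | i != j) circle X Y (rad2 X Y v j) i|%:R <= m.
      by rewrite -natrD -cardsUI I0 addn0 ler_nat max_card.
    have : 3 * k2 * m <= 3 / 32 * m by rewrite ler_pM2r //; lra.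
    have : r%:R^-1 * m <= 4^-1 * m by rewrite ler_pM2r.
    by rewrite -/s in b0; lra.
  rewrite inE => /andP[/bigcupP[i _ xi] /bigcupP[i' _ xi']].
  by apply/eqP/esym; have [] := circle_disj v0r xi xi'.
exists X, Y, s; split => //.
  apply: le_trans (_ : #|B|%:R <= _).
    rewrite ler_nat; apply/subset_leq_card/subsetP => v; rewrite inE => /forallP h.
    by apply/negPn/negP => /all_s[j vj]; move: (h j); rewrite vj.
  by apply: le_trans Bk _; rewrite ler_pM2r //; lra.
move=> j; have [jB|] := boolP (circle X Y s j \subset B).
  apply: le_trans (_ : #|B|%:R <= _); first by rewrite ler_nat subset_leq_card.
  apply: le_trans Bk _; rewrite ler_pM2r //.
  have : 0 < r%:R^-1 :> R by rewrite invr_gt0 ltr0n.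
  by lra.
case/subsetPn => v vc vB; have := vc; rewrite inE => /andP[vj /eqP vs].
have vr : 0 < rad2 X Y v j by rewrite vs.
have := big v vB j vj vr; rewrite vs => b1.
have : #|circle X Y s j|%:R + #|\bigcup_(i | i != j) circle X Y s i|%:R <= m.
  rewrite -natrD -cardsUI (_ : _ :&: _ = set0) ?cards0 ?addn0 ?ler_nat ?max_card //.
  apply/setP => x; rewrite !inE; apply/negbTE/negP => /andP[xj /bigcupP[i ij xi]].
  by move/eqP: ij; apply; have xj' : x \in circle X Y s j by [rewrite inE]; have [->] := circle_disj v0r xi xj'.
have : 3 * k2 * m <= kappa * m by rewrite ler_pM2r //; lra.
by lra.
Qed.

(** Let v be off all the circles.  Two vertices other than v of a spread simplex
    through v are on different circles, so its squared side is 2 s.  The points at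
    this squared distance from v lie on the circles on whose axes v lies, apart
    from at most two points on every other circle and the few exceptional points.
    If such a circle exists then v is at squared distance s from the centre, so,
    being on no circle, v is off at least two of the axes.  Hence the sphere has at
    most about (1 - 2/r) n points, in contradiction to [large_sphere]. *)
Lemma lenz_structure : exists2 d : R, 0 < d & exists M : nat,
  forall (T : finType) (p : T -> 'rV[R]_(2 * r)), injective p -> (M <= #|T|)%N ->
  (forall v, (link_density R r k - d) * #|T|%:R ^+ k.-1 <= (simplex_degree p k v)%:R) ->
  exists (X Y : T -> 'I_r -> R) (s : R),
  [/\ is_frame p X Y, 0 < s & forall v, exists j, v \in circle X Y s j].
Proof.
have rp : 0 < r%:R :> R by rewrite ltr0n; lia.
have r2 : 2 <= r%:R :> R by rewrite ler_nat; lia.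
pose e : R := (4 * r%:R)^-1.
have e0 : 0 < e by rewrite invr_gt0 mulr_gt0.
have re : r%:R * e = 4^-1 by rewrite /e; field; rewrite gt_eqF.
have [dA dA0 hA] := large_sphere k4 kr e0.
have [M2 h2] := hA 1%N.
pose kap : R := Num.min dA (e / (4 * r%:R)).
have kap0 : 0 < kap by rewrite lt_min dA0 divr_gt0 // mulr_gt0.
have kapA : kap <= dA by rewrite ge_min lexx.
have kapB : kap * (4 * r%:R) <= e by rewrite -ler_pdivlMr ?mulr_gt0 // ge_min lexx orbT.
have [d1 d10 [M1 h1]] := circles_exist kap0.
exists (Num.min dA d1); first by rewrite lt_min dA0 d10.
exists (M1 + M2 + (Num.truncn ((2 * r)%:R / kap)).+1)%N => T p p_inj hT hdeg.
set m : R := #|T|%:R.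
have mL : (2 * r)%:R <= kap * m.
  rewrite mulrC -ler_pdivrMr //; apply: ltW; apply: lt_le_trans (truncnS_gt _) _.
  by rewrite ler_nat; apply: leq_trans hT; exact: leq_addl.
have m0 : 0 < m by rewrite ltr0n; apply: leq_trans hT; rewrite addnS.
have hT1 : (M1 <= #|T|)%N by apply: leq_trans hT; rewrite -addnA leq_addr.
have hT2 : (M2 <= #|T|)%N by apply: leq_trans hT; rewrite addnAC leq_addl.
have mk0 : 0 < m ^+ k.-1 by exact: exprn_gt0.
have hdeg' d' : Num.min dA d1 <= d' -> forall v,
    (link_density R r k - d') * #|T|%:R ^+ k.-1 <= (simplex_degree p k v)%:R.
  by move=> dd' v; apply: le_trans (hdeg v); rewrite ler_pM2r // lerD2l lerN2.
have [|X [Y [s [fr s0 Bk nk]]]] := h1 T p p_inj hT1 (hdeg' d1 _).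
  by rewrite ge_min lexx orbT.
exists X, Y, s; split => // v; apply: contrapT => /forallNP nv.
pose B := [set v | [forall j, v \notin circle X Y s j]].
have BS y : y \notin B -> exists j, [/\ on_plane X Y y j, 0 < rad2 X Y y j & rad2 X Y y j \in [:: s]].
  rewrite inE negb_forall => /existsP[j]; rewrite negbK inE => /andP[yj /eqP ys].
  by exists j; rewrite ys inE.
pose J := [set j | (X v j == 0) && (Y v j == 0)].
have h : (1 - r%:R^-1 - e) * m <= #|sphere p (2 * s) v|%:R.
  apply: (h2 T p X Y p_inj fr hT2 v B [:: s]) => //.
  - by apply: le_trans Bk _; apply: ler_wpM2r => //; exact: ltW.
  - by move=> y yB _; exact: BS.
  - move=> A /simplexP[Ak [a Aa]] vA sA x y xA yA xy; rewrite (Aa x y) // {x y xA yA xy}.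
    have [|y1 [y2 [y1A y2A y1v y2v y12]]] := @two_others _ v A; first by rewrite Ak; exact: ltnW.
    have [y1B _] := sA y1 y1A y1v; have [y2B _] := sA y2 y2A y2v.
    have [j1 [p1 rd1]] := BS y1 y1B; rewrite inE => /eqP e1.
    have [j2 [p2 rd2]] := BS y2 y2B; rewrite inE => /eqP e2.
    have j12 : j1 != j2 := spread_planes sA y1A y2A y2v y12 p1 p2 rd1.
    by rewrite -(Aa y1 y2) // (qd_cross fr j12 p1 p2) e1 e2; ring.
  - by apply: hdeg'; rewrite ge_min lexx.
(* i1 and i2 are two planes whose circles the sphere meets in at most two points *)
have [i1 [i2 [i12 hs]]] : exists i1 i2 : 'I_r, i1 != i2 /\
   (sphere p (2 * s) v \subset B :|: \bigcup_(i | off_axis X Y v i)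
       [set x | [&& on_plane X Y x i, rad2 X Y x i == s & qd p v x == 2 * s]] :|:
     \bigcup_(i | (i != i1) && (i != i2)) circle X Y s i).
  pose i0 : 'I_r := Ordinal (ltn_trans (isT : (0 < 3)%N) (leq_trans k4 kr)).
  pose i1' : 'I_r := Ordinal (ltn_trans (isT : (1 < 3)%N) (leq_trans k4 kr)).
  have sph x i : x \in sphere p (2 * s) v -> x \in circle X Y s i -> ~~ off_axis X Y v i ->
      \sum_(l < r) rad2 X Y v l = s.
    rewrite !inE => /andP[_ /eqP qx] /andP[xi /eqP xs]; rewrite negbK => /eqP[x0 y0].
    by move: qx; rewrite (qd_orth fr xi x0 y0) xs; lra.
  have offP x i : x \in sphere p (2 * s) v -> x \in circle X Y s i -> off_axis X Y v i ->
      x \in \bigcup_(i | off_axis X Y v i)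
       [set x | [&& on_plane X Y x i, rad2 X Y x i == s & qd p v x == 2 * s]].
    rewrite !inE => /andP[_ qx] /andP[xi xs] vi.
    by apply/bigcupP; exists i => //; rewrite inE xi xs qx.
  have Bc x : x \notin B -> exists i, x \in circle X Y s i.
    by rewrite inE negb_forall => /existsP[i]; rewrite negbK => xi; exists i.
  have [vs|vs] := eqVneq (\sum_(l < r) rad2 X Y v l) s; last first.
    exists i0, i1'; split => //; apply/subsetP => x xs.
    rewrite !in_setU; have [//|/Bc[i xi]] := boolP (x \in B).
    have [vi|vi] := boolP (off_axis X Y v i); first by rewrite (offP x i).
    by move: vs; rewrite (sph x i xs xi vi) eqxx.
  have [i1 vi1] : exists i1, off_axis X Y v i1.
    apply: contrapT => /forallNP hi; move: s0; rewrite -vs big1 ?ltxx // => i _.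
    by have /negP := hi i; rewrite negbK => /eqP[x0 y0]; rewrite /rad2 x0 y0 expr0n addr0.
  have [i2 [i21 vi2]] : exists i2, i2 != i1 /\ off_axis X Y v i2.
    apply: contrapT => /forallNP hi; apply: (nv i1); rewrite inE.
    have h0 i : i != i1 -> X v i = 0 /\ Y v i = 0.
      move=> ii1; have : ~~ off_axis X Y v i by apply/negP => vi; apply: (hi i).
      by rewrite negbK => /eqP[-> ->].
    apply/andP; split; first exact/on_planeP.
    rewrite -vs (bigD1 i1) //= big1 ?addr0 // => i /h0[x0 y0].
    by rewrite /rad2 x0 y0 expr0n addr0.
  exists i1, i2; split; first by rewrite eq_sym.
  apply/subsetP => x xs.
  rewrite !in_setU; have [//|/Bc[i xi]] := boolP (x \in B).
  have [vi|vi] := boolP (off_axis X Y v i); first by rewrite (offP x i).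
  apply/orP; right; apply/bigcupP; exists i => //.
  by apply/andP; split; apply: contraNneq vi => ->.
have hc : #|sphere p (2 * s) v|%:R <= kap * m + (2 * r)%:R + (r%:R - 2) * ((r%:R^-1 + kap) * m).
  apply: le_trans (_ : (#|B| + 2 * r + \sum_(i | (i != i1) && (i != i2)) #|circle X Y s i|)%:R <= _).
    rewrite ler_nat; apply: leq_trans (subset_leq_card hs) _.
    apply: leq_trans (leq_card_setU _ _).1 _; apply: leq_add; last exact: card_bigcup_le.
    apply: leq_trans (leq_card_setU _ _).1 _; rewrite leq_add2l.
    apply: leq_trans (card_bigcup_le _ _ _) _.
    apply: (@leq_trans (\sum_(i < r) 2)); last by rewrite sum_nat_const card_ord mulnC.
    rewrite big_mkcond /=; apply: leq_sum => i _; case: ifP => // vi.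
    exact: card_circle_sphere.
  rewrite !natrD; apply: lerD; first by rewrite lerD2r.
  rewrite natr_sum; apply: le_trans (_ : \sum_(i | (i != i1) && (i != i2)) (r%:R^-1 + kap) * m <= _).
    by apply: ler_sum => i _; exact: nk.
  rewrite sumr_cst mulrC; apply: ler_wpM2r.
    by rewrite mulr_ge0 ?addr_ge0 ?invr_ge0 ?ltW.
  rewrite -(natrB R (_ : 2 <= r)%N) ?ler_nat; last by rewrite -(ler_nat R).
  have -> : [set i | (i != i1) && (i != i2)] = ~: [set i1; i2].
    by apply/setP => i; rewrite !inE negb_or.
  by rewrite -[X in (_ <= X - _)%N](card_ord r) -(cardsC [set i1; i2]) cards2 i12 addKn.
have E : (r%:R - 2) * ((r%:R^-1 + kap) * m) = m - 2 * (r%:R^-1 * m) + (r%:R - 2) * kap * m.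
  by field; rewrite gt_eqF.
have kr2 : (r%:R - 2) * kap * m <= r%:R * kap * m.
  by apply: ler_wpM2r; [exact: ltW | apply: ler_wpM2r; [exact: ltW | lra]].
have kB : r%:R * kap * m <= e / 4 * m.
  by apply: ler_wpM2r; [exact: ltW | lra].
have kC : kap * m <= e / 8 * m.
  apply: ler_wpM2r; first exact: ltW.
  have : kap * 2 <= kap * r%:R by rewrite ler_pM2l.
  by lra.
have eE : e * m = 4^-1 * (r%:R^-1 * m) by rewrite /e; field; rewrite gt_eqF.
have q0 : 0 < r%:R^-1 * m by rewrite mulr_gt0 // invr_gt0.
move: h hc; rewrite E; set Q := r%:R^-1 * m in eE q0 E *.
have -> : (1 - r%:R^-1 - e) * m = m - Q - e * m by rewrite /Q; ring.
by lra.
Qed.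
End Lenz.

(** * Choosing one piece in each plane *)

Section Profiles.
Local Open Scope nat_scope.
Variable r : nat.

(** With eps_j edges and nu_j points in the j-th part: the number of ways to choose
    an edge in the parts of J and a point in those of I, k points in all. *)
Definition profile_sum (k : nat) (eps nu : 'I_r -> nat) : nat :=
  \sum_(J : {set 'I_r} | 2 * #|J| <= k)
    (\prod_(j in J) eps j) *
    (\sum_(I : {set 'I_r} | (I \subset ~: J) && (#|I| == k - 2 * #|J|)) \prod_(i in I) nu i).

(** The first sum of [fk] is the term of the empty J. *)
Lemma fk_profile_sum (k : nat) (nu : 'I_r -> nat) :
  fk k nu = profile_sum k (fun j => nu j - ~~ (4 %| nu j)) nu.
Proof.
set eps := fun j => nu j - ~~ (4 %| nu j).
pose G (l : nat) (J : {set 'I_r}) := (\prod_(j in J) eps j) *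
    (\sum_(I : {set 'I_r} | (I \subset ~: J) && (#|I| == k - 2 * l)) \prod_(i in I) nu i).
have -> : fk k nu = \sum_(0 <= l < (k %/ 2).+1) \sum_(J : {set 'I_r} | #|J| == l) G l J.
  rewrite /fk [RHS]big_nat_recl //; congr (_ + _); last by rewrite big_add1.
  rewrite [RHS](big_pred1 set0) => [|J]; last by rewrite /= cards_eq0.
  rewrite /G big_set0 mul1n; apply: eq_bigl => I.
  by rewrite setC0 subsetT muln0 subn0.
rewrite big_mkord /profile_sum.
rewrite (exchange_big_dep (fun J : {set 'I_r} => 2 * #|J| <= k)) /=; last first.
  by move=> l J _ /eqP->; rewrite mulnC -leq_divRL // -ltnS.
apply: eq_bigr => J Jk.
have lJ : #|J| < (k %/ 2).+1 by rewrite ltnS leq_divRL // mulnC.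
by rewrite (big_pred1 (Ordinal lJ)) // => l; rewrite /= eq_sym.
Qed.

Lemma leq_profile_sum (k : nat) (eps eps' nu : 'I_r -> nat) :
  (forall j, eps j <= eps' j) -> profile_sum k eps nu <= profile_sum k eps' nu.
Proof.
move=> h; apply: leq_sum => J _; rewrite leq_mul2r; apply/orP; right.
exact: leq_prod.
Qed.

Variables (X : finType) (C : 'I_r -> {set X}) (E : 'I_r -> {set {set X}}).
Hypothesis E2 : forall j A, A \in E j -> #|A| = 2.

(** At most one edge of E j or one point of C j is chosen for each j. *)
Definition configs (k : nat) : {set {ffun 'I_r -> {set X}}} :=
  [set phi : {ffun 'I_r -> {set X}} |
    [forall j, [|| phi j == set0, phi j \in [set [set x] | x in C j] | phi j \in E j]] &&
    (\sum_j #|phi j| == k)].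

Let F (J I : {set 'I_r}) (j : 'I_r) : {set {set X}} :=
  if j \in J then E j else if j \in I then [set [set x] | x in C j] else [set set0].

(** J and I are the sets of j where the chosen piece has two points and one point. *)
Lemma card_configs (k : nat) :
  #|configs k| = profile_sum k (fun j => #|E j|) (fun j => #|C j|).
Proof.
have F_card (J I : {set 'I_r}) j A : A \in F J I j -> #|A| = 2 * (j \in J) + ((j \notin J) && (j \in I)).
  rewrite /F; case: ifP => jJ /=; first by move/E2->.
  case: ifP => jI; first by case/imsetP => x _ ->; rewrite cards1.
  by rewrite inE => /eqP->; rewrite cards0.
have prodE (J I : {set 'I_r}) : I \subset ~: J ->
    (\prod_(j in J) #|E j|) * \prod_(i in I) #|C i| = #|family (fun j => mem (F J I j))|.
  move=> IJ; rewrite card_family foldrE big_map big_enum /=.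
  rewrite big_mkcond [X in _ * X]big_mkcond -big_split /=; apply: eq_bigr => j _.
  rewrite /F; case: ifP => jJ.
    by rewrite ifN ?muln1 //; apply: contraTN jJ => /(subsetP IJ); rewrite inE.
  rewrite mul1n; case: ifP => jI; last by rewrite cards1.
  by rewrite card_imset //; exact: set1_inj.
pose JI (phi : {ffun 'I_r -> {set X}}) :=
  ([set j | #|phi j| == 2], [set j | #|phi j| == 1]).
transitivity (\sum_(JI0 : {set 'I_r} * {set 'I_r} | (2 * #|JI0.1| <= k) &&
     ((JI0.2 \subset ~: JI0.1) && (#|JI0.2| == k - 2 * #|JI0.1|)))
     #|family (fun j => mem (F JI0.1 JI0.2 j))|); last first.
  rewrite /profile_sum -(pair_big_dep (fun J : {set 'I_r} => 2 * #|J| <= k)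
    (fun J I : {set 'I_r} => (I \subset ~: J) && (#|I| == k - 2 * #|J|))
    (fun J I => #|family (fun j => mem (F J I j))|)) /=.
  apply: eq_bigr => J _; rewrite big_distrr /=; apply: eq_bigr => I /andP[IJ _].
  by rewrite prodE.
under [RHS]eq_bigr do rewrite -sum1_card.
rewrite (exchange_big_dep predT) //= -sum1_card big_mkcond /=.
apply: eq_bigr => phi _.
have eqv (J I : {set 'I_r}) : [&& 2 * #|J| <= k, (I \subset ~: J) && (#|I| == k - 2 * #|J|) &
     phi \in family (fun j => mem (F J I j))] = (phi \in configs k) && ((J, I) == JI phi).
  apply/idP/idP => [/and3P[Jk /andP[IJ /eqP Ik] /familyP ph]|].
    have phc j := F_card _ _ _ _ (ph j).
    have JE : J = [set j | #|phi j| == 2].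
      by apply/setP => j; rewrite inE phc; case: (j \in J) => //=; case: (j \in I).
    have IE : I = [set j | #|phi j| == 1].
      apply/setP => j; rewrite inE phc; case jJ: (j \in J) => /=; last by case: (j \in I).
      by apply/negbTE; apply: contraTN jJ => /(subsetP IJ); rewrite inE.
    rewrite /JI -IE -JE eqxx andbT inE; apply/andP; split.
      apply/forallP => j; have : phi j \in F J I j := ph j.
      rewrite /F; case: ifP => _; first by move=> ->; rewrite !orbT.
      by case: ifP => _; [move=> ->; rewrite orbT | rewrite inE => ->].
    under eq_bigr do rewrite phc.
    rewrite big_split /= -big_distrr /= -[X in _ == X](subnKC Jk) -Ik; apply/eqP; congr (2 * _ + _).
      by rewrite -sum1_card [RHS]big_mkcond /=; apply: eq_bigr => j _; case: (j \in J).
    rewrite -sum1_card [RHS]big_mkcond /=; apply: eq_bigr => j _.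
    case jI: (j \in I); last by rewrite andbF.
    by have := subsetP IJ j jI; rewrite inE => ->.
  case/andP; rewrite inE => /andP[/forallP ph /eqP phk] /eqP[-> ->].
  have phj j : #|phi j| = 2 * (#|phi j| == 2) + (#|phi j| == 1).
    case/or3P: (ph j) => [/eqP->|/imsetP[x _ ->]|/E2->] //; by rewrite ?cards0 ?cards1.
  have sumk : 2 * #|[set j | #|phi j| == 2]| + #|[set j | #|phi j| == 1]| = k.
    rewrite -phk; under eq_bigr do rewrite phj.
    rewrite big_split /= -big_distrr /=; congr (2 * _ + _).
      by rewrite -sum1dep_card big_mkcond /=; apply: eq_bigr => j _; case: (_ == 2).
    by rewrite -sum1dep_card big_mkcond /=; apply: eq_bigr => j _; case: (_ == 1).
  apply/and3P; split.
  - by rewrite -sumk leq_addr.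
  - apply/andP; split; last by rewrite -[X in X - _]sumk addKn.
    by apply/subsetP => j; rewrite !inE => /eqP->.
  - apply/familyP => j; rewrite /F !inE.
    case/or3P: (ph j) => [/eqP h|/imsetP[x xC h]|h].
    + by rewrite h cards0 /= inE.
    + by rewrite h cards1 /=; apply: imset_f.
    + by rewrite (E2 h) /=.
case: ifP => phc.
  rewrite (big_pred1 (JI phi)) // => -[J I]; rewrite /= -[RHS]andTb -phc -eqv.
  by rewrite !andbA.
rewrite big1 // => -[J I] /=; rewrite -!andbA => h.
by have := eqv J I; rewrite -!andbA h phc.
Qed.
End Profiles.

(** * Simplices in a Lenz configuration *)

Section LenzCount.
Variables (R : realType) (r : nat) (T : finType) (p : T -> 'rV[R]_(2 * r)).
Hypothesis p_inj : injective p.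
Variables (X Y : T -> 'I_r -> R) (s : R).
Hypotheses (fr : is_frame p X Y) (s0 : 0 < s).

Local Notation circ := (circle X Y s).

(** The pairs of points of the j-th circle that differ by a quarter turn
    ([circle_qd]). *)
Definition edges (j : 'I_r) : {set {set T}} :=
  [set e : {set T} | [exists u : T * T, [&& u.1 \in circ j, u.2 \in circ j, u.1 != u.2,
     qd p u.1 u.2 == 2 * s & e == [set u.1; u.2]]]].

Lemma edgesP j e : reflect (exists x y, [/\ x \in circ j, y \in circ j, x != y,
   qd p x y = 2 * s & e = [set x; y]]) (e \in edges j).
Proof.
rewrite inE; apply: (iffP existsP) => [[[x y] /= /and5P[xj yj xy /eqP q /eqP ->]]|[x [y [xj yj xy q ->]]]].
  by exists x, y.
by exists (x, y); rewrite /= xj yj xy q !eqxx.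
Qed.

Lemma card_edge j e : e \in edges j -> #|e| = 2%N.
Proof. by case/edgesP => x [y [_ _ xy _ ->]]; rewrite cards2 xy. Qed.

Section OneCircle.
Variable j : 'I_r.

Let pd x y := X x j * X y j + Y x j * Y y j.
Let cr x y := X x j * Y y j - Y x j * X y j.

Lemma circle_pd x : x \in circ j -> pd x x = s.
Proof. by rewrite inE => /andP[_ /eqP <-]; rewrite /pd /rad2; ring. Qed.

Lemma circle_qd x y : x \in circ j -> y \in circ j -> qd p x y = 2 * s - 2 * pd x y.
Proof.
rewrite !inE => /andP[xj /eqP xs] /andP[yj /eqP ys].
by rewrite (qd_same fr xj yj) xs ys /pd; ring.
Qed.

Definition perp (x : T) : {set T} := [set y in circ j | pd x y == 0].

Lemma circle_off_axis x : x \in circ j -> off_axis X Y x j.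
Proof.
rewrite inE => /andP[_ /eqP xs]; apply: contraTneq s0 => -[x0 y0].
by rewrite -xs /rad2 x0 y0 expr0n addr0 ltxx.
Qed.

Lemma card_circle_at x a : x \in circ j -> (#|[set y in circ j | qd p x y == a]| <= 2)%N.
Proof.
move=> xj; have := card_circle_sphere p_inj fr s a (circle_off_axis xj).
apply: leq_trans; apply/subset_leq_card/subsetP => y.
by rewrite !inE => /andP[/andP[-> ->] ->].
Qed.

Lemma card_perp x : x \in circ j -> (#|perp x| <= 2)%N.
Proof.
move=> xj; apply: leq_trans (card_circle_at (2 * s) xj).
apply/subset_leq_card/subsetP => y; rewrite !inE => /andP[yj /eqP h].
have yj' : y \in circ j by rewrite inE.
by rewrite yj circle_qd // h mulr0 subr0 eqxx.
Qed.

Lemma sum_perp : (2 * #|edges j| <= \sum_(x in circ j) #|perp x|)%N.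
Proof.
rewrite -(@sum_pointed _ 2 (edges j)); last by move=> A; exact: card_edge.
rewrite [X in (_ <= X)%N]big_mkcond /=; apply: leq_sum => x _.
case: ifP => xj.
  apply: leq_trans (leq_imset_card (fun y => [set x; y]) _).
  apply/subset_leq_card/subsetP => e; rewrite inE => /andP[/edgesP[y [z [yj zj yz q ->]]]].
  have pd0 y' z' : y' \in circ j -> z' \in circ j -> qd p y' z' = 2 * s -> pd y' z' = 0.
    by move=> yj' zj'; rewrite circle_qd //; lra.
  rewrite !inE => /orP[/eqP->|/eqP->]; apply/imsetP.
    by exists z => //; rewrite inE zj pd0 ?eqxx.
  by exists y; [rewrite inE yj pd0 ?eqxx // qdC | rewrite setUC].
rewrite leqn0 cards_eq0; apply/eqP/setP => e; rewrite in_set0 in_set; apply/negbTE/negP.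
move=> /andP[/edgesP[y [z [yj zj _ _ ->]]]]; rewrite in_set2 => /orP[]/eqP xE.
  by rewrite xE yj in xj.
by rewrite xE zj in xj.
Qed.

(** x and y are vertices of one square inscribed in the circle, as one is a multiple
    of the other by a power of the quarter turn. *)
Definition quad (x y : T) : bool := (pd x y == 0) || (cr x y == 0).

Lemma quad_trans x y z : y \in circ j -> quad x y -> quad y z -> quad x z.
Proof.
move=> yj; have ys := circle_pd yj.
have e1 : s * cr x z = cr x y * pd y z + pd x y * cr y z by rewrite -ys /pd /cr; ring.
have e2 : s * pd x z = pd x y * pd y z - cr x y * cr y z by rewrite -ys /pd /cr; ring.
have c0 w : s * w = 0 -> w == 0 by move/eqP; rewrite mulf_eq0 (gt_eqF s0).
rewrite /quad => /orP[]/eqP h1 /orP[]/eqP h2; apply/orP.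
- by right; apply: c0; rewrite e1 h1 h2; ring.
- by left; apply: c0; rewrite e2 h1 h2; ring.
- by left; apply: c0; rewrite e2 h1 h2; ring.
- by right; apply: c0; rewrite e1 h1 h2; ring.
Qed.

Lemma quad_sym x y : quad x y = quad y x.
Proof.
rewrite /quad; have -> : pd y x = pd x y by rewrite /pd; ring.
have -> : cr y x = - cr x y by rewrite /cr; ring.
by rewrite oppr_eq0.
Qed.

(** The class of x is [perp x] together with [perp y] for any y in [perp x]. *)
Lemma dvdn4_circle : (forall x, x \in circ j -> #|perp x| = 2%N) -> (4 %| #|circ j|)%N.
Proof.
move=> p2; pose P := equivalence_partition quad (circ j).
have eq : {in circ j & &, equivalence_rel quad}.
  move=> x y z xj yj zj; split; first by rewrite /quad /cr [_ * _ in X in _ || X]mulrC subrr eqxx orbT.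
  move=> xy; apply/idP/idP; last exact: quad_trans.
  by apply: quad_trans => //; rewrite quad_sym.
have pP := equivalence_partitionP eq.
rewrite (card_uniform_partition (n := 4) _ pP) ?dvdn_mull // => A /imsetP[x xj ->].
have [y yx] : exists y, y \in perp x by apply/set0Pn; rewrite -card_gt0 p2.
have [yj pxy] : y \in circ j /\ pd x y = 0 by move: yx; rewrite inE => /andP[-> /eqP].
have ys := circle_pd yj; have xs := circle_pd xj.
have e1 z : s * cr x z = cr x y * pd y z.
  have : s * cr x z = cr x y * pd y z + pd x y * cr y z by rewrite -ys /pd /cr; ring.
  by rewrite pxy mul0r addr0.
have cxy : cr x y != 0.
  have : cr x y ^+ 2 + pd x y ^+ 2 = pd x x * pd y y by rewrite /pd /cr; ring.
  rewrite xs ys pxy expr0n addr0; apply: contra_eq_neq => ->.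
  by rewrite expr0n /= eq_sym mulf_neq0 ?gt_eqF.
have pc z : (pd y z == 0) = (cr x z == 0).
  apply/eqP/eqP => h; apply/eqP; move/eqP: (e1 z); rewrite h mulr0.
    by rewrite mulf_eq0 gt_eqF.
  by rewrite eq_sym mulf_eq0 (negbTE cxy).
have -> : [set z in circ j | quad x z] = perp x :|: perp y.
  by apply/setP => z; rewrite !in_set pc -andb_orr.
have d0 : perp x :&: perp y = set0.
  apply/setP => z; rewrite in_set0 in_setI; apply/negbTE/negP.
  rewrite [z \in perp x]in_set [z \in perp y]in_set pc => /andP[/andP[zj /eqP h1] /andP[_ /eqP h2]].
  have zs := circle_pd zj.
  have : cr x z ^+ 2 + pd x z ^+ 2 = pd x x * pd z z by rewrite /pd /cr; ring.
  rewrite h1 h2 xs zs !expr0n addr0 => /esym/eqP.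
  by rewrite mulf_eq0 gt_eqF.
have := cardsUI (perp x) (perp y).
by rewrite d0 cards0 addn0 (p2 x xj) (p2 y yj) => ->.
Qed.

(** By double counting twice the number of edges is at most twice the number of
    points, and equality means that every point has two quarter turns. *)
Lemma card_edges : (#|edges j| <= #|circ j| - ~~ (4 %| #|circ j|))%N.
Proof.
have le2 : (\sum_(x in circ j) #|perp x| <= #|circ j| * 2)%N.
  by rewrite -sum_nat_const; apply: leq_sum => x; exact: card_perp.
have le1 : (#|edges j| <= #|circ j|)%N.
  by rewrite -(leq_pmul2l (isT : (0 < 2)%N)) [X in (_ <= X)%N]mulnC (leq_trans sum_perp).
have [//|d4] := boolP (4 %| _)%N; first by rewrite subn0.
rewrite subn1 -ltnS prednK; last by rewrite lt0n; apply: contraNneq d4 => ->.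
rewrite ltn_neqAle le1 andbT; apply: contraNneq d4 => eqn.
apply: dvdn4_circle => x xj; apply/eqP; rewrite eqn_leq card_perp //= leqNgt; apply/negP => lt.
have : (\sum_(x in circ j) #|perp x| < #|circ j| * 2)%N.
  rewrite -sum_nat_const (bigD1 x) //= [X in (_ < X)%N](bigD1 x) //= -addSn.
  apply: leq_add => //; apply: leq_sum => y /andP[yj _]; exact: card_perp.
by move=> /(leq_ltn_trans sum_perp); rewrite eqn mulnC ltnn.
Qed.
End OneCircle.

Hypothesis cov : forall v, exists j, v \in circ j.

(** A point of a circle has at most two points of it at any given distance. *)
Lemma simplex_not_in_circle (k : nat) (A : {set T}) (j : 'I_r) : (3 < k)%N ->
  A \in simplices p k -> ~~ (A \subset circ j).
Proof.
move=> k3 /simplexP[Ak [a Aa]]; apply/negP => /subsetP Aj.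
have [x xA] : exists x, x \in A by apply/set0Pn; rewrite -card_gt0 Ak; apply: leq_ltn_trans k3.
have : (2 < #|A :\ x|)%N by rewrite (cardsD1 x) xA add1n in Ak; rewrite -ltnS Ak.
apply/negP; rewrite -leqNgt; apply: leq_trans (card_circle_at a (Aj x xA)).
apply/subset_leq_card/subsetP => y; rewrite !in_setD1 => /andP[yx yA].
by rewrite in_set Aj //= Aa ?eqxx // eq_sym.
Qed.

Lemma simplex_side (k : nat) (A : {set T}) : (3 < k)%N -> A \in simplices p k ->
  forall x y, x \in A -> y \in A -> x != y -> qd p x y = 2 * s.
Proof.
move=> k3 As; have /simplexP[Ak [a Aa]] := As.
suff <- : a = 2 * s by [].
have [x xA] : exists x, x \in A by apply/set0Pn; rewrite -card_gt0 Ak; apply: leq_ltn_trans k3.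
have [i xi] := cov x.
have /subsetPn[y yA yi] := simplex_not_in_circle i k3 As.
have [l yl] := cov y.
have il : i != l by apply: contraNneq yi => ->.
have xy : x != y by apply: contraNneq yi => <-.
move: xi yl; rewrite !inE => /andP[xi /eqP xs] /andP[yl /eqP ys].
by rewrite -(Aa x y) // (qd_cross fr il xi yl) xs ys; ring.
Qed.

(** A simplex is determined by its intersections with the circles.  Three of its
    points on one circle would be three pairwise orthogonal vectors in a plane. *)
Lemma card_lenz_simplices (k : nat) : (3 < k)%N ->
  (#|simplices p k| <= fk k (fun j => #|circ j|))%N.
Proof.
move=> k3; rewrite fk_profile_sum.
apply: leq_trans (leq_profile_sum _ _ card_edges).
rewrite -(card_configs _ card_edge).
pose phi (A : {set T}) : {ffun 'I_r -> {set T}} := [ffun j => A :&: circ j].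
have phiK A : \bigcup_j phi A j = A.
  apply/setP => x; apply/bigcupP/idP => [[j _]|xA].
    by rewrite ffunE inE => /andP[].
  by have [j xj] := cov x; exists j => //; rewrite ffunE inE xA.
rewrite -(card_imset (f := phi)); last first.
  by move=> A A' h; rewrite -(phiK A) h phiK.
apply/subset_leq_card/subsetP => _ /imsetP[A As ->].
have /simplexP[Ak _] := As; have Aq := simplex_side k3 As.
rewrite inE; apply/andP; split.
  apply/forallP => j; rewrite ffunE.
  case n0: #|A :&: circ j| => [|n]; first by rewrite -cards_eq0 n0.
  case: n n0 => [|n] n0.
    have /cards1P[x xE] : #|A :&: circ j| == 1%N by rewrite n0.
    apply/or3P; apply: Or32; rewrite xE; apply: imset_f.
    by have : x \in A :&: circ j; [rewrite xE set11 | rewrite inE => /andP[]].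
  case: n n0 => [|n] n0.
    have /cards2P[x [y [xy xyE]]] : #|A :&: circ j| == 2%N by rewrite n0.
    have : x \in A :&: circ j by rewrite xyE !inE eqxx.
    have : y \in A :&: circ j by rewrite xyE !inE eqxx orbT.
    rewrite !in_setI => /andP[yA yj] /andP[xA xj].
    by apply/or3P; apply: Or33; apply/edgesP; exists x, y; split => //; exact: Aq.
  have /card_gt2P[x [y [z [[xI yI zI] [xy yz zx]]]]] : (2 < #|A :&: circ j|)%N by rewrite n0.
  move: xI yI zI; rewrite !in_setI => /andP[xA xj] /andP[yA yj] /andP[zA zj].
  have q1 := Aq x y xA yA xy; have q2 := Aq y z yA zA yz.
  have q3 := Aq z x zA xA zx.
  move: q1 q2 q3; rewrite !(circle_qd (j := j)) // => q1 q2 q3.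
  exfalso; have xs := circle_pd xj; have ys := circle_pd yj; have zs := circle_pd zj.
  have d1 : X x j * X y j + Y x j * Y y j = 0 by lra.
  have d2 : X y j * X z j + Y y j * Y z j = 0 by lra.
  have d3 : X z j * X x j + Y z j * Y x j = 0 by lra.
  have : s * s * s = 0.
    rewrite -{1}xs -{1}ys -{1}zs.
    set x1 := X x j in d1 d3 *; set x2 := Y x j in d1 d3 *; set y1 := X y j in d1 d2 *.
    set y2 := Y y j in d1 d2 *; set z1 := X z j in d2 d3 *; set z2 := Y z j in d2 d3 *.
    have -> : (x1 * x1 + x2 * x2) * (y1 * y1 + y2 * y2) * (z1 * z1 + z2 * z2) =
        (x1 * y1 + x2 * y2) ^+ 2 * (z1 * z1 + z2 * z2) +
        (x1 * y2 - x2 * y1) * ((y2 * z1 - y1 * z2) * (z1 * x1 + z2 * x2)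
          + (x1 * z2 - x2 * z1) * (y1 * z1 + y2 * z2)).
      by ring.
    by rewrite d1 d2 d3; ring.
  by apply/eqP; rewrite !mulf_neq0 // gt_eqF.
rewrite -Ak; under eq_bigr do rewrite ffunE.
apply/eqP; rewrite -sum1_card; under eq_bigr do rewrite -sum1_card.
rewrite (exchange_big_dep (mem A)) /=; last by move=> j x _; rewrite inE => /andP[].
apply: eq_bigr => x xA; have [j xj] := cov x.
rewrite (big_pred1 j) // => i; rewrite in_setI xA /=; apply/idP/eqP => [xi|->//].
by have [] := circle_disj s0 xi xj.
Qed.
End LenzCount.

(** * Lenz configurations with many simplices *)

Local Open Scope fset_scope.
Local Open Scope ring_scope.

Section FsetLink.
Variables (R : realType) (r : nat) (T : finType) (p : T -> 'rV[R]_(2 * r)).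
Hypothesis p_inj : injective p.

(** The point set indexed by A; [simplices] counts sets of indices. *)
Definition pts (A : {set T}) : {fset 'rV[R]_(2 * r)} := [fset p x | x in A].

Lemma mem_pts A x : (p x \in pts A) = (x \in A).
Proof.
apply/imfsetP/idP => [[y /= yA /p_inj ->]|xA] //; last by exists x.
Qed.

Lemma card_pts A : #|` pts A| = #|A|.
Proof. by rewrite card_imfset //= cardE. Qed.

Lemma pts_inj : injective pts.
Proof. by move=> A B h; apply/setP => x; rewrite -!mem_pts h. Qed.

Lemma regular_pts (k : nat) A : regular_simplex k (pts A) = (A \in simplices p k).
Proof.
rewrite inE /regular_simplex card_pts; congr (_ && _).
have edistE x y : edist (p x) (p y) = Num.sqrt (qd p x y) by [].
apply/asboolP/asboolP => -[a h].
  exists (a ^+ 2) => x y xA yA xy; rewrite -(h (p x) (p y)) ?mem_pts //.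
    by rewrite edistE sqr_sqrtr // sqd_ge0.
  by rewrite (inj_eq p_inj).
exists (Num.sqrt a) => _ _ /imfsetP[x xA ->] /imfsetP[y yA ->] xy.
by rewrite edistE (h x y) // -(inj_eq p_inj).
Qed.

Lemma num_simplices_pts (k : nat) (Z : {set T}) :
  num_simplices k (pts Z) = #|[set A in simplices p k | A \subset Z]|.
Proof.
rewrite /num_simplices (_ : [fset S in _ | _] =
   [fset pts A | A in [set A in simplices p k | A \subset Z]]).
  rewrite card_imfset /= ?cardE //; exact: pts_inj.
apply/fsetP => S; rewrite !inE /= fpowersetE; apply/andP/imfsetP.
  move=> [/fsubsetP SZ Sr].
  have SE : S = pts [set x in Z | p x \in S].
    apply/fsetP => y; apply/idP/imfsetP => [yS|[x /=]]; last by rewrite inE => /andP[_ xS] ->.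
    by have /imfsetP[x /= xZ yE] := SZ y yS; exists x; rewrite // inE xZ -yE.
  exists [set x in Z | p x \in S] => //; rewrite inE -regular_pts -SE Sr /=.
  by apply/subsetP => x; rewrite inE => /andP[].
move=> [A /=]; rewrite inE => /andP[As /subsetP AZ] ->; rewrite regular_pts; split => //.
by apply/fsubsetP => _ /imfsetP[x /= xA ->]; rewrite mem_pts AZ.
Qed.
End FsetLink.

Section CirclePoints.
Variable R : realType.

(** Any injective sequence in the open interval from 0 to 1 would do: the quarter
    turns of distinct points of the open first quadrant are distinct. *)
Definition base_x (q : nat) : R := q.+2%:R^-1.
Definition base_y (q : nat) : R := Num.sqrt (1 - base_x q ^+ 2).

(** The points 4 q, ..., 4 q + 3 form a square, so that initial segments consist of
    squares and part of a square. *)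
Definition circle_pt (i : nat) : R * R :=
  let x := base_x (i %/ 4)%N in let y := base_y (i %/ 4)%N in
  match i %% 4 with 0 => (x, y) | 1 => (- y, x) | 2 => (- x, - y) | _ => (y, - x) end%N.

Definition turn (i : nat) : nat := (if i %% 4 == 3 then i - 3 else i.+1)%N.

Lemma base_gt0 q : 0 < base_x q /\ 0 < base_y q.
Proof.
have x0 : 0 < base_x q by rewrite invr_gt0 ltr0n.
split => //; rewrite sqrtr_gt0 subr_gt0 expr_lt1 ?ltW //.
by rewrite invf_lt1 ?ltr1n ?ltr0n.
Qed.

Lemma base_norm q : base_x q ^+ 2 + base_y q ^+ 2 = 1.
Proof.
have [x0 _] := base_gt0 q; rewrite /base_y sqr_sqrtr; first by rewrite addrC subrK.
rewrite subr_ge0 expr_le1 ?(ltW x0) //.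
by rewrite invf_le1 ?ler1n ?ltr0n.
Qed.

Lemma circle_pt_norm i : (circle_pt i).1 ^+ 2 + (circle_pt i).2 ^+ 2 = 1.
Proof.
rewrite -(base_norm (i %/ 4)%N) /circle_pt.
by case: (i %% 4)%N => [|[|[|n]]] /=; rewrite ?sqrrN // addrC.
Qed.

Lemma circle_pt_inj : injective circle_pt.
Proof.
move=> i j; rewrite /circle_pt => ij.
suff [qE mE] : (i %/ 4 = j %/ 4)%N /\ (i %% 4 = j %% 4)%N.
  by rewrite (divn_eq i 4) (divn_eq j 4) qE mE.
have xinj q q' : base_x q = base_x q' -> q = q'.
  by move/invr_inj/eqP; rewrite eqr_nat => /eqP[].
have [x0 y0] := base_gt0 (i %/ 4)%N; have [x1 y1] := base_gt0 (j %/ 4)%N.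
have := ltn_pmod i (isT : (0 < 4)%N); have := ltn_pmod j (isT : (0 < 4)%N).
move: ij; case: (i %% 4)%N => [|[|[|[|n]]]] //; case: (j %% 4)%N => [|[|[|[|n']]]] // [h1 h2] _ _;
  try (split => //; apply: xinj; lra); exfalso; lra.
Qed.

Lemma circle_pt_turn i :
  (circle_pt i).1 * (circle_pt (turn i)).1 + (circle_pt i).2 * (circle_pt (turn i)).2 = 0.
Proof.
have [q [m [m4 ->]]] : exists q m, (m < 4)%N /\ i = (q * 4 + m)%N.
  by exists (i %/ 4)%N, (i %% 4)%N; split; [exact: ltn_pmod | exact: divn_eq].
have tE : turn (q * 4 + m) = (q * 4 + (if m == 3 then 0 else m.+1))%N.
  rewrite /turn modnMDl modn_small //; case: (m =P 3%N) => [->|_]; last by rewrite addnS.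
  by rewrite addnK addn0.
have m'4 : ((if m == 3 then 0 else m.+1) < 4)%N by case: m m4 {tE} => [|[|[|[|]]]].
rewrite tE /circle_pt !divnMDl // !modnMDl !(modn_small m4) !(modn_small m'4).
rewrite !(divn_small m4) !(divn_small m'4) !addn0.
case: m m4 {tE m'4} => [|[|[|[|]]]] //= _; ring.
Qed.

Lemma turn_neq i : turn i != i.
Proof. by rewrite /turn; case: ifP => /eqP h; apply/eqP => h2; have := divn_eq i 4; lia. Qed.

Lemma turn_turn_neq i : turn (turn i) != i.
Proof.
have := divn_eq i 4; have := ltn_pmod i (isT : (0 < 4)%N).
rewrite /turn; case: (eqVneq (i %% 4)%N 3%N) => h h4 h5; case: ifP => /eqP h'; apply/eqP => h2; lia.
Qed.

Lemma turn_lt i n : (i < n -> i.+1 < n \/ 4 %| n -> turn i < n)%N.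
Proof. by rewrite /turn => h1 h2; case: ifP => /eqP h; lia. Qed.
End CirclePoints.

Section LowerBound.
Variables (R : realType) (r n : nat).
Local Notation T := ('I_r * 'I_n)%type.

(** The i-th point of the j-th circle; row a of the matrix holds the a-th
    coordinates in the r planes. *)
Definition lenz_pt (x : T) : 'rV[R]_(2 * r) :=
  mxvec (\matrix_(a < 2, b < r) if b == x.1 then
    (if a == ord0 then (circle_pt R x.2).1 else (circle_pt R x.2).2) else 0).

Lemma qd_lenz (x y : T) : qd lenz_pt x y =
  if x.1 == y.1 then ((circle_pt R x.2).1 - (circle_pt R y.2).1) ^+ 2 +
                     ((circle_pt R x.2).2 - (circle_pt R y.2).2) ^+ 2
  else 2.
Proof.
rewrite /qd /sqd /lenz_pt.
pose co (a : 'I_2) (z : R * R) := if a == ord0 then z.1 else z.2.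
pose G (a : 'I_2) (b : 'I_r) := ((if b == x.1 then co a (circle_pt R x.2) else 0) -
   (if b == y.1 then co a (circle_pt R y.2) else 0)) ^+ 2.
rewrite (reindex _ (curry_mxvec_bij _ _)) /=.
rewrite (eq_bigr (fun ab => G ab.1 ab.2)) => [|[a b] _]; last by rewrite /= !mxvecE !mxE.
rewrite -(pair_bigA _ G) /= !big_ord_recl big_ord0 addr0 /G /co /=.
have key (u v : R) : \sum_(b < r) ((if b == x.1 then u else 0) - (if b == y.1 then v else 0)) ^+ 2 =
    if x.1 == y.1 then (u - v) ^+ 2 else u ^+ 2 + v ^+ 2.
  rewrite (bigD1 x.1) //= eqxx; case: eqP => [xy|/eqP xy].
    by rewrite big1 ?addr0 // => b bx; rewrite -xy (negbTE bx) subrr expr0n.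
  have yx : y.1 != x.1 by rewrite eq_sym.
  rewrite (bigD1 y.1) //= eqxx (negbTE yx) subr0 sub0r sqrrN.
  rewrite big1 ?addr0 // => b /andP[bx bY].
  by rewrite (negbTE bx) (negbTE bY) subrr expr0n.
rewrite !key; case: eqP => // _.
by rewrite addrACA !circle_pt_norm.
Qed.

Lemma lenz_pt_inj : injective lenz_pt.
Proof.
move=> x y xy; have : qd lenz_pt x y = 0.
  by apply/eqP; rewrite /qd sqd_eq0 xy.
rewrite qd_lenz; case: eqP => [e1|_] /eqP; last by rewrite pnatr_eq0.
rewrite paddr_eq0 ?sqr_ge0 // !sqrf_eq0 !subr_eq0 => /andP[/eqP h1 /eqP h2].
have e2 : x.2 = y.2.
  apply/val_inj/(@circle_pt_inj R).
  by rewrite [LHS]surjective_pairing [RHS]surjective_pairing h1 h2.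
by rewrite (surjective_pairing x) (surjective_pairing y) e1 e2.
Qed.

Variable nu : 'I_r -> nat.
Hypothesis nu_le : forall j, (nu j <= n)%N.

Let C (j : 'I_r) : {set 'I_n} := [set i : 'I_n | (i < nu j)%N].
Let edge (i : 'I_n) : {set 'I_n} := [set x : 'I_n | (x == i :> nat) || (x == turn i :> nat)].
Let D (j : 'I_r) : {set 'I_n} := [set i in C j | (turn i < nu j)%N].
Let E (j : 'I_r) : {set {set 'I_n}} := [set edge i | i in D j].
Let Z : {set T} := [set x | x.2 \in C x.1].

Lemma card_column j : #|C j| = nu j.
Proof. by rewrite -sum1dep_card -(big_ord_widen n (fun=> 1%N)) // sum1_card card_ord. Qed.

(** Only the last point of the j-th circle can be without successor, and this
    happens when the last square is incomplete. *)
Lemma card_turnable j : (nu j - ~~ (4 %| nu j) <= #|D j|)%N.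
Proof.
have h (i : 'I_n) : (i < nu j -> i.+1 < nu j \/ 4 %| nu j -> i \in D j)%N.
  by move=> h1 h2; rewrite !inE h1 turn_lt.
have [d4|d4] := boolP (4 %| nu j)%N.
  rewrite subn0 -card_column; apply/subset_leq_card/subsetP => i; rewrite inE => ij.
  by apply: h => //; right.
rewrite leq_subLR -{1}card_column; apply: (@leq_trans #|[set i : 'I_n | i.+1 == nu j :> nat] :|: D j|).
  apply/subset_leq_card/subsetP => i; rewrite inE => ij; rewrite in_setU inE.
  by move: (ij); rewrite leq_eqVlt => /orP[->//|ij']; rewrite h ?orbT //; left.
apply: leq_trans (leq_card_setU _ _).1 _; rewrite leq_add2r.
apply/card_le1_eqP => i i'; rewrite !inE => /eqP e1 /eqP e2.
by apply: val_inj; apply: succn_inj; rewrite e1 e2.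
Qed.

(** A turn edge determines its starting point, as two turns do not lead back. *)
Lemma card_turn_edges j : #|E j| = #|D j|.
Proof.
apply: card_in_imset => i i' _ _ h.
have : i' \in edge i by rewrite h inE eqxx.
rewrite inE => /orP[/eqP/val_inj-> //|/eqP e1].
have : i \in edge i' by rewrite -h inE eqxx.
rewrite inE => /orP[/eqP/val_inj-> //|/eqP e2].
by have := turn_turn_neq i; rewrite -e1 -e2 eqxx.
Qed.

Lemma edgeE (i : 'I_n) (ti : (turn i < n)%N) : edge i = [set i; Ordinal ti].
Proof. by apply/setP => x; rewrite !inE -!val_eqE. Qed.

Lemma card_turn_edge j A : A \in E j -> #|A| = 2%N.
Proof.
case/imsetP => i; rewrite !inE => /andP[_ ti] ->.
have ti' := leq_trans ti (nu_le j).
by rewrite (edgeE ti') cards2 -val_eqE /= eq_sym turn_neq.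
Qed.

Lemma card_lenz_set : #|Z| = (\sum_j nu j)%N.
Proof.
rewrite -sum1dep_card -(pair_big_dep xpredT (fun j i => i \in C j) (fun _ _ => 1%N)) /=.
by apply: eq_bigr => j _; rewrite sum1_card card_column.
Qed.

(** The configurations of turn edges and points of [card_configs] are simplices. *)
Lemma lower_bound (k : nat) : exists P : {fset 'rV[R]_(2 * r)},
  #|` P| = (\sum_j nu j)%N /\ (fk k nu <= num_simplices k P)%N.
Proof.
exists (pts lenz_pt Z); rewrite (card_pts lenz_pt_inj) card_lenz_set; split => //.
rewrite (num_simplices_pts lenz_pt_inj) fk_profile_sum.
apply: leq_trans (leq_profile_sum k nu card_turnable) _.
have -> : profile_sum k (fun j => #|D j|) nu = profile_sum k (fun j => #|E j|) (fun j => #|C j|).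
  by congr profile_sum; apply/funext => j; rewrite ?card_turn_edges ?card_column.
rewrite -(card_configs C card_turn_edge k).
pose f (phi : {ffun 'I_r -> {set 'I_n}}) : {set T} := [set x | x.2 \in phi x.1].
have f_inj : injective f.
  move=> phi psi /setP h; apply/ffunP => j; apply/setP => i.
  by have := h (j, i); rewrite !inE.
rewrite -(card_imset _ f_inj); apply/subset_leq_card/subsetP => _ /imsetP[phi + ->].
rewrite inE => /andP[/forallP ph /eqP phk].
rewrite inE; apply/andP; split; last first.
  apply/subsetP => -[j i]; rewrite !inE /= => ij.
  case/or3P: (ph j) => [/eqP h|/imsetP[x xC h]|/imsetP[x]].
  - by move: ij; rewrite h inE.
  - by move: ij xC; rewrite h !inE => /eqP->.
  - by rewrite !inE => /andP[xj tj] h; move: ij; rewrite h inE => /orP[]/eqP->.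
apply/simplexP; split.
  rewrite -phk -sum1dep_card.
  rewrite -(pair_big_dep xpredT (fun j i => i \in phi j) (fun _ _ => 1%N)) /=.
  by apply: eq_bigr => j _; rewrite sum1_card.
exists 2 => -[j i] [j' i']; rewrite !inE /= qd_lenz /= => ij ij' ne.
case: eqP => // jj; subst j'.
have ii : i != i' by apply: contraNneq ne => ->.
case/or3P: (ph j) => [/eqP h|/imsetP[x xC h]|/imsetP[x]].
- by move: ij; rewrite h inE.
- by move: ij ij' ii; rewrite h !inE => /eqP-> /eqP->; rewrite eqxx.
- rewrite !inE => /andP[xj tj] h.
  have tn := leq_trans tj (nu_le j).
  have tu := circle_pt_turn R x.
  have n1 := circle_pt_norm R x; have n2 := circle_pt_norm R (turn x).
  move: ij ij' ii; rewrite h (edgeE tn) !inE => /orP[]/eqP-> /orP[]/eqP->; rewrite ?eqxx //= => _.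
    by rewrite -[RHS]/(1 + 1) -{1}n1 -n2; apply/eqP; rewrite -subr_eq0; apply/eqP; move: tu; 
      move: (circle_pt R x).1 (circle_pt R x).2 (circle_pt R (turn x)).1 (circle_pt R (turn x)).2 => a b c d; lra.
  by move: tu n1 n2; 
      move: (circle_pt R x).1 (circle_pt R x).2 (circle_pt R (turn x)).1 (circle_pt R (turn x)).2 => a b c d; lra.
Qed.
End LowerBound.

(** * The increments of the maximum and the induction *)

Section MaxFk.
Local Open Scope nat_scope.
Variables (r k : nat).

(** The right-hand side of [theorem5]. *)
Definition max_fk (n : nat) : nat :=
  \max_(nu : {ffun 'I_r -> 'I_n.+1} | (\sum_(i < r) nu i)%N == n)
     fk k (fun i : 'I_r => nat_of_ord (nu i)).

Lemma max_fk_ub (nu : 'I_r -> nat) : fk k nu <= max_fk (\sum_j nu j).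
Proof.
set n := \sum_j nu j.
have nun j : nu j < n.+1 by rewrite ltnS /n (bigD1 j) //= leq_addr.
pose mu : {ffun 'I_r -> 'I_n.+1} := [ffun j => Ordinal (nun j)].
have muE : (fun i : 'I_r => nat_of_ord (mu i)) = nu by apply/funext => j; rewrite ffunE.
have := @leq_bigmax_cond _ (fun nu : {ffun 'I_r -> 'I_n.+1} => (\sum_(i < r) nu i)%N == n)
   (fun nu => fk k (fun i : 'I_r => nat_of_ord (nu i))) mu.
rewrite muE; apply; apply/eqP; apply: eq_bigr => j _.
by rewrite -[LHS]/((fun i : 'I_r => nat_of_ord (mu i)) j) muE.
Qed.

Let g (n : nat) := n - ~~ (4 %| n).

(** If a < b then the left-hand side is at most a and the right-hand side at least
    b - 1. *)
Lemma quad_loss_mono a b : a <= b -> g a <= g b.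
Proof.
rewrite leq_eqVlt => /orP[/eqP->//|ab]; apply: (@leq_trans a); first exact: leq_subr.
by rewrite /g; case: (4 %| b) => /=; lia.
Qed.

Definition elem_sum (nu : 'I_r -> nat) : nat := \sum_(I : {set 'I_r} | #|I| == k) \prod_(i in I) nu i.

(** The new terms of the first sum of [fk] when a point is added to part j. *)
Definition gain (nu : 'I_r -> nat) (j : 'I_r) : nat :=
  \sum_(I : {set 'I_r} | (#|I| == k) && (j \in I)) \prod_(i in I :\ j) nu i.

Lemma fk_add_point (nu : 'I_r -> nat) (j : 'I_r) :
  fk k nu + gain nu j <= fk k (fun i => nu i + (i == j)).
Proof.
rewrite /fk addnAC; apply: leq_add.
  rewrite [X in _ <= X](bigID (fun I : {set 'I_r} => j \in I)) /=.
  rewrite [X in X + _ <= _](bigID (fun I : {set 'I_r} => j \in I)) /= addnAC.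
  rewrite -big_split /=; apply: leq_add; apply: leq_sum => I /andP[_ jI].
    rewrite (bigD1 j) //= [X in _ <= X](bigD1 j) //= eqxx mulnDl mul1n.
    have E : \prod_(i in I | i != j) (nu i + (i == j)) = \prod_(i in I | i != j) nu i.
      by apply: eq_bigr => i /andP[_ /negbTE->]; rewrite addn0.
    rewrite E leq_add2l; apply: eq_leq; apply: eq_bigl => i.
    by rewrite !inE andbC.
  apply: leq_prod => i _; exact: leq_addr.
apply: leq_sum => l _; apply: leq_sum => J _; apply: leq_mul.
  by apply: leq_prod => i _; apply: quad_loss_mono; exact: leq_addr.
by apply: leq_sum => I _; apply: leq_prod => i _; exact: leq_addr.
Qed.

Lemma sum_gain (nu : 'I_r -> nat) : \sum_j nu j * gain nu j = k * elem_sum nu.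
Proof.
rewrite /gain; under eq_bigr do rewrite big_distrr /=.
rewrite (exchange_big_dep (fun I : {set 'I_r} => #|I| == k)) /=; last by move=> j I _ /andP[].
rewrite big_distrr /=; apply: eq_bigr => I /eqP Ik.
transitivity (\sum_(j in I) \prod_(i in I) nu i); last by rewrite sum_nat_const Ik.
apply: eq_big => [j|j /andP[_ jI]]; first by rewrite Ik eqxx.
by rewrite [RHS](bigD1 j) //=; congr (_ * _); apply: eq_bigl => i; rewrite !inE andbC.
Qed.

(** A term of the second sum of [fk] has at most k - 1 factors, and there are at
    most 4^r pairs (J, I). *)
Lemma fk_le_elem_sum (nu : 'I_r -> nat) (m : nat) : 0 < m -> (forall j, nu j <= m) ->
  fk k nu <= elem_sum nu + 4 ^ r * m ^ k.-1.
Proof.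
move=> m0 num; rewrite fk_profile_sum /profile_sum (bigD1 set0) /=; last by rewrite cards0.
rewrite big_set0 mul1n; apply: leq_add.
  by rewrite cards0 muln0 subn0 /elem_sum; apply: eq_leq; apply: eq_bigl => I; rewrite setC0 subsetT.
have prodm (I : {set 'I_r}) (h : 'I_r -> nat) : (forall j, h j <= nu j) -> \prod_(i in I) h i <= m ^ #|I|.
  move=> hnu; rewrite -prod_nat_const; apply: leq_prod => i _; exact: leq_trans (num i).
have cardS : #|{set 'I_r}| = 2 ^ r by rewrite -cardsT -powersetT card_powerset cardsT card_ord.
have -> : 4 ^ r = 2 ^ r * 2 ^ r by rewrite -expnMn.
apply: (@leq_trans (\sum_(J : {set 'I_r}) 2 ^ r * m ^ k.-1)); last first.
  by rewrite sum_nat_const cardS mulnA.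
rewrite big_mkcond /=; apply: leq_sum => J _; case: ifP => // /andP[Jk J0].
apply: (@leq_trans (m ^ #|J| * (2 ^ r * m ^ (k - 2 * #|J|)))).
  apply: leq_mul; first by apply: prodm => j; exact: leq_subr.
  apply: (@leq_trans (\sum_(I : {set 'I_r}) m ^ (k - 2 * #|J|))); last first.
    by rewrite sum_nat_const cardS.
  rewrite big_mkcond /=; apply: leq_sum => I _; case: ifP => // /andP[_ /eqP <-].
  exact: prodm.
rewrite mulnCA leq_mul2l -expnD; apply/orP; right; apply: leq_pexp2l => //.
have : 0 < #|J| by rewrite card_gt0.
by move: #|J| Jk; lia.
Qed.

Hypothesis r0 : 0 < r.

Definition near_equal (n : nat) (j : 'I_r) : nat :=
  n %/ r + (j == Ordinal r0) * (n %% r).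

Lemma sum_near_equal n : \sum_j near_equal n j = n.
Proof.
rewrite big_split /= sum_nat_const card_ord (bigD1 (Ordinal r0)) //= ?eqxx mul1n.
by rewrite big1 ?addn0 => [|j /negbTE-> //]; rewrite mulnC -divn_eq.
Qed.

Lemma max_fk_attained n : exists nu : 'I_r -> nat, \sum_j nu j = n /\ max_fk n = fk k nu.
Proof.
have nun j : near_equal n j < n.+1 by rewrite ltnS -{2}(sum_near_equal n) (bigD1 j) //= leq_addr.
pose mu : {ffun 'I_r -> 'I_n.+1} := [ffun j => Ordinal (nun j)].
have [] := @eq_bigmax_cond _ (fun nu : {ffun 'I_r -> 'I_n.+1} => (\sum_(i < r) nu i)%N == n)
   (fun nu => fk k (fun i : 'I_r => nat_of_ord (nu i))).
  apply/card_gt0P; exists mu; rewrite unfold_in; apply/eqP; rewrite -[RHS](sum_near_equal n).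
  by apply: eq_bigr => j _; rewrite ffunE.
by move=> nu /eqP nun' eqm; exists (fun i => nat_of_ord (nu i)); split.
Qed.

Lemma fk_near_equal (n : nat) : 'C(r, k) * (n %/ r) ^ k <= fk k (near_equal n).
Proof.
rewrite /fk; apply: leq_trans (leq_addr _ _).
have -> : 'C(r, k) = #|[set I : {set 'I_r} | #|I| == k]| by rewrite card_draws card_ord.
rewrite -sum1dep_card big_distrl /=; apply: leq_sum => I /eqP Ik.
rewrite mul1n -Ik -prod_nat_const; apply: leq_prod => i _; exact: leq_addr.
Qed.
End MaxFk.

Section Increment.
Variables (R : realType) (r k : nat).
Hypotheses (k0 : (1 < k)%N) (kr : (k <= r)%N).

Lemma bernoulli_sub (x a : R) (j : nat) : 0 <= a -> a <= x ->
  x ^+ j.+1 - j.+1%:R * a * x ^+ j <= (x - a) ^+ j.+1.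
Proof.
move=> a0 ax; have x0 : 0 <= x by exact: le_trans ax.
elim: j => [|j IH]; first by rewrite !expr1 expr0 mul1r mulr1.
rewrite [(x - a) ^+ _]exprS; apply: le_trans (ler_wpM2l _ IH); last by rewrite subr_ge0.
rewrite -subr_ge0.
have -> : (x - a) * (x ^+ j.+1 - j.+1%:R * a * x ^+ j) - (x ^+ j.+2 - j.+2%:R * a * x ^+ j.+1) =
   j.+1%:R * a ^+ 2 * x ^+ j.
  by rewrite -[j.+2%:R]natr1 [x ^+ j.+2]exprS [x ^+ j.+1]exprS; ring.
by rewrite !mulr_ge0 ?exprn_ge0 // ?sqr_ge0.
Qed.

(** Add a point to an optimal nu.  By [sum_gain] some part gains at least
    k e_k / n, where e_k, the first sum of [fk], is at least its value at a balanced
    nu up to an error of lower order. *)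
Lemma max_fk_increment (d : R) : 0 < d -> exists N : nat, forall n : nat, (N <= n)%N ->
  (link_density R r k - d) * n.+1%:R ^+ k.-1 <= (max_fk r k n.+1)%:R - (max_fk r k n)%:R.
Proof.
move=> d0; have r0 : (0 < r)%N by lia.
have rp : 0 < r%:R :> R by rewrite ltr0n.
set ld := link_density R r k.
have ld0 : 0 <= ld by rewrite divr_ge0 // exprn_ge0.
pose K : R := ld * k%:R * (r%:R + 1) + k%:R * 4 ^+ r.
exists (r + (Num.truncn (K / d)).+1)%N => n hn.
have n0 : (0 < n)%N by apply: leq_trans hn; rewrite addnS.
set x : R := n.+1%:R; have x0 : 0 < x by rewrite ltr0n.
have xK : K <= d * x.
  rewrite mulrC -ler_pdivrMr //; apply: ltW; apply: lt_le_trans (truncnS_gt _) _.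
  by rewrite ler_nat; apply: leq_trans (leqW hn); exact: leq_addl.
have [nu [nun nuE]] := max_fk_attained k r0 n.
have inc j : (max_fk r k n + gain k nu j <= max_fk r k n.+1)%N.
  rewrite nuE; apply: leq_trans (fk_add_point k nu j) _.
  have -> : n.+1 = (\sum_i (nu i + (i == j)))%N.
    by rewrite big_split /= nun (bigD1 j) //= eqxx big1 ?addn0 ?addn1 // => i /negbTE->.
  exact: max_fk_ub.
have mono : (max_fk r k n <= max_fk r k n.+1)%N.
  by apply: leq_trans (inc (Ordinal r0)); exact: leq_addr.
have [dl|dl] := lerP ld d.
  apply: le_trans (_ : 0 <= _); last by rewrite subr_ge0 ler_nat.
  by rewrite pmulr_lle0 ?exprn_gt0 // subr_le0.
set G : R := (max_fk r k n.+1)%:R - (max_fk r k n)%:R.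
have gG j : (gain k nu j)%:R <= G.
  by rewrite lerBrDl -natrD ler_nat.
have G0 : 0 <= G by rewrite subr_ge0 ler_nat.
have kG : k%:R * (elem_sum k nu)%:R <= n%:R * G.
  rewrite -natrM -sum_gain natr_sum -nun natr_sum mulr_suml; apply: ler_sum => j _.
  by rewrite natrM; apply: ler_wpM2l.
have nule j : (nu j <= n)%N by rewrite -nun (bigD1 j) //= leq_addr.
have h1 : ('C(r, k) * (n %/ r) ^ k <= elem_sum k nu + 4 ^ r * n ^ k.-1)%N.
  apply: leq_trans (fk_near_equal k r0 n) _; apply: leq_trans _ (fk_le_elem_sum k n0 nule).
  by rewrite -nuE -{2}(sum_near_equal r0 n) max_fk_ub.
have h2 : x - (r%:R + 1) <= r%:R * (n %/ r)%:R.
  rewrite lerBlDr /x natr1 -natrM -natrD ler_nat.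
  have := ltn_ceil n r0; rewrite mulSn mulnC.
  by move: (r * (n %/ r))%N => w; lia.
have h3 : ld * (x - (r%:R + 1)) ^+ k <= k%:R * ('C(r, k) * (n %/ r) ^ k)%:R.
  have -> : k%:R * ('C(r, k) * (n %/ r) ^ k)%:R = ld * (r%:R * (n %/ r)%:R) ^+ k :> R.
    have kE : k = k.-1.+1 by rewrite prednK // ltnW.
    rewrite natrM natrX mulrA -natrM exprMn mulrA; congr (_ * _).
    have -> : (k * 'C(r, k) = r * 'C(r.-1, k.-1))%N.
      by rewrite {1 2}kE -mul_bin_diag; case: (r) r0.
    have -> : r%:R ^+ k = r%:R * r%:R ^+ k.-1 :> R by rewrite -exprS -kE.
    by rewrite natrM /ld /link_density mulrCA divfK // expf_neq0 // gt_eqF.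
  apply: ler_wpM2l => //; apply: lerXn2r => //; rewrite nnegrE ?mulr_ge0 //.
  rewrite subr_ge0 /x -natr1 lerD2r ler_nat; apply: leq_trans hn; exact: leq_addr.
have h4 : k%:R * ('C(r, k) * (n %/ r) ^ k)%:R <= n%:R * G + k%:R * 4 ^+ r * x ^+ k.-1.
  apply: le_trans (_ : k%:R * (elem_sum k nu + 4 ^ r * n ^ k.-1)%:R <= _).
    by apply: ler_wpM2l; rewrite ?ler_nat.
  rewrite natrD mulrDr; apply: lerD => //.
  rewrite natrM mulrA !natrX; apply: ler_wpM2l; first by rewrite mulr_ge0 // exprn_ge0.
  by apply: lerXn2r; rewrite ?nnegrE ?ler0n // ler_nat.
have h5 : ld * (x ^+ k - k%:R * (r%:R + 1) * x ^+ k.-1) <= ld * (x - (r%:R + 1)) ^+ k.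
  apply: ler_wpM2l => //; have -> : k = k.-1.+1 by rewrite prednK // ltnW.
  apply: bernoulli_sub; first by rewrite addr_ge0.
  rewrite /x -natr1 lerD2r ler_nat; apply: leq_trans hn; exact: leq_addr.
have xk : x ^+ k = x ^+ k.-1 * x by rewrite -exprSr prednK // ltnW.
have xk0 : 0 < x ^+ k.-1 by exact: exprn_gt0.
have h6 : (ld - d) * x ^+ k.-1 * x <= n%:R * G.
  have : K * x ^+ k.-1 <= d * x * x ^+ k.-1 by rewrite ler_pM2r.
  have := le_trans h5 (le_trans h3 h4); rewrite xk /K.
  move: (x ^+ k.-1) (n%:R * G) (4 ^+ r : R) (k%:R : R) (r%:R : R) => P Q V kk rr.
  by lra.
rewrite -(ler_pM2r x0); apply: le_trans h6 _; rewrite mulrC; apply: ler_wpM2l => //.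
by rewrite ler_nat.
Qed.
End Increment.

Section Main.
Variables (R : realType) (r k : nat).
Hypotheses (k4 : (4 <= k)%N) (kr : (k <= r)%N).

Lemma sum_circles (T : finType) (X Y : T -> 'I_r -> R) (s : R) : 0 < s ->
  (forall v, exists j, v \in circle X Y s j) -> (\sum_j #|circle X Y s j| = #|T|)%N.
Proof.
move=> s0 cov; under eq_bigr do rewrite -sum1_card.
rewrite (exchange_big_dep xpredT) //= -sum1_card; apply: eq_bigr => v _.
have [j vj] := cov v; rewrite (big_pred1 j) // => i; apply/idP/eqP => [vi|->//].
by have [] := circle_disj s0 vi vj.
Qed.

Lemma max_fk_le (n : nat) : (max_fk r k n <= max_simplices R k (2 * r) n)%N.
Proof.
have r0 : (0 < r)%N by lia.
have [nu [nun ->]] := max_fk_attained k r0 n.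
have nule j : (nu j <= n)%N by rewrite -nun (bigD1 j) //= leq_addr.
have [P [Pn h]] := lower_bound R nule k.
by apply: leq_trans h _; apply: max_simplices_ub; rewrite Pn.
Qed.

(** By [lenz_structure] and [card_lenz_simplices] an optimal set with more than
    [max_fk] simplices has a point of degree below the increment of [max_fk];
    remove it. *)
Lemma excess_grows : exists N : nat, forall n : nat, (N <= n)%N ->
  (max_fk r k n.+1 < max_simplices R k (2 * r) n.+1)%N ->
  (max_simplices R k (2 * r) n.+1 + max_fk r k n < max_simplices R k (2 * r) n + max_fk r k n.+1)%N.
Proof.
have [d d0 [M hM]] := lenz_structure R k4 kr.
have k1 : (1 < k)%N by exact: leq_trans k4.
have r0 : (0 < r)%N by lia.
have [N hN] := max_fk_increment k1 kr d0.
exists (M + N)%N => n hn lt.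
have [P0 [P0n _]] : exists P : {fset 'rV[R]_(2 * r)}, #|` P| = n.+1 /\
    (fk k (near_equal r0 n.+1) <= num_simplices k P)%N.
  have nule j : (near_equal r0 n.+1 j <= n.+1)%N.
    by rewrite -{2}(sum_near_equal r0 n.+1) (bigD1 j) //= leq_addr.
  by have := lower_bound R nule k; rewrite sum_near_equal.
have [P [Pn PS]] := max_simplices_attained k P0n.
pose p (x : P) := val x.
have p_inj : injective p by exact: val_inj.
have cT : #|{: P}| = n.+1 by rewrite -Pn cardfE.
have ptsT : pts p setT = P.
  apply/fsetP => x; apply/imfsetP/idP => [[y _ ->]|xP]; first exact: valP.
  by exists [` xP] => //=; rewrite inE.
have numP : num_simplices k P = #|simplices p k|.
  rewrite -{1}ptsT num_simplices_pts //; apply: eq_card => A.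
  by rewrite inE subsetT andbT.
have [v hv] : exists v, (simplex_degree p k v)%:R < (link_density R r k - d) * n.+1%:R ^+ k.-1.
  apply: contrapT => /forallNP hdeg.
  have [| |X [Y [s [fr s0 cov]]]] := hM P p p_inj.
  - by rewrite cT; apply: leq_trans (leqW hn); exact: leq_addr.
  - by move=> v; rewrite leNgt cT; apply/negP; exact: hdeg.
  move: lt; rewrite -PS numP; apply/negP; rewrite -leqNgt.
  apply: leq_trans (card_lenz_simplices p_inj fr s0 cov k4) _.
  by have := max_fk_ub k (fun j => #|circle X Y s j|); rewrite (sum_circles s0 cov) cT.
have numv : (num_simplices k (pts p (~: [set v])) + simplex_degree p k v = num_simplices k P)%N.
  rewrite numP num_simplices_pts // addnC -cardsUI [X in (_ + X)%N](_ : _ = 0%N); last first.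
    apply/eqP; rewrite cards_eq0; apply/eqP/setP => A; rewrite !inE; apply/negbTE/negP.
    move=> /andP[/andP[_ vA] /andP[_ /subsetP/(_ v vA)]].
    by rewrite !inE eqxx.
  rewrite addn0; apply: eq_card => A; rewrite in_setU !in_set -andb_orr.
  rewrite [A \subset _](_ : _ = (v \notin A)) ?orbN ?andbT //.
  by rewrite subsetC sub1set inE.
have numle : (num_simplices k (pts p (~: [set v])) <= max_simplices R k (2 * r) n)%N.
  apply: max_simplices_ub; rewrite card_pts //.
  by have := cardsC1 v; rewrite cT.
have incv : (simplex_degree p k v + max_fk r k n < max_fk r k n.+1)%N.
  have := lt_le_trans hv (hN n (leq_trans (leq_addl _ _) hn)).
  by rewrite ltrBrDr -natrD ltr_nat.
rewrite -PS -numv -addnA; apply: (@leq_trans (num_simplices k (pts p (~: [set v])) + max_fk r k n.+1)).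
  by rewrite -addnS leq_add2l.
by rewrite leq_add2r.
Qed.

End Main.

Theorem theorem5 (R : realType) (r k : nat) (hk : (4 <= k)%N) (hr : (k <= r)%N) :
  exists n0 : nat, forall n : nat, (n0 <= n)%N ->
    max_simplices R k (2 * r)%N n =
    (\max_(nu : {ffun 'I_r -> 'I_n.+1} | (\sum_(i < r) nu i)%N == n)
       fk k (fun i : 'I_r => nat_of_ord (nu i)))%N.
Proof.
have [N hN] := excess_grows R hk hr.
exists (N + (max_simplices R k (2 * r) N).+1)%N => n hn.
apply/eqP; rewrite eqn_leq max_fk_le // andbT leqNgt; apply/negP => lt.
have acc i : (max_fk r k (N + i) < max_simplices R k (2 * r) (N + i))%N ->
    (i + max_simplices R k (2 * r) (N + i) + max_fk r k N <=
     max_simplices R k (2 * r) N + max_fk r k (N + i))%N.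
  elim: i => [|i IH]; first by rewrite addn0 add0n.
  rewrite addnS => /[dup] h /(hN _ (leq_addr _ _)) h'.
  have : (max_fk r k (N + i) < max_simplices R k (2 * r) (N + i))%N by lia.
  by move/IH; lia.
have := acc (n - N)%N; rewrite subnKC; last by apply: leq_trans hn; exact: leq_addr.
move/(_ lt); move: lt hn; rewrite -/(max_fk r k n); lia.
Qed.
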